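(* Consider the sequential sampling design described in the context, with working models $\{\mathcal Q_n\}_{n\ge1}$, induced policy class $\Pi$, data $O_1,\dots,O_n$, functions $f_\pi$ ($\pi\in\Pi$) and process $\widetilde{\mathbb G}_n$. Suppose that $\{\mathcal Q_n\}_{n\ge1}$ is chosen in such a way that $\Pi$ is separable and $J_1(\eta_n,\Pi)=o(1)$ for any $\eta_n=o(1)$, where $J_1(\eta,\Pi)$ is the uniform entropy integral of $\Pi$, evaluated at $\eta$, with respect to the envelope function constantly equal to one. Let $\{\widehat{\mathcal V}(\pi):\pi\in\Pi\}$ be an estimator of $\{\mathcal V(\pi):\pi\in\Pi\}$ based on $O_1,\dots,O_n$ with $$\sup_{\pi\in\Pi}\left|n^{1/2}\bigl(\widehat{\mathcal V}(\pi)-\mathcal V(\pi)\bigr)-\widetilde{\mathbb G}_nf_\pi\right|=o_P(1),$$ and let $\widehat\pi\in\Pi$ be a data-dependent policy with $\widehat{\mathcal V}(\widehat\pi)\ge\sup_{\pi\in\Pi}\widehat{\mathcal V}(\pi)-o_P(n^{-1/2})$. Then $\mathcal R(\widehat\pi)=o_P(n^{-1/2})$.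
   Context: Reference law. $P$ is a distribution of $(X,A,Y)$, $X\in\mathcal X$, $A\in\{-1,1\}$, $Y\in[0,1]$, with $P(A=1\mid X)\in[\delta,1-\delta]$ a.s. for some $\delta\in(0,1/2)$; $\mathbb E$ is expectation under $P$. $\{(X_n,Z_n(-1),Z_n(1))\}_{n\ge1}$ are i.i.d. from a distribution $\mathbb P$, with $Z_n(\pm1)\in[0,1]$, such that if the $\tilde A_n$ are independently drawn from the conditional law of $A$ given $X=X_n$ under $P$, then $(X_n,\tilde A_n,Z_n(\tilde A_n))$ are i.i.d. from $P$. Design. $\{t_n\}$ and $\{\xi_n\}$ are nonincreasing with $t_1\le1/2$, $\lim_nt_n>0$, $\lim_n\xi_n>0$. For each $n$, $G_n:\mathbb R\to\mathbb R$ is nondecreasing and $\kappa_n$-Lipschitz with $G_n(u)=t_n$ for $u\le-\xi_n$, $G_n(0)=1/2$, $G_n(u)=1-t_n$ for $u\ge\xi_n$, and $\limsup_n\kappa_n<\infty$. For each $n$, $\mathcal Q_n=\{Q_\beta:\beta\in B_n\}$ is a class of functions $\{-1,1\}\times\mathcal X\to[0,1]$. The Rademacher law with parameter $p$ is the law on $\{-1,1\}$ giving mass $p$ to $1$. For some $n_0\ge1$ and $i\le n_0$, $A_i$ is drawn independently from the conditional law of $A$ given $X=X_i$ under $P$, and $g_i(a,x)=P(A=a\mid X=x)$. For $n>n_0$, given $O_1,\dots,O_{n-1}$, let $$\beta_n=\arg\min_{\beta\in B_n}\sum_{i=1}^{n-1}\frac{(Y_i-Q_\beta(A_i,X_i))^2}{g_i(A_i,X_i)},\qquad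 g_n(1,x)=1-g_n(-1,x)=G_n\bigl(Q_{\beta_n}(1,x)-Q_{\beta_n}(-1,x)\bigr),$$ and, conditionally on $O_1,\dots,O_{n-1}$ and $X_n$, draw $A_n$ from the Rademacher law with parameter $g_n(1,X_n)$. In all cases $Y_i=Z_i(A_i)$, $O_i=(X_i,A_i,Y_i)$, and $W_i=g_i(A_i,X_i)$. Policies. $\Pi$ is the set of policies $\pi_\beta(x)=\mathbf 1\{Q_\beta(1,x)\ge Q_\beta(-1,x)\}-\mathbf 1\{Q_\beta(1,x)<Q_\beta(-1,x)\}$, $\beta\in\bigcup_{n\ge1}B_n$. Value: $\mathcal V(\pi)=\mathbb E[\mathbb E[Y\mid A=\pi(X),X]]$; regret: $\mathcal R(\pi)=\sup_{\pi'\in\Pi}\mathcal V(\pi')-\mathcal V(\pi)$. Process. For $\pi\in\Pi$, $$f_\pi(o)=\frac{\mathbf 1\{a=\pi(x)\}}{P(A=a\mid X=x)}\bigl(y-\mathbb E[Y\mid A=a,X=x]\bigr)+\mathbb E[Y\mid A=\pi(x),X=x]-\mathcal V(\pi),$$ and $\mathcal F=\{f_\pi:\pi\in\Pi\}$, each $f\in\mathcal F$ being also regarded as a function of $(o,w)$ (not depending on $w$). For a function $g:\{-1,1\}\times\mathcal X\to[0,1]$ with $g(1,\cdot)+g(-1,\cdot)=1$, $\mathbb P^g$ is the law of $(O,W)$ obtained by drawing $(X,Z(-1),Z(1))\sim\mathbb P$, then $A$ from the Rademacher law with parameter $g(1,X)$, and setting $O=(X,A,Z(A))$, $W=g(A,X)$.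 Then $\widetilde{\mathbb G}_n\in\ell^\infty(\mathcal F)$ is $$\widetilde{\mathbb G}_nf=n^{-1/2}\sum_{i=1}^n\Bigl(f(O_i,W_i)-\mathbb E_{\mathbb P^{g_i}}[f(O_i,W_i)\mid O_1,\dots,O_{i-1}]\Bigr),$$ where $g_i$ is deterministic given $O_1,\dots,O_{i-1}$. Uniform entropy integral: $J_1(\eta,\Pi)=\int_0^\eta\sqrt{\sup_\mu\log N(\epsilon,\Pi,L^2(\mu))}\,d\epsilon$, with $N$ the covering number and the supremum over (finitely discrete) probability measures $\mu$ on $\mathcal X$. $o_P$ is with respect to the law of the data as $n\to\infty$. Measurability issues are disregarded. *)

(* Defs.v *)
From HB Require Import structures.
From mathcomp Require Import all_boot all_order all_algebra.
From mathcomp Require Import all_classical all_reals all_analysis.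
Set Implicit Arguments.
Unset Strict Implicit.
Unset Printing Implicit Defensive.
Import Order.TTheory GRing.Theory Num.Theory.
Import numFieldNormedType.Exports.
Local Open Scope classical_set_scope.
Local Open Scope ring_scope.

(* Treatments range over {-1, 1}, encoded as bool: true is 1, false is -1.
   [trt] is the embedding into the reals.  Observations o = (x, a, y) are
   left-nested triples, so that x = o.1.1, a = o.1.2, y = o.2.  A full-data
   point v = (x, z(-1), z(1)) has x = v.1.1, z(-1) = v.1.2, z(1) = v.2. *)
Notation obs X R := (X * bool * R)%type.
Notation fulldata X R := (X * R * R)%type.

Definition trt {R : pzRingType} (a : bool) : R := if a then 1 else -1.

Definition potential {X : Type} {R : Type} (v : fulldata X R) (a : bool) : R :=
  if a then v.2 else v.1.2.

Definition observe {X : Type} {R : Type} (v : fulldata X R) (a : bool)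
  : obs X R := (v.1.1, a, potential v a).

Section ReferenceLaw.
Context {d : measure_display} {X : measurableType d} {R : realType}.
Variable P : probability (obs X R) R.

(* [p] is a version of (a, x) |-> P(A = a | X = x). *)
Definition is_propensity (p : bool -> X -> R) : Prop :=
  [/\ forall a, measurable_fun setT (p a),
      forall a x, 0 <= p a x,
      forall x, p true x + p false x = 1 &
      forall (a : bool) (B : set X), measurable B ->
        (P [set o | B o.1.1 /\ o.1.2 = a] =
         \int[P]_(o in [set o | B o.1.1]) (p a o.1.1)%:E)%E].

(* [m] is a version of (a, x) |-> E[Y | A = a, X = x]. *)
Definition is_regression (m : bool -> X -> R) : Prop :=
  [/\ forall a, measurable_fun setT (m a),
      P.-integrable setT (fun o => (m o.1.2 o.1.1)%:E) &
      forall (a : bool) (B : set X), measurable B ->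
        (\int[P]_(o in [set o | B o.1.1 /\ o.1.2 = a]) (o.2)%:E =
         \int[P]_(o in [set o | B o.1.1 /\ o.1.2 = a]) (m a o.1.1)%:E)%E].

(* In [value], [regret] and [f_pol], [m] is meant to be a version of
   E[Y | A = ., X = .] and [p] a version of P(A = . | X = .). *)
Definition value (m : bool -> X -> R) (pi : X -> bool) : R :=
  fine 'E_P[fun o => m (pi o.1.1) o.1.1].

Definition regret (m : bool -> X -> R) (Pi : set (X -> bool))
    (pi : X -> bool) : \bar R :=
  (ereal_sup [set (value m pi')%:E | pi' in Pi] - (value m pi)%:E)%E.

Definition f_pol (p m : bool -> X -> R) (pi : X -> bool) (o : obs X R) : R :=
  let: (x, a, y) := o in
  (a == pi x)%:R / p a x * (y - m a x) + m (pi x) x - value m pi.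

End ReferenceLaw.

(* The law of (O, W): draw v = (X, Z(-1), Z(1)) from [PP], then A from the
   Rademacher law with parameter g(1, X) (that is, [bernoulli_prob] in the
   encoding of treatments by bool), and set O = (X, A, Z(A)), W = g(A, X). *)
Definition sampling_law {d : measure_display} {X : measurableType d}
    {R : realType} (PP : probability (fulldata X R) R) (g : bool -> X -> R)
    (C : set (obs X R * R)) : \bar R :=
  (\int[PP]_v bernoulli_prob (g true v.1.1)
     [set a | C (observe v a, g a v.1.1)])%E.

Section Policies.
Context {X : Type} {R : realType} {I : Type}.
Variables (Q : I -> bool -> X -> R) (B : nat -> set I).

Definition greedy (q : bool -> X -> R) (x : X) : bool :=
  q false x <= q true x.

Lemma trt_greedy (q : bool -> X -> R) (x : X) :
  trt (greedy q x) =
  (q false x <= q true x)%R%:R - (q true x < q false x)%R%:R :> R.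
Proof.
rewrite /trt /greedy; case: (leP (q false x) (q true x)) => _.
  by rewrite subr0.
by rewrite sub0r.
Qed.

Definition policies : set (X -> bool) :=
  [set greedy (Q b) | b in \bigcup_n B n].

End Policies.

Section Entropy.
Context {X : Type} {R : realType}.

(* The L^2(mu) distance for the finitely discrete mu putting mass [w i] at
   [x i]; the points need not be distinct. *)
Definition L2dist k (x : 'I_k -> X) (w : 'I_k -> R) (f g : X -> R) : R :=
  Num.sqrt (\sum_i w i * (f (x i) - g (x i)) ^+ 2).

(* Minimal number of open balls of radius [eps] covering [F]; the centers need
   not belong to [F], and the value is +oo when no finite cover exists. *)
Definition covering_number (eps : R) (F : set (X -> R))
    k (x : 'I_k -> X) (w : 'I_k -> R) : \bar R :=
  ereal_inf [set n%:R%:E | n in [set n : nat | exists c : 'I_n -> X -> R,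
    forall f, F f -> exists i, L2dist x w f (c i) < eps]].

Definition uniform_entropy (eps : R) (F : set (X -> R)) : \bar R :=
  ereal_sup [set h | exists k (x : 'I_k -> X) (w : 'I_k -> R),
    [/\ forall i, 0 <= w i, \sum_i w i = 1 &
        h = lne (covering_number eps F x w)]].

Definition J1 (eta : R) (F : set (X -> R)) : \bar R :=
  (\int[lebesgue_measure]_(eps in `[0%R, eta]) (uniform_entropy eps F `^ 2^-1))%E.

(* Policies regarded as {-1, 1}-valued functions. *)
Definition pm_class (Pi : set (X -> bool)) : set (X -> R) :=
  [set (fun x => trt (pi x)) | pi in Pi].

(* Separability in the sense of empirical process theory: every element is the
   pointwise limit of a sequence drawn from one fixed countable subclass. *)
Definition separable_class (F : set (X -> R)) : Prop :=
  exists F0 : set (X -> R), [/\ F0 `<=` F, countable F0 &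
    forall f, F f -> exists2 u : nat -> X -> R, forall k, F0 (u k) &
      forall x, u k x @[k --> \oo] --> f x].

End Entropy.

(* [oP Pr T r] is T_n = o_P(r_n), for nonnegative r_n.  Measurability of T_n is
   not assumed, so the probability is the outer one. *)
Definition oP {d : measure_display} {Omega : measurableType d} {R : realType}
    (Pr : probability Omega R) (T : nat -> Omega -> \bar R) (r : nat -> R)
  : Prop :=
  forall e : R, 0 < e ->
    (mu_ext Pr [set w | ((e * r n)%:E < `|T n w|)%E] @[n --> \oo] --> 0%E).

(* Sequences are indexed from 0: what is indexed by n + 1 in the 1-based
   convention is indexed by n here, and a sample of size n consists of the
   observations of index i < n. *)
Record tuning {R : realType} (t xi kappa : nat -> R) (G : nat -> R -> R)
  : Prop := {
  tuning_t_noninc : nonincreasing_seq t;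
  tuning_xi_noninc : nonincreasing_seq xi;
  tuning_t0 : t 0%N <= 2^-1;
  tuning_t_lim : exists2 l : R, 0 < l & t @ \oo --> l;
  tuning_xi_lim : exists2 l : R, 0 < l & xi @ \oo --> l;
  tuning_nondec : forall n, {homo G n : u v / u <= v};
  tuning_lip : forall n, (kappa n).-lipschitz (G n : R^o -> R^o);
  tuning_low : forall n u, u <= - xi n -> G n u = t n;
  tuning_mid : forall n, G n 0 = 2^-1;
  tuning_high : forall n u, xi n <= u -> G n u = 1 - t n;
  tuning_kappa : (limn_esup (EFin \o kappa) < +oo)%E }.

Section Design.
Context {dX dO : measure_display} {X : measurableType dX}
  {Omega : measurableType dO} {R : realType} {I : Type}.
Variables (Pr : probability Omega R) (PP : probability (fulldata X R) R).
Variables (V : nat -> {RV Pr >-> fulldata X R}) (A : nat -> {RV Pr >-> bool}).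
Variables (p : bool -> X -> R) (n0 : nat) (G : nat -> R -> R).
Variables (Q : I -> bool -> X -> R) (B : nat -> set I).
Variable (beta : forall n : nat, n.-tuple (obs X R) -> I).
Arguments beta : clear implicits.

(* The V_n = (X_n, Z_n(-1), Z_n(1)) are independent with common law [PP]. *)
Definition iid_from : Prop :=
  forall (N : nat) (C : 'I_N -> set (fulldata X R)),
    (forall i, measurable (C i)) ->
    Pr (\bigcap_(i in [set: 'I_N]) (V i @^-1` C i)) = (\prod_(i < N) PP (C i))%E.

Definition obs_at (n : nat) (w : Omega) : obs X R := observe (V n w) (A n w).

(* The observations of index < n. *)
Definition data (n : nat) (w : Omega) : n.-tuple (obs X R) :=
  [tuple obs_at i w | i < n].

(* At time n the fitted index is [beta n] applied to the past observations. *)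
Definition g_ (n : nat) (w : Omega) (a : bool) (x : X) : R :=
  if (n < n0)%N then p a x else
  let q := Q (beta n (data n w)) in
  let g1 := G n (q true x - q false x) in
  if a then g1 else 1 - g1.

Definition weight_at (n : nat) (w : Omega) : R := g_ n w (A n w) (V n w).1.1.

Definition weighted_loss (n : nat) (w : Omega) (b : I) : R :=
  \sum_(i < n) (let: (x, a, y) := obs_at i w in (y - Q b a x) ^+ 2 / g_ i w a x).

(* Generated by all the full data and the treatments of index < n. *)
Definition sigma_before (n : nat) : set (set Omega) :=
  <<s [set E | (exists j C, measurable C /\ E = V j @^-1` C) \/
               (exists j b, (j < n)%N /\ E = A j @^-1` [set b])] >>.

Record sequential_design : Prop := {
  design_argmin : forall n w, (n0 <= n)%N ->
    B n (beta n (data n w)) /\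
    forall b, B n b ->
      weighted_loss n w (beta n (data n w)) <= weighted_loss n w b;
  design_meas : forall n a, (n0 <= n)%N ->
    measurable_fun setT
      (fun hx : n.-tuple (obs X R) * X => Q (beta n hx.1) a hx.2);
  (* A_n is drawn by an auxiliary randomization whose law depends only on the
     earlier observations and X_n: the Rademacher law with parameter
     g_n(1, X_n) is its conditional law even given all the full data and the
     earlier treatments. *)
  design_draw : forall n E, sigma_before n E ->
    (Pr (E `&` A n @^-1` [set true]) =
     \int[Pr]_(w in E) (g_ n w true (V n w).1.1)%:E)%E }.

(* [g_ i w] is determined by the observations of index < i, so the conditional
   expectation given these is an integral against [sampling_law PP (g_ i w)]. *)
Definition Gtilde (n : nat) (w : Omega) (f : obs X R * R -> R) : R :=
  (Num.sqrt n%:R)^-1 * \sum_(i < n)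
    (f (obs_at i w, weight_at i w) -
     fine (\int[sampling_law PP (g_ i w)]_ow (f ow)%:E)%E).

End Design.

(* Main.v *)
(* Write S_n for sqrt n times the centered process.  With the propensity split
   as 1{a = pi(x)} = (1 + a pi(x)) / 2, an increment S_n(f_pi) - S_n(f_pi') is
   the sum of a martingale, whose i-th term is (pi - pi')(X_i) times a noise
   term, bounded and centered given X_i, and of a centered sum of i.i.d. terms
   (pi - pi')(X_i) b(X_i) with b bounded.  Given all the covariates, the noise
   terms are jointly sub-Gaussian, because the design at time i depends on the
   outcomes only through the past; the i.i.d. part is sub-Gaussian after
   symmetrization.  Both are therefore controlled by one chaining argument over
   the traces of the policy class on X_1, ..., X_n, whose covers are provided by
   the uniform entropy.  Empirical L^2 distances are replaced by true ones at
   the cost of a uniform law of large numbers for the squared differences, which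
   also shows that the class is totally bounded in L^2(P).

   Hence the process is asymptotically equicontinuous, its increments are
   o_P(sqrt n), and hat pi is consistent: V(hat pi) tends to the supremum Vs of
   the value.  Total boundedness then gives near-maximizers pi' of V within any
   prescribed distance of hat pi, even if the supremum is not attained or is
   approached at several places.  Comparing hat pi with such a pi', the linear
   expansion of the value estimator leaves only the increment of the process
   between pi' and hat pi, which is negligible by equicontinuity. *)

Require Import Defs.
From HB Require Import structures.
From mathcomp Require Import all_boot all_order all_algebra.
From mathcomp Require Import all_classical all_reals all_analysis.
From mathcomp Require Import measurable_realfun ring lra.
Set Implicit Arguments.
Unset Strict Implicit.
Unset Printing Implicit Defensive.
Import Order.TTheory GRing.Theory Num.Theory.
Import numFieldNormedType.Exports.
Local Open Scope classical_set_scope.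
Local Open Scope ring_scope.

(** * Means of bounded measurable functions *)

(** The obstacle is to condition on all the covariates at once while the design keeps adapting to
    the outcomes. No conditional law is built. The noise at time [k] is shown orthogonal to a
    sigma-algebra that hides only the outcomes of time [k]: replacing each earlier treatment by its
    draw probability never reveals them. Conditioning on the covariates becomes a sum over the
    finitely many events on which the policies of a finite family have prescribed values at the
    sample points. Accordingly, chaining is carried out pointwise, as a domination by exponentials
    of linear forms, and integrated afterwards, once against random signs and once against the noise
    on each such event. Suprema run over finite subfamilies of a countable dense family, with bounds
    free of their size; monotone limits and pointwise density then reach the whole class, with
    measurable exceptional events. Since [p] and [m] are only versions, they are replaced by
    truncations bounded everywhere, which agree with them at almost every full-data point. *)

Definition bmeas d (T : measurableType d) (R : realType) (f : T -> R) : Prop :=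
  measurable_fun setT f /\ exists K, forall x, `|f x| <= K.

Definition mean d (T : measurableType d) (R : realType)
  (mu : probability T R) (f : T -> R) : R := \int[mu]_x f x.

Section BoundedMeasurable.
Context d (T : measurableType d) (R : realType).
Implicit Types (f g : T -> R).

Lemma bmeas_cst (r : R) : bmeas (fun _ : T => r).
Proof. by split=> //; exists `|r|. Qed.

Lemma bmeasD f g : bmeas f -> bmeas g -> bmeas (fun x => f x + g x).
Proof.
move=> [mf [K Kf]] [mg [L Lg]]; split; first exact: measurable_funD.
exists (K + L) => x; apply: (le_trans (ler_normD _ _)); exact: lerD.
Qed.

Lemma bmeasN f : bmeas f -> bmeas (fun x => - f x).
Proof.
move=> [mf [K Kf]]; split; last by exists K => x; rewrite normrN.
exact: measurableT_comp.
Qed.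

Lemma bmeasB f g : bmeas f -> bmeas g -> bmeas (fun x => f x - g x).
Proof. by move=> bf bg; apply: bmeasD => //; exact: bmeasN. Qed.

Lemma bmeasM f g : bmeas f -> bmeas g -> bmeas (fun x => f x * g x).
Proof.
move=> [mf [K Kf]] [mg [L Lg]]; split; first exact: measurable_funM.
by exists (K * L) => x; rewrite normrM ler_pM.
Qed.

Lemma bmeasZ r f : bmeas f -> bmeas (fun x => r * f x).
Proof. by move=> bf; apply: bmeasM => //; exact: bmeas_cst. Qed.

Lemma bmeas_norm f : bmeas f -> bmeas (fun x => `|f x|).
Proof.
move=> [mf [K Kf]]; split; last by exists K => x; rewrite normr_id.
exact: measurableT_comp.
Qed.

Lemma bmeas_max f g : bmeas f -> bmeas g -> bmeas (fun x => Num.max (f x) (g x)).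
Proof.
move=> [mf [K Kf]] [mg [L Lg]]; split; first exact: measurable_maxr.
exists (Num.max K L) => x; rewrite /Num.max; case: ifPn => _.
  by rewrite (le_trans (Lg x))// le_max lexx orbT.
by rewrite (le_trans (Kf x))// le_max lexx.
Qed.

Lemma bmeas_sum I (r : seq I) (P : pred I) (F : I -> T -> R) :
  (forall i, P i -> bmeas (F i)) -> bmeas (fun x => \sum_(i <- r | P i) F i x).
Proof.
move=> bF; elim: r => [|i r IH].
  by under eq_fun do rewrite big_nil; exact: bmeas_cst.
under eq_fun do rewrite big_cons.
by case: (boolP (P i)) => Pi //; apply: bmeasD => //; exact: bF.
Qed.

Lemma bmeas_bigmax I (r : seq I) (P : pred I) (F : I -> T -> R) (c : R) :
  (forall i, P i -> bmeas (F i)) ->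
  bmeas (fun x => \big[Num.max/c]_(i <- r | P i) F i x).
Proof.
move=> bF; elim: r => [|i r IH].
  by under eq_fun do rewrite big_nil; exact: bmeas_cst.
under eq_fun do rewrite big_cons.
by case: (boolP (P i)) => Pi //; apply: bmeas_max => //; exact: bF.
Qed.

Lemma bmeas_indic (E : set T) : measurable E -> bmeas (\1_E : T -> R).
Proof.
move=> mE; split; first exact: measurable_indic.
by exists 1 => x; rewrite indicE; case: (_ \in _); rewrite ?normr1 ?normr0.
Qed.

Lemma bmeas_expR f : bmeas f -> bmeas (fun x => expR (f x)).
Proof.
move=> [mf [K Kf]]; split; first by apply: measurableT_comp => //.
exists (expR K) => x; rewrite ger0_norm ?expR_ge0// ler_expR.
exact: le_trans (ler_norm _) (Kf x).
Qed.

Lemma bmeas_comp d' (U : measurableType d') (f : U -> R) (h : T -> U) :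
  bmeas f -> measurable_fun setT h -> bmeas (f \o h).
Proof.
move=> [mf [K Kf]] mh; split; first exact: measurableT_comp.
by exists K => x /=.
Qed.

Lemma bmeas_natr (h : T -> bool) : measurable_fun setT h ->
  bmeas (fun x => (h x)%:R : R).
Proof.
move=> mh; split; last first.
  by exists 1 => x; case: (h x); rewrite ?normr1 ?normr0.
rewrite (_ : (fun _ => _) = (fun x => if h x then 1 else 0)); last first.
  by apply/funext => x; case: (h x).
exact: measurable_fun_ifT.
Qed.

Variable mu : probability T R.

Lemma bmeas_integrable f : bmeas f -> mu.-integrable setT (EFin \o f).
Proof.
move=> [mf [K Kf]]; apply: measurable_bounded_integrable => //.
  by rewrite -ge0_fin_numE// fin_num_measure.
exists K; split; first by rewrite num_real.
by move=> x Kx y _ /=; rewrite (le_trans (Kf _))// ltW.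
Qed.

Lemma meanD f g : bmeas f -> bmeas g ->
  mean mu (fun x => f x + g x) = mean mu f + mean mu g.
Proof. by move=> bf bg; rewrite /mean RintegralD//; exact: bmeas_integrable. Qed.

Lemma meanB f g : bmeas f -> bmeas g ->
  mean mu (fun x => f x - g x) = mean mu f - mean mu g.
Proof. by move=> bf bg; rewrite /mean RintegralB//; exact: bmeas_integrable. Qed.

Lemma meanZ r f : bmeas f -> mean mu (fun x => r * f x) = r * mean mu f.
Proof. by move=> bf; rewrite /mean RintegralZl//; exact: bmeas_integrable. Qed.

Lemma mean_cst r : mean mu (fun=> r) = r.
Proof. by rewrite /mean Rintegral_cst//= (_ : _ setT = 1%E) ?mulr1//; exact: probability_setT. Qed.

Lemma le_mean f g : bmeas f -> bmeas g -> (forall x, f x <= g x) ->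
  mean mu f <= mean mu g.
Proof. by move=> bf bg fg; apply: le_Rintegral => //; exact: bmeas_integrable. Qed.

Lemma mean_ge0 f : (forall x, 0 <= f x) -> 0 <= mean mu f.
Proof. by move=> f0; apply: Rintegral_ge0. Qed.

Lemma mean_norm f : bmeas f -> `|mean mu f| <= mean mu (fun x => `|f x|).
Proof. by move=> bf; apply: le_normr_Rintegral => //; exact: bmeas_integrable. Qed.

Lemma mean_sum I (r : seq I) (P : pred I) (F : I -> T -> R) :
  (forall i, P i -> bmeas (F i)) ->
  mean mu (fun x => \sum_(i <- r | P i) F i x) = \sum_(i <- r | P i) mean mu (F i).
Proof.
move=> bF; elim: r => [|i r IH].
  by under [X in mean _ X]eq_fun do rewrite big_nil; rewrite mean_cst big_nil.
under [X in mean _ X]eq_fun do rewrite big_cons.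
rewrite big_cons; case: (boolP (P i)) => Pi //.
by rewrite meanD ?IH//; [exact: bF|exact: bmeas_sum].
Qed.

Lemma mean_indic E : measurable E -> mean mu \1_E = fine (mu E).
Proof. by move=> mE; rewrite /mean /Rintegral integral_indic// setIT. Qed.

Lemma norm_mean_le f K : bmeas f -> (forall x, `|f x| <= K) -> `|mean mu f| <= K.
Proof.
move=> bf fK; apply: (le_trans (mean_norm bf)).
rewrite -[leRHS](mean_cst K); apply: le_mean => //; first exact: bmeas_norm.
exact: bmeas_cst.
Qed.

Lemma eq_mean f g : f =1 g -> mean mu f = mean mu g.
Proof. by move=> /funext ->. Qed.

Lemma ae_eq_mean f g : measurable_fun setT f -> measurable_fun setT g ->
  {ae mu, forall x, f x = g x} -> mean mu f = mean mu g.
Proof.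
move=> mf mg fg; rewrite /mean /Rintegral; congr fine.
apply: ae_eq_integral => //; try exact/measurable_EFinP.
by apply: filterS fg => x /= -> _.
Qed.

End BoundedMeasurable.

Arguments bmeas_indic {d T R} [E].

(** [W + K] is rounded down to the grid of mesh [1/(n+1) <= e], and the sets are its level sets.
    They are measurable for whatever sigma-algebra makes [W] measurable, which matters when [T]
    carries a generated one. *)
Lemma simple_approx d (T : measurableType d) (R : realType) (W : T -> R) (K e : R) :
  measurable_fun setT W -> (forall x, `|W x| <= K) -> 0 < e ->
  exists M (c : 'I_M -> R) (S : 'I_M -> set T), (forall i, measurable (S i)) /\
    forall x, `|W x - \sum_i c i * \1_(S i) x| <= e.
Proof.
move=> mW WK e0.
have W0 x : 0 <= W x + K by rewrite -lerBlDr sub0r; have /ler_normlP[] := WK x; lra.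
pose n := Num.trunc e^-1.
have ne : n.+1%:R^-1 <= e.
  by rewrite -[leRHS]invrK lef_pV2 ?posrE ?invr_gt0// ltW// truncnS_gt.
pose tr x := Num.trunc ((W x + K) * n.+1%:R).
have [N NK] : exists N : nat, 2 * K < N%:R.
  by exists (Num.trunc (2 * K)).+1; exact: truncnS_gt.
pose S (i : nat) : set T := [set x | tr x = i].
have mS i : measurable (S i).
  have -> : S i = [set x |
     (i%:R <= (W x + K) * n.+1%:R) && ((W x + K) * n.+1%:R < i.+1%:R)].
    apply/seteqP; split=> x /=; rewrite /S /tr /=.
      move=> <-; exact: truncn_itv (mulr_ge0 (W0 x) _).
    by move/truncn_def.
  have mWn : measurable_fun setT (fun x => (W x + K) * n.+1%:R).
    by apply: measurable_funM => //; apply: measurable_funD.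
  have mc (r : R) : measurable_fun setT (fun _ : T => r) by [].
  have := measurable_and (measurable_fun_ler (mc i%:R) mWn)
    (measurable_fun_ltr mWn (mc i.+1%:R)).
  by move=> /(_ measurableT [set true] I); rewrite setTI.
(* Index 0 carries the constant [- K] on the whole space; index [1 + i] carries the level
   [i / (n+1)]. *)
exists (1 + N * n.+1)%N.
exists (fun i => match fintype.split i with inl _ => - K | inr i => i%:R / n.+1%:R end).
exists (fun i => match fintype.split i with inl _ => setT | inr i => S i end).
split=> [i|x]; first by case: fintype.split.
rewrite big_split_ord /= big_ord1 (unsplitK (inl ord0)) indicT mulr1.
have -> : \sum_(i < N * n.+1)
    match fintype.split (rshift 1 i) with inl _ => - K | inr i => i%:R / n.+1%:R end *
    \1_(match fintype.split (rshift 1 i) with inl _ => setT | inr i => S i end) x =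
    (tr x)%:R / n.+1%:R.
  have trN : (tr x < N * n.+1)%N.
    rewrite truncn_lt_nat; last by rewrite mulr_ge0.
    rewrite natrM ltr_pM2r ?ltr0Sn//; apply: le_lt_trans NK.
    by have := WK x; rewrite ler_norml => /andP[_]; lra.
  rewrite (bigD1 (Ordinal trN))//= (unsplitK (inr _)) big1 ?addr0 => [|i itr].
    by rewrite indicE mem_set ?mulr1.
  rewrite (unsplitK (inr _)) indicE memNset ?mulr0// /S /= => tri.
  by move/eqP: itr; apply; apply/val_inj.
apply: le_trans ne; rewrite opprD opprK addrA.
have /andP[] := truncn_itv (mulr_ge0 (W0 x) (ler0n R n.+1)); rewrite -/(tr x).
rewrite -ler_pdivrMr ?ltr0Sn// -ltr_pdivlMr ?ltr0Sn// => a b.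
rewrite ger0_norm ?subr_ge0// lerBlDl (le_trans (ltW b))//.
by rewrite -(@natr1 R (tr x)) mulrDl mul1r.
Qed.

(** * Orthogonality to a generated sigma-algebra, in place of conditional expectations *)

Section Orthogonality.
Context d (T : measurableType d) (R : realType) (mu : probability T R).
Variables (H : set (set T)) (Y : T -> R).
Hypothesis bY : bmeas Y.

Lemma mean_indicM_eq0 (E : set T) : measurable E ->
  mean mu (fun x => Y x * \1_E x) = 0 <-> (\int[mu]_(x in E) (Y x)%:E = 0)%E.
Proof.
move=> mE; have bYE := bmeasM bY (bmeas_indic mE).
have -> : (\int[mu]_(x in E) (Y x)%:E = \int[mu]_x (Y x * \1_E x)%:E)%E.
  rewrite integral_mkcond; apply: eq_integral => x _.
  by rewrite restrict_EFin patch_indic.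
have := integrable_fin_num measurableT (bmeas_integrable mu bYE).
rewrite /mean /Rintegral; case: (integral _ _ _) => //= r _.
by split=> [->|[]].
Qed.

Lemma orth_sigma : setI_closed H -> (forall E, H E -> measurable E) ->
  mean mu Y = 0 -> (forall E, H E -> mean mu (fun x => Y x * \1_E x) = 0) ->
  forall E, <<s H >> E -> measurable E /\ mean mu (fun x => Y x * \1_E x) = 0.
Proof.
move=> HI Hm Y0 HY E; rewrite -setI_closed_g_dynkin_g_sigma_algebra//.
move=> /(_ [set F | measurable F /\ mean mu (fun x => Y x * \1_F x) = 0]).
apply; split; last by move=> F HF; split; [exact: Hm|exact: HY].
split.
- split=> //; rewrite -[RHS]Y0; apply: eq_mean => x.
  by rewrite indicT mulr1.
- move=> F [mF YF]; split; first exact: measurableC.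
  transitivity (mean mu (fun x => Y x - Y x * \1_F x)).
    apply: eq_mean => x; rewrite !indicE in_setC.
    by case: (_ \in _); rewrite ?mulr1 ?mulr0 ?subrr ?subr0.
  rewrite meanB// ?Y0 ?YF ?subrr//.
  by apply: bmeasM => //; exact: bmeas_indic.
- move=> F tF FP; have mF k : measurable (F k) by have [] := FP k.
  have mU : measurable (\bigcup_k F k) by exact: bigcup_measurable.
  split=> //; apply/mean_indicM_eq0 => //.
  rewrite integral_bigcup//; last first.
    by apply: integrableS (bmeas_integrable mu bY).
  rewrite eseries0// => i _ _.
  by apply/mean_indicM_eq0; have [] := FP i.
Qed.

(** Uniform approximation of [W] by steps over sets of [<<s H >>] carries the orthogonality from
    events to functions. This is the tested form of a vanishing conditional expectation of [Y] given
    [H]. *)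
Lemma orth_bounded (W : g_sigma_algebraType H -> R) (K : R) :
  (forall E, <<s H >> E -> measurable E /\ mean mu (fun x => Y x * \1_E x) = 0) ->
  measurable_fun setT W -> (forall x, `|W x| <= K) ->
  mean mu (fun x => Y x * W x) = 0.
Proof.
move=> HP mW WK.
have bW : bmeas (W : T -> R).
  split; last by exists K.
  by move=> _ B mB; have [] := HP _ (mW measurableT B mB).
have [L YL] := bY.2.
have L0 : 0 <= L by exact: le_trans (YL point).
apply/eqP; rewrite -normr_le0; apply/ler_addgt0Pl => e e0; rewrite addr0.
have e0' : 0 < e / (L + 1) by rewrite divr_gt0// ltr_wpDl.
have [M [c [S [mS SW]]]] := simple_approx mW WK e0'.
have bS i : bmeas (\1_(S i) : T -> R) by apply: bmeas_indic; apply (HP _ (mS i)).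
pose Wn (x : T) := \sum_i c i * \1_(S i) x.
have bWn : bmeas Wn by apply: bmeas_sum => i _; exact: bmeasZ.
have M0 : mean mu (fun x => Y x * Wn x) = 0.
  transitivity (mean mu (fun x => \sum_i c i * (Y x * \1_(S i) x))).
    by apply: eq_mean => x; rewrite /Wn mulr_sumr; apply: eq_bigr => i _; rewrite mulrCA.
  rewrite mean_sum => [|i _]; last by apply: bmeasZ; exact: bmeasM.
  by rewrite big1// => i _; rewrite meanZ ?(HP _ (mS i)).2 ?mulr0//; exact: bmeasM.
rewrite -[X in `|X|]subr0 -[X in _ - X]M0 -meanB; try exact: bmeasM.
apply: norm_mean_le => [|x]; first by apply: bmeasB; exact: bmeasM.
rewrite -mulrBr normrM; apply: le_trans (_ : L * (e / (L + 1)) <= _).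
  by apply: ler_pM => //; exact: SW.
by rewrite mulrA ler_pdivrMr ?ltr_wpDl// mulrC ler_pM2l// lerDl.
Qed.

End Orthogonality.

(** * Chaining under sub-Gaussian domination *)

Section Chaining.
Context {R : realType}.

Definition dot n (c e : 'I_n -> R) : R := \sum_i c i * e i.

(* [F] lies below a nonnegative combination of exponentials of linear forms
   whose value, after each exponential has been replaced by its sub-Gaussian
   bound with parameter [K], is at most [b].  Any expectation under which
   linear forms in [e] are K-sub-Gaussian therefore maps [F] below [b]. *)
Definition subgauss_dominated (K : R) n (F : ('I_n -> R) -> R) (b : R) : Prop :=
  exists (L : finType) (a0 : R) (al : L -> R) (c : L -> 'I_n -> R),
  [/\ forall l, 0 <= al l,
      forall e, F e <= a0 + \sum_l al l * expR (dot (c l) e) &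
      a0 + \sum_l al l * expR (K ^+ 2 * dot (c l) (c l) / 2) <= b].

Implicit Types (K : R) (n : nat).

Lemma subgauss_dominatedD K n (F G : ('I_n -> R) -> R) b1 b2 :
  subgauss_dominated K F b1 -> subgauss_dominated K G b2 ->
  subgauss_dominated K (fun e => F e + G e) (b1 + b2).
Proof.
move=> [L [a0 [al [c [al0 Fle Fb]]]]] [L' [a0' [al' [c' [al0' Gle Gb]]]]].
exists (L + L')%type, (a0 + a0').
exists (fun l => match l with inl l => al l | inr l => al' l end).
exists (fun l => match l with inl l => c l | inr l => c' l end).
split=> [[]//|e|]; rewrite big_sumType /= addrACA; exact: lerD.
Qed.

Lemma le_subgauss_dominated K n (F G : ('I_n -> R) -> R) b1 b2 :
  (forall e, G e <= F e) -> b1 <= b2 ->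
  subgauss_dominated K F b1 -> subgauss_dominated K G b2.
Proof.
move=> GF b12 [L [a0 [al [c [al0 Fle Fb]]]]]; exists L, a0, al, c.
by split=> // [e|]; [exact: le_trans (GF e) (Fle e)|exact: le_trans Fb b12].
Qed.

Lemma dotZl n (x : R) (c e : 'I_n -> R) :
  dot (fun i => x * c i) e = x * dot c e.
Proof. by rewrite /dot mulr_sumr; apply: eq_bigr => i _; rewrite mulrA. Qed.

Lemma dotB n (c c' e : 'I_n -> R) :
  dot (fun i => c i - c' i) e = dot c e - dot c' e.
Proof. by rewrite /dot -sumrB; apply: eq_bigr => i _; rewrite mulrBl. Qed.

Lemma dotZ n (x : R) (c : 'I_n -> R) :
  dot (fun i => x * c i) (fun i => x * c i) = x ^+ 2 * dot c c.
Proof. by rewrite /dot mulr_sumr; apply: eq_bigr => i _; ring. Qed.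

Lemma dot_le2 n (x y z : 'I_n -> R) (b b' : R) :
  dot (fun i => x i - y i) (fun i => x i - y i) <= b ->
  dot (fun i => y i - z i) (fun i => y i - z i) <= b' ->
  dot (fun i => x i - z i) (fun i => x i - z i) <= 2 * (b + b').
Proof.
move=> xy yz; apply: le_trans (_ : 2 * (dot (fun i => x i - y i) (fun i => x i - y i)
  + dot (fun i => y i - z i) (fun i => y i - z i)) <= _); last first.
  by rewrite ler_pM2l// lerD.
rewrite /dot -big_split mulr_sumr /=; apply: ler_sum => i _.
rewrite -subr_ge0; set a := x i; set b0 := y i; set c := z i.
rewrite [leRHS](_ : _ = ((a - b0) - (b0 - c)) ^+ 2) ?sqr_ge0//; ring.
Qed.

Lemma expR_normr_le (x : R) : expR `|x| <= expR x + expR (- x).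
Proof.
have [x0|x0] := lerP 0 x; first by rewrite ger0_norm// lerDl expR_ge0.
by rewrite ltr0_norm// lerDr expR_ge0.
Qed.

(** Tangent of the exponential at [ln D]: [la |x| <= ln D - 1 + exp(la |x|) / D]. With [la] such
    that the sub-Gaussian bound of [exp(la x)] is at most [3 B], and [D = (3 B)^2], the main term
    [ln D / la] is the stated bound, and the excess [(1 + 6 B #|A|) / D] is at most 1 since
    [B >= 1], so the [- 1] absorbs it. *)
Lemma subgauss_dominated_max K n (J : finType) (A : {set J}) (v : J -> 'I_n -> R)
    (s B : R) : 0 < K -> 0 < s -> 1 <= B -> #|A|%:R <= B ->
  (forall l, l \in A -> dot (v l) (v l) <= s ^+ 2) ->
  subgauss_dominated K
    (fun e => \big[Num.max/0]_(l in A) `|dot (v l) e|)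
    (K * s * Num.sqrt (2 * ln (3 * B))).
Proof.
move=> K0 s0 B1 AB vs.
have B0 : 0 < B by exact: lt_le_trans B1.
have lnB : 0 < ln (3 * B) by apply: ln_gt0; lra.
have sqB : 0 < Num.sqrt (2 * ln (3 * B)) by rewrite sqrtr_gt0 mulr_gt0.
pose la := Num.sqrt (2 * ln (3 * B)) / (K * s).
have Ks : 0 < K * s by exact: mulr_gt0.
have la0 : 0 < la by exact: divr_gt0.
have sqE : Num.sqrt (2 * ln (3 * B)) ^+ 2 = 2 * ln (3 * B).
  by rewrite sqr_sqrtr// mulr_ge0// ltW.
have laE : la ^+ 2 * (K ^+ 2 * s ^+ 2) / 2 = ln (3 * B).
  rewrite /la expr_div_n sqE exprMn; field.
  by rewrite !gt_eqF.
pose D := (3 * B) ^+ 2.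
have B3 : 0 < 3 * B by rewrite mulr_gt0.
have D0 : 0 < D by rewrite exprn_gt0.
have lnD : ln D = 2 * ln (3 * B) by rewrite lnXn ?posrE// mulr2n; lra.
pose al (l : J) := (l \in A)%:R * (la^-1 * D^-1).
pose c (b : bool) l : 'I_n -> R := fun i => (if b then la else - la) * v l i.
(* The boolean selects the sign of the exponent, because [exp |x| <= exp x + exp (- x)]. The term
   [D^-1] keeps the constant nonnegative, as the default value 0 of the maximum requires. *)
exists (bool * J)%type, (la^-1 * (ln D - 1 + D^-1)).
exists (fun bl => al bl.2), (fun bl => c bl.1 bl.2).
have bE (F : bool -> J -> R) : \sum_(bl : bool * J) F bl.1 bl.2 = \sum_j (F true j + F false j).
  rewrite -(pair_bigA _ F) /= big_bool big_split //=.
have al0 l : 0 <= al l.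
  by rewrite /al mulr_ge0// mulr_ge0// invr_ge0 ltW.
split=> [[]//|e|].
- rewrite (bE (fun (b : bool) l => al l * expR (dot (c b l) e))).
  set S := \sum_j _.
  have S0 : 0 <= S.
    by apply: sumr_ge0 => j _; rewrite addr_ge0// mulr_ge0// expR_ge0.
  apply: bigmax_le => [|l lA].
    rewrite addr_ge0// mulr_ge0// ?invr_ge0 ?(ltW la0)//.
    have := @expR_ge1Dx R (- ln D); rewrite expRN lnK ?posrE//; lra.
  have -> : `|dot (v l) e| = la^-1 * (la * `|dot (v l) e|).
    by rewrite mulKf// gt_eqF.
  rewrite -(gtr0_norm la0) -normrM -dotZl (gtr0_norm la0).
  set x := dot _ e.
  have Sl : la^-1 * D^-1 * expR `|x| <= S.
    rewrite /S (bigD1 l)//= -[leLHS]addr0; apply: lerD; last first.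
      by apply: sumr_ge0 => j _; rewrite addr_ge0// mulr_ge0// expR_ge0.
    rewrite /al lA mul1r -mulrDr ler_pM2l; last first.
      by rewrite mulr_gt0// invr_gt0.
    rewrite /c (_ : dot (fun i => - la * _) e = - x) ?expR_normr_le//.
    by rewrite /x !dotZl mulNr.
  have := @expR_ge1Dx R (`|x| - ln D); rewrite expRD expRN lnK ?posrE// => le1.
  have : la^-1 * (1 + (`|x| - ln D)) <= S.
    apply: le_trans Sl; rewrite -mulrA ler_pM2l ?invr_gt0//.
    by rewrite [leRHS]mulrC.
  have : 0 < la^-1 * D^-1 by rewrite mulr_gt0 ?invr_gt0.
  by rewrite !mulrDr !mulrN; lra.
- rewrite (bE (fun (b : bool) l => al l * expR (K ^+ 2 * dot (c b l) (c b l) / 2))).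
  have leE (b : bool) j : al j * expR (K ^+ 2 * dot (c b j) (c b j) / 2) <=
      (j \in A)%:R * (la^-1 * D^-1 * (3 * B)).
    rewrite /al; case: (boolP (j \in A)) => jA; last by rewrite !mul0r.
    rewrite !mul1r ler_pM2l; last by rewrite mulr_gt0// invr_gt0.
    rewrite -[leRHS]lnK ?posrE// ler_expR -laE.
    rewrite /c dotZ (_ : (if b then la else - la) ^+ 2 = la ^+ 2); last first.
      by case: b; rewrite ?sqrrN.
    have c0 : 0 < K ^+ 2 * la ^+ 2 / 2 by rewrite !mulr_gt0 ?exprn_gt0 ?invr_gt0.
    have := vs _ jA; rewrite -(ler_pM2l c0) => le_vs.
    apply: le_trans (_ : K ^+ 2 * la ^+ 2 / 2 * s ^+ 2 <= _).
      by apply: le_trans le_vs; rewrite le_eqVlt; apply/orP; left; apply/eqP; ring.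
    by rewrite le_eqVlt; apply/orP; left; apply/eqP; ring.
  have -> : K * s * Num.sqrt (2 * ln (3 * B)) = la^-1 * ln D.
    rewrite lnD /la; move: sqE sqB; set q := Num.sqrt _ => <- q0; field.
    by rewrite !gt_eqF.
  apply: (@le_trans _ _ (la^-1 * (ln D - 1 + D^-1) +
     \sum_j ((j \in A)%:R * (la^-1 * D^-1 * (3 * B)) *+ 2))).
    by rewrite lerD2l; apply: ler_sum => j _; rewrite mulr2n lerD.
  have -> : \sum_j ((j \in A)%:R * (la^-1 * D^-1 * (3 * B)) *+ 2) =
      la^-1 * (#|A|%:R * (D^-1 * (6 * B))).
    have cA : \sum_j ((j \in A)%:R : R) = #|A|%:R.
      by rewrite -sum1_card natr_sum [RHS]big_mkcond; apply: eq_bigr => j _; case: ifP.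
    by rewrite sumrMnl -mulr_suml cA; ring.
  rewrite -mulrDr ler_pM2l ?invr_gt0//.
  suff : D^-1 + #|A|%:R * (D^-1 * (6 * B)) <= 1 by lra.
  rewrite mulrCA -[X in X + _]mulr1 -mulrDr mulrC ler_pdivrMr// mul1r /D.
  have : #|A|%:R * (6 * B) <= B * (6 * B) by rewrite ler_pM2r ?mulr_gt0.
  have : 1 <= B ^+ 2 by rewrite expr_ge1// ltW.
  by rewrite exprMn expr2; lra.
Qed.
Lemma sqrt_ln3expR_le (x : R) : 0 <= x ->
  Num.sqrt (2 * ln (3 * expR x)) <= 2 * (1 + Num.sqrt x).
Proof.
move=> x0; have s0 := sqrtr_ge0 x.
rewrite -[leRHS]ger0_norm; last by rewrite mulr_ge0// addr_ge0.
rewrite -sqrtr_sqr ler_wsqrtr// lnM ?posrE ?expR_gt0// expRK.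
have l3 : ln (3 : R) <= 2.
  have := @le_ln1Dx R 2; rewrite (_ : 1 + 2 = 3 :> R); last by ring.
  by apply; lra.
have := sqr_sqrtr x0; set q := Num.sqrt x => qE.
have : 0 <= q by [].
have : 0 <= q ^+ 2 by exact: sqr_ge0.
by rewrite exprMn sqrrD; lra.
Qed.

Section Chain.
Variables (K : R) (n : nat) (J : finType) (v : J -> 'I_n -> R) (a : nat -> R).
Variables (N : nat -> {set J}) (pr : nat -> J -> J).
Hypothesis K0 : 0 < K.
Hypothesis n0 : (0 < n)%N.
Hypothesis a0 : forall k, 0 <= a k.
Hypothesis a_mono : forall k, a k <= a k.+1.
Hypothesis prN : forall k j, pr k j \in N k.
Hypothesis cardN : forall k, #|N k|%:R <= expR (a k).

Let diff (j j' : J) : 'I_n -> R := fun i => v j i - v j' i.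
Let dist2 (j j' : J) : R := dot (diff j j') (diff j j').
Let rho (k : nat) : R := 2 * 2^-1 ^+ k * Num.sqrt n%:R.
Let wt (k : nat) : R := 2^-1 ^+ k * (1 + Num.sqrt (a k)).

Hypothesis pr_close : forall k j, dist2 j (pr k j) <= rho k ^+ 2.

Let sqn0 : 0 < Num.sqrt (n%:R : R).
Proof. by rewrite sqrtr_gt0 ltr0n. Qed.

Let half_gt0 k : 0 < (2^-1 : R) ^+ k.
Proof. by rewrite exprn_gt0. Qed.

Let rho_gt0 k : 0 < rho k.
Proof. by rewrite /rho !mulr_gt0. Qed.

Let dist2C j j' : dist2 j j' = dist2 j' j.
Proof. by apply: eq_bigr => i _; rewrite /diff; ring. Qed.

Let link (k k' : nat) (s : R) (A : {set J * J}) : 0 < s ->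
  (forall u, u \in A -> [/\ u.1 \in N k, u.2 \in N k' & dist2 u.1 u.2 <= s ^+ 2]) ->
  subgauss_dominated K
    (fun e => \big[Num.max/0]_(u in A) `|dot (diff u.1 u.2) e|)
    (K * s * (2 * (1 + Num.sqrt (a k + a k')))).
Proof.
move=> s0 AP; have akk : 0 <= a k + a k' by exact: addr_ge0.
apply: le_subgauss_dominated (subgauss_dominated_max
  (v := fun u : J * J => diff u.1 u.2) (A := A) (B := expR (a k + a k')) K0 s0 _ _ _).
- by [].
- by rewrite ler_pM2l ?mulr_gt0// sqrt_ln3expR_le.
- by rewrite -expR0 ler_expR.
- rewrite expRD; apply: le_trans (_ : #|finset.setX (N k) (N k')|%:R <= _).
    rewrite ler_nat; apply: subset_leq_card; apply/fintype.subsetP => u /AP[uk uk' _].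
    by rewrite inE uk.
  by rewrite cardsX natrM ler_pM.
- by move=> u /AP[].
Qed.

(** One function [F] has to dominate the chains of all [j] together, so each scale contributes a
    maximum over all admissible pairs of net points. A link between scales [k] and [k + 1] has
    length at most [2 rho k], that is [8 * 2^-(k+1) sqrt n], and its entropy factor is at most
    [4 (1 + sqrt (a (k+1)))]: hence 32. *)
Let telescope k0 m : exists F : ('I_n -> R) -> R, (forall e, 0 <= F e) /\
  (forall j e, `|dot (diff (pr (k0 + m) j) (pr k0 j)) e| <= F e) /\
  subgauss_dominated K F (32 * K * Num.sqrt n%:R * \sum_(k0.+1 <= k < (k0 + m).+1) wt k).
Proof.
elim: m => [|m [F [F0 [Fle FK]]]].
  exists (fun=> 0); split=> //; split=> [j e|].
    by rewrite addn0 /diff /dot big1 ?normr0// => i _; rewrite subrr mul0r.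
  exists unit, 0, (fun=> 0), (fun _ _ => 0); split=> //.
    by move=> e; rewrite big1 ?addr0// => i _; rewrite mul0r.
  by rewrite addn0 big_geq// mulr0 big1 ?addr0// => i _; rewrite mul0r.
pose k := (k0 + m)%N.
pose A := [set u : J * J | [&& u.1 \in N k.+1, u.2 \in N k &
   dist2 u.1 u.2 <= (2 * rho k) ^+ 2]]%SET.
have AP u : u \in A -> [/\ u.1 \in N k.+1, u.2 \in N k & dist2 u.1 u.2 <= (2 * rho k) ^+ 2].
  by rewrite inE => /and3P.
have r2 : 0 < 2 * rho k by rewrite mulr_gt0.
exists (fun e => F e + \big[Num.max/0]_(u in A) `|dot (diff u.1 u.2) e|).
split=> [e|]; first by rewrite addr_ge0// bigmax_ge_id.
split.
  move=> j e; rewrite addnS -/k.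
  have -> : dot (diff (pr k.+1 j) (pr k0 j)) e =
     dot (diff (pr k j) (pr k0 j)) e + dot (diff (pr k.+1 j) (pr k j)) e.
    by rewrite /diff !dotB; ring.
  apply: le_trans (ler_normD _ _) _; apply: lerD; first exact: Fle.
  apply: (@le_bigmax_cond _ _ _ _ (pr k.+1 j, pr k j) (fun u => u \in A)
    (fun u : J * J => `|dot (diff u.1 u.2) e|)).
  rewrite inE !prN /=; apply: le_trans (dot_le2 (y := v j) _ _) _.
  - by rewrite -/(diff _ _) -/(dist2 _ _) dist2C; exact: pr_close.
  - exact: pr_close.
  have : rho k.+1 ^+ 2 <= rho k ^+ 2.
    have rk : rho k.+1 <= rho k.
      rewrite /rho ler_pM2r// ler_pM2l// exprS.
      by have := half_gt0 k; lra.
    by apply: lerXn2r rk; rewrite nnegrE ltW.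
  by rewrite exprMn; lra.
have := subgauss_dominatedD FK (link r2 AP); apply: le_subgauss_dominated => //.
rewrite addnS -/k [X in _ <= _ * X]big_nat_recr/=; last by rewrite ltnS leq_addr.
rewrite [leRHS]mulrDr lerD2l.
apply: le_trans (_ : K * (2 * rho k) * (2 * (2 * (1 + Num.sqrt (a k.+1)))) <= _).
  rewrite ler_pM2l ?mulr_gt0// ler_pM2l//.
  have : Num.sqrt (a k.+1 + a k) <= 2 * Num.sqrt (a k.+1).
    rewrite -[X in X * _](@ger0_norm _ 2)// -sqrtr_sqr -sqrtrM ?sqr_ge0//.
    apply: ler_wsqrtr; have := a_mono k; have := a0 k.+1.
    by rewrite expr2; lra.
  have := sqrtr_ge0 (a k.+1); lra.
rewrite /rho /wt exprS le_eqVlt; apply/orP; left; apply/eqP; by field.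
Qed.

(** Both ends of a pair are chained to scale [k0], which takes two telescopes and doubles 32 to 64.
    The two base points are then at distance at most [4 rho k0], and the single link between them
    fits into the term of index [k0]. The hypothesis on [pr (k0 + m)] says that the chain has
    reached the vectors themselves. *)
Lemma chaining k0 m : (forall j, v (pr (k0 + m) j) =1 v j) ->
  subgauss_dominated K
    (fun e => \big[Num.max/0]_(u | dist2 u.1 u.2 <= rho k0 ^+ 2)
       `|dot (diff u.1 u.2) e|)
    (64 * K * Num.sqrt n%:R * \sum_(k0 <= k < (k0 + m).+1) wt k).
Proof.
move=> prK.
have [F [F0 [Fle FK]]] := telescope k0 m.
pose A := [set u : J * J | [&& u.1 \in N k0, u.2 \in N k0 &
   dist2 u.1 u.2 <= (4 * rho k0) ^+ 2]]%SET.
have AP u : u \in A -> [/\ u.1 \in N k0, u.2 \in N k0 & dist2 u.1 u.2 <= (4 * rho k0) ^+ 2].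
  by rewrite inE => /and3P.
have r4 : 0 < 4 * rho k0 by rewrite mulr_gt0.
have := subgauss_dominatedD (subgauss_dominatedD FK FK) (link r4 AP).
apply: le_subgauss_dominated => [e|].
  apply: bigmax_le => [|[j j'] /= jj'].
    by rewrite !addr_ge0// bigmax_ge_id.
  have -> : dot (diff j j') e = dot (diff (pr (k0 + m) j) (pr k0 j)) e
      - dot (diff (pr (k0 + m) j') (pr k0 j')) e + dot (diff (pr k0 j) (pr k0 j')) e.
    have vE i : v (pr (k0 + m) i) = v i by apply/funext.
    by rewrite /diff !dotB !vE; ring.
  apply: le_trans (ler_normD _ _) _; apply: lerD.
    by apply: le_trans (ler_normB _ _) _; apply: lerD; exact: Fle.
  apply: (@le_bigmax_cond _ _ _ _ (pr k0 j, pr k0 j') (fun u => u \in A)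
    (fun u : J * J => `|dot (diff u.1 u.2) e|)).
  rewrite inE !prN /=.
  apply: le_trans (dot_le2 (y := v j') (b' := rho k0 ^+ 2) _ (pr_close _ _)) _.
    apply: (dot_le2 (y := v j) (b := rho k0 ^+ 2)); last exact: jj'.
    by rewrite -/(diff _ _) -/(dist2 _ _) dist2C; exact: pr_close.
  by move: (rho k0) => q; have := sqr_ge0 q; rewrite exprMn; lra.
rewrite [X in _ <= _ * X]big_nat_recl ?leq_addr// [leRHS]mulrDr.
rewrite -(big_add1 _ _ k0 (k0 + m).+1 xpredT) /= addrC; apply: lerD; last first.
  by rewrite -!mulrDl; set S := \sum_(_ <= _ < _) _; lra.
apply: le_trans (_ : K * (4 * rho k0) * (2 * (2 * (1 + Num.sqrt (a k0)))) <= _).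
  rewrite ler_pM2l ?mulr_gt0// ler_pM2l//.
  have : Num.sqrt (a k0 + a k0) <= 2 * Num.sqrt (a k0).
    rewrite -[X in X * _](@ger0_norm _ 2)// -sqrtr_sqr -sqrtrM ?sqr_ge0//.
    by apply: ler_wsqrtr; have := a0 k0; rewrite expr2; lra.
  have := sqrtr_ge0 (a k0); lra.
have : 0 <= K * Num.sqrt n%:R * wt k0.
  by rewrite !mulr_ge0// ?addr_ge0 ?(ltW K0)// exprn_ge0.
have -> : K * (4 * rho k0) * (2 * (2 * (1 + Num.sqrt (a k0)))) =
    32 * (K * Num.sqrt n%:R * wt k0) by rewrite /rho /wt; ring.
by rewrite -!mulrA; lra.
Qed.
End Chain.
End Chaining.
Import HBNNSimple.

(* No measurability of [f] is needed: the integral of a nonnegative function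
   is a supremum over the simple functions below it. *)
Lemma disjoint_sum_le_integral d (T : measurableType d) (R : realType)
    (mu : {measure set T -> \bar R}) (D : set T) (f : T -> \bar R)
    (I : nat -> set T) (h : nat -> R) (M : nat) :
  (forall x, 0 <= f x)%E -> (forall j, measurable (I j)) -> trivIset setT I ->
  (forall j, 0 <= h j) -> (forall j, I j `<=` D) ->
  (forall j x, I j x -> ((h j)%:E <= f x)%E) ->
  (\sum_(j < M) (h j)%:E * mu (I j) <= \int[mu]_(x in D) f x)%E.
Proof.
move=> f0 mI tI h0 ID hf.
pose g : {nnsfun T >-> R} :=
  sum_nnsfun (fun j => scale_nnsfun (indic_nnsfun R (mI j)) (h0 j)) M.
have gE x : g x = \sum_(j < M) h j * \1_(I j) x by rewrite /g sum_nnsfunE.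
have -> : (\sum_(j < M) (h j)%:E * mu (I j) = \int[mu]_x (g x)%:E)%E.
  under eq_integral do rewrite gE -sumEFin.
  rewrite ge0_integral_sum//; first last.
  - by move=> j x _; rewrite lee_fin mulr_ge0.
  - by move=> j; apply/measurable_EFinP; apply: measurable_funM => //;
      exact: measurable_indic.
  apply: eq_bigr => j _.
  under eq_integral do rewrite EFinM.
  rewrite ge0_integralZl ?lee_fin//; last first.
    by apply/measurable_EFinP; exact: measurable_indic.
  by rewrite integral_indic ?setIT.
rewrite [leRHS]integral_mkcond integralT_nnsfun ge0_integralTE; last first.
  by move=> x; rewrite patchE; case: ifP.
apply: ereal_sup_ubound; exists g => // x /=.
have [[j Ij]|nI] := pselect (exists j : 'I_M, I j x); last first.
  rewrite gE big1 ?patchE; first by case: ifP.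
  move=> j _; rewrite indicE memNset ?mulr0// => Ij; apply: nI; by exists j.
rewrite patchE mem_set /=; last exact: ID Ij.
apply: le_trans (hf j x Ij).
rewrite lee_fin gE (bigD1 j)//= indicE mem_set// mulr1 big1 ?addr0// => i ij.
rewrite indicE memNset ?mulr0// => Ii; move/eqP: ij; apply; apply/val_inj.
by apply: tI => //; exists x.
Qed.

(** * Covers from the uniform entropy integral *)

Section Entropy.
Context {R : realType}.

(** Lower sum over the disjoint intervals from [2^-(k+1)] to [2^-k], whose length is [2^-(k+1)]. *)
Lemma dyadic_sum_le_integral (f : R -> \bar R) (eta : R) (h : nat -> R) (k1 M : nat) :
  (forall x, 0 <= f x)%E -> (2^-1 : R) ^+ k1 <= eta -> (forall k, 0 <= h k) ->
  (forall k x, (k1 <= k)%N -> 0 < x -> x <= 2^-1 ^+ k -> ((h k)%:E <= f x)%E) ->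
  ((\sum_(j < M) h (k1 + j)%N * 2^-1 ^+ (k1 + j).+1)%:E <=
   \int[lebesgue_measure]_(x in `[0%R, eta]) f x)%E.
Proof.
move=> f0 keta h0 hf.
pose I (j : nat) : set R := `](2^-1 ^+ (k1 + j).+1)%R, (2^-1 ^+ (k1 + j))%R]%classic.
have half0 k : 0 < (2^-1 : R) ^+ k by rewrite exprn_gt0.
have halfS k : (2^-1 : R) ^+ k.+1 < 2^-1 ^+ k by rewrite exprS; have := half0 k; lra.
have half_mono k k' : (k <= k')%N -> (2^-1 : R) ^+ k' <= 2^-1 ^+ k.
  by move=> kk'; rewrite ler_wiXn2l// ?invr_ge0// invf_le1// ler1n.
have IP j x : I j x -> 2^-1 ^+ (k1 + j).+1 < x /\ x <= 2^-1 ^+ (k1 + j).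
  by rewrite /I /= in_itv/= => /andP.
apply: le_trans (_ : (\sum_(j < M) (h (k1 + j)%N)%:E * lebesgue_measure (I j) <= _)%E).
  rewrite -sumEFin le_eqVlt; apply/orP; left; apply/eqP; apply: eq_bigr => j _.
  rewrite EFinM; congr (_ * _)%E.
  rewrite lebesgue_measure_itv /= lte_fin halfS -EFinD; congr (_%:E).
  by rewrite exprS; lra.
have := @disjoint_sum_le_integral _ _ _ (@lebesgue_measure R) `[0%R, eta]%classic f I (fun j => h (k1 + j)%N) M.
apply => //.
- by move=> j; exact: measurable_itv.
- move=> i j _ _ [x [/IP[x1 x2] /IP[y1 y2]]].
  have [ltij|ltji|//] := ltngtP i j.
    have := half_mono (k1 + i).+1 (k1 + j)%N; rewrite ltn_add2l => /(_ ltij).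
    by move=> /(le_trans y2); rewrite leNgt x1.
  have := half_mono (k1 + j).+1 (k1 + i)%N; rewrite ltn_add2l => /(_ ltji).
  by move=> /(le_trans x2); rewrite leNgt y1.
- move=> j x /IP[x1 x2]; rewrite /= in_itv /= (le_trans x2) ?andbT.
    by rewrite ltW//; apply: lt_trans x1.
  by rewrite (le_trans _ keta)// half_mono// leq_addr.
- move=> j x /IP[x1 x2]; apply: hf x2; first exact: leq_addr.
  by apply: lt_trans x1.
Qed.

End Entropy.

(* Covers, at the scales 2^-k, of the traces on [n] points of the class viewed
   as {-1, 1}-valued, in the distance of the empirical measure. *)
Definition dyadic_entropy (X : Type) (R : realType) (C : set (X -> bool))
    (a : nat -> R) : Prop :=
  forall n (x : 'I_n -> X) k, (0 < n)%N ->
  exists N (c : 'I_N -> 'I_n -> R), N%:R <= expR (a k) /\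
  forall pi, C pi -> exists i,
    \sum_j (trt (pi (x j)) - c i j) ^+ 2 < n%:R * (2^-1 ^+ k) ^+ 2.

Section UniformEntropy.
Context {X : pointedType} {R : realType}.
Variable C : set (X -> bool).
Hypothesis C0 : C !=set0.

Let F : set (X -> R) := pm_class C.

Let cov_ge1 eps k (x : 'I_k -> X) (w : 'I_k -> R) :
  (1 <= covering_number eps F x w)%E.
Proof.
apply: le_ereal_inf_tmp => _ [n [c cP] <-]; rewrite lee_fin ler1n lt0n.
apply/eqP => n0; have [pi Cpi] := C0.
have [[i ilt] _] := cP (fun x => trt (pi x)) (ex_intro2 _ _ pi Cpi erefl).
by rewrite n0 in ilt.
Qed.

Let cov_antimono eps eps' k (x : 'I_k -> X) (w : 'I_k -> R) : eps <= eps' ->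
  (covering_number eps' F x w <= covering_number eps F x w)%E.
Proof.
move=> le; apply: le_ereal_inf => _ [n [c cP] <-]; exists n => //; exists c.
by move=> f /cP[i fi]; exists i; exact: lt_le_trans fi le.
Qed.

Let entropy_antimono eps eps' : eps <= eps' ->
  (uniform_entropy eps' F <= uniform_entropy eps F)%E.
Proof.
move=> le; apply: ge_ereal_sup => _ [k [x [w [w0 w1 ->]]]].
apply: ereal_sup_ge; exists (lne (covering_number eps F x w)).
  by exists k, x, w.
have ge0 e : (0 <= covering_number e F x w)%E by exact: le_trans (cov_ge1 _ _ _).
by rewrite lee_lne ?in_itv/= ?ge0 ?leey// cov_antimono.
Qed.

Let entropy_ge0 eps : (0 <= uniform_entropy eps F)%E.
Proof.
apply: ereal_sup_ge.
exists (lne (covering_number eps F (fun _ : 'I_1 => point) (fun=> 1))).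
  by exists 1%N, (fun=> point), (fun=> 1); rewrite big_ord1; split.
by rewrite lne_ge0 cov_ge1.
Qed.

Lemma dyadic_cover eps (r : R) n (x : 'I_n -> X) : (0 < n)%N -> 0 < eps ->
  (uniform_entropy eps F <= r%:E)%E ->
  exists N (c : 'I_N -> 'I_n -> R), N%:R <= expR (r + 1) /\
  forall pi, C pi -> exists i,
    \sum_j (trt (pi (x j)) - c i j) ^+ 2 < n%:R * eps ^+ 2.
Proof.
move=> n0 e0 Hr; pose w (_ : 'I_n) : R := n%:R^-1.
have nR : n%:R != 0 :> R by rewrite pnatr_eq0 -lt0n.
have covr : (lne (covering_number eps F x w) <= r%:E)%E.
  apply: le_trans Hr; apply: ereal_sup_ubound; exists n, x, w; split=> //.
    by move=> i; rewrite invr_ge0.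
  by rewrite /w sumr_const card_ord -[LHS]mulr_natl divff.
(* An actual cover is extracted from the infimum through a strict inequality, which the exponent
   [r + 1] provides. *)
have cov_lt : (covering_number eps F x w < (expR (r + 1))%:E)%E.
  have := cov_ge1 eps x w; move: covr.
  case: (covering_number _ _ _ _) => //= c.
  case: ifPn => [c0 _|].
    by rewrite lee_fin => /le_trans /(_ c0); rewrite ler10.
  rewrite -ltNge lee_fin lte_fin => c0 lnc _.
  by rewrite -(lnK c0) ltr_expR (le_lt_trans lnc)// ltrDl.
have /ereal_inf_lt[_ [N [c cP] <-] Nlt] := cov_lt.
exists N, (fun i j => c i (x j)); split; first by rewrite ltW.
move=> pi Cpi; have [i] := cP (fun x => trt (pi x)) (ex_intro2 _ _ pi Cpi erefl).
rewrite /L2dist => lt_e; exists i.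
have S0 : 0 <= \sum_i0 w i0 * (trt (pi (x i0)) - c i (x i0)) ^+ 2.
  by apply: sumr_ge0 => j _; rewrite mulr_ge0 ?invr_ge0 ?sqr_ge0.
have : \sum_i0 w i0 * (trt (pi (x i0)) - c i (x i0)) ^+ 2 < eps ^+ 2.
  by rewrite -(sqr_sqrtr S0) ltrXn2r ?nnegrE ?sqrtr_ge0 ?ltW.
by rewrite -mulr_sumr ltr_pdivrMl ?ltr0n.
Qed.

(** Along the harmonic sequence some [J1 eta0] is finite. The entropy is antitone in the radius, so
    this integral dominates its dyadic sums: the weights [2^-k (1 + sqrt (a k))] are summable, and
    [W] is the tail of their series. *)
Lemma entropy_of_J1 :
  (forall eta : nat -> R, (forall n, 0 <= eta n) ->
     eta @ \oo --> (0 : R) -> J1 (eta n) F @[n --> \oo] --> (0 : \bar R)) ->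
  exists (a W : nat -> R), [/\ forall k, 0 <= a k, forall k, a k <= a k.+1,
    dyadic_entropy C a,
    forall k0 M, \sum_(k0 <= k < M) 2^-1 ^+ k * (1 + Num.sqrt (a k)) <= W k0 &
    W @ \oo --> (0 : R)].
Proof.
move=> hJ.
have [eta0 eta0_gt0 Jfin] : exists2 eta0 : R, 0 < eta0 & (J1 eta0 F < +oo)%E.
  have := hJ (@harmonic R) (fun n => ltW (harmonic_gt0 n)) (@cvg_harmonic R).
  have n1 : nbhs (0%E : \bar R) [set y | (y < 1%:E)%E].
    by apply: (@nbhs_open_ereal_lt _ 0 (fun=> 1)).
  move=> /(_ _ n1) [N _ /(_ N (leqnn _)) /= lt1].
  by exists (harmonic N); [exact: harmonic_gt0|exact: lt_trans lt1 (ltry _)].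
pose S eps := (uniform_entropy eps F `^ 2^-1)%E.
have S0 eps : (0 <= S eps)%E by exact: poweR_ge0.
have Santi eps eps' : eps <= eps' -> (S eps' <= S eps)%E.
  move=> le; apply: gt0_ler_poweR => //; rewrite ?in_itv/= ?entropy_ge0 ?leey//.
  exact: entropy_antimono.
have half0 k : 0 < (2^-1 : R) ^+ k by rewrite exprn_gt0.
have half_mono k k' : (k <= k')%N -> (2^-1 : R) ^+ k' <= 2^-1 ^+ k.
  by move=> kk'; rewrite ler_wiXn2l// ?invr_ge0// invf_le1// ler1n.
have [k1 k1eta] : exists k1, (2^-1 : R) ^+ k1 <= eta0.
  have [N Neta] : exists N : nat, eta0^-1 < N%:R by exists (Num.trunc eta0^-1).+1; exact: truncnS_gt.
  exists N; rewrite exprVn -[leRHS]invrK lef_pV2 ?posrE ?exprn_gt0 ?invr_gt0//.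
  by rewrite (le_trans (ltW Neta))// -natrX ler_nat ltnW// ltn_expl.
pose J := fine (J1 eta0 F).
have JE : J1 eta0 F = J%:E.
  by rewrite /J fineK// ge0_fin_numE//; apply: integral_ge0 => x _; exact: S0.
have sumS (h : nat -> R) M : (forall k, 0 <= h k) ->
    (forall k, (k1 <= k)%N -> ((h k)%:E <= S (2^-1 ^+ k)%R)%E) ->
    \sum_(j < M) h (k1 + j)%N * 2^-1 ^+ (k1 + j).+1 <= J.
  move=> h0 hS; rewrite -lee_fin -JE; apply: dyadic_sum_le_integral => //.
  by move=> k x k1k x0 xk; apply: le_trans (hS k k1k) _; exact: Santi.
have Sfin k : (k1 <= k)%N -> (S (2^-1 ^+ k)%R < +oo)%E.
  move=> k1k; rewrite ltey; apply/eqP => Sy.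
  have J0 : 0 <= J by rewrite -lee_fin -JE; apply: integral_ge0 => x _; exact: S0.
  (* An infinite value at scale [k] would allow the height [c] on one single dyadic interval, with
     contribution [J + 1 > J]. *)
  pose c := (J + 1) / 2^-1 ^+ k.+1.
  have c0 : 0 <= c by rewrite divr_ge0// ?addr_ge0// ltW.
  have c_ge0 i : 0 <= (if i == k then c else 0) by case: ifP.
  have c_le i : (k1 <= i)%N -> ((if i == k then c else 0)%:E <= S (2^-1 ^+ i)%R)%E.
    by move=> k1i; case: ifPn => // /eqP ->; rewrite Sy leey.
  have := sumS _ (k - k1).+1 c_ge0 c_le.
  rewrite big_ord_recr /= subnKC// eqxx.
  have sum0 : 0 <= \sum_(i < k - k1) (if (k1 + i)%N == k then c else 0) * 2^-1 ^+ (k1 + i).+1.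
    by apply: sumr_ge0 => i _; rewrite mulr_ge0 ?(ltW (half0 _)).
  have : c * 2^-1 ^+ k.+1 = J + 1 by rewrite /c mulfVK ?gt_eqF.
  by move: sum0; set s := \sum_(_ < _) _; lra.
pose H k := fine (uniform_entropy (2^-1 ^+ k) F).
have HE k : (k1 <= k)%N -> uniform_entropy (2^-1 ^+ k) F = (H k)%:E.
  move=> k1k; rewrite fineK// ge0_fin_numE ?entropy_ge0//.
  by apply: lty_poweRy (Sfin k k1k); rewrite invr_eq0.
have H0 k : 0 <= H k by rewrite fine_ge0// entropy_ge0.
(* Scales coarser than [k1] reuse the finer covers of scale [k1]; the [+ 1] is the one of
   [dyadic_cover]. *)
pose a k := H (maxn k k1) + 1.
pose w k := 2^-1 ^+ k * (1 + Num.sqrt (a k)).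
have a0 k : 0 <= a k by rewrite addr_ge0.
have w0 k : 0 <= w k by rewrite mulr_ge0 ?(ltW (half0 _))// addr_ge0 ?sqrtr_ge0.
pose h k := Num.sqrt (H k).
have hS k : (k1 <= k)%N -> ((h k)%:E <= S (2^-1 ^+ k)%R)%E.
  by move=> k1k; rewrite /S HE// poweR12_sqrt ?lee_fin.
(* [2^-k] is written as twice a difference of consecutive powers, so that the part free of entropy
   telescopes. *)
have wh k : (k1 <= k)%N -> w k <= 2 * (2^-1 ^+ k - 2^-1 ^+ k.+1) * 2 + 2 * (h k * 2^-1 ^+ k.+1).
  move=> k1k; rewrite /w /a (maxn_idPl k1k) exprS.
  have : Num.sqrt (H k + 1) <= h k + 1.
    have h0 : 0 <= h k by exact: sqrtr_ge0.
    rewrite -[leRHS]ger0_norm ?addr_ge0// -sqrtr_sqr ler_wsqrtr//.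
    rewrite sqrrD1 /h sqr_sqrtr//; move: h0; rewrite /h; lra.
  have := half0 k; set q := 2^-1 ^+ k => q0 le.
  have : q * Num.sqrt (H k + 1) <= q * (h k + 1) by rewrite ler_pM2l.
  by lra.
have sumw M : \sum_(0 <= k < M) w k <= \sum_(0 <= k < k1) w k + (4 + 2 * J).
  apply: le_trans (_ : \sum_(0 <= k < k1 + M) w k <= _).
    rewrite [leRHS](big_cat_nat _ (n := M))//= ?leq_addl// lerDl.
    by apply: sumr_ge0.
  rewrite (big_cat_nat _ (n := k1))//= ?leq_addr// lerD2l.
  rewrite -{1}[k1]add0n big_addn addKn big_mkord.
  apply: le_trans (_ : \sum_(j < M) (2 * (2^-1 ^+ (k1 + j) - 2^-1 ^+ (k1 + j).+1) * 2 +
      2 * (h (k1 + j)%N * 2^-1 ^+ (k1 + j).+1)) <= _).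
    by apply: ler_sum => j _; rewrite addnC wh// leq_addr.
  rewrite big_split /=; apply: lerD; last first.
    by rewrite -mulr_sumr ler_pM2l// sumS// => k; exact: sqrtr_ge0.
  rewrite -mulr_suml -mulr_sumr.
  have -> : \sum_(i < M) ((2^-1 : R) ^+ (k1 + i) - 2^-1 ^+ (k1 + i).+1) =
     2^-1 ^+ k1 - 2^-1 ^+ (k1 + M).
    elim: M => [|M IH]; first by rewrite big_ord0 addn0 subrr.
    by rewrite big_ord_recr /= IH addnS; ring.
  have := half_mono 0%N k1 (leq0n _); rewrite expr0.
  by have := half0 (k1 + M)%N; lra.
pose T M := \sum_(0 <= k < M) w k.
have Tmono : {homo T : n m / (n <= m)%N >-> n <= m}.
  move=> n m nm; rewrite /T [leRHS](big_cat_nat _ (n := n))//= lerDl.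
  by apply: sumr_ge0.
have Tcvg : cvgn T.
  apply: nondecreasing_is_cvgn => //.
  by exists (\sum_(0 <= k < k1) w k + (4 + 2 * J)) => _ [M _ <-]; exact: sumw.
exists a, (fun k => limn T - T k); split=> //.
- move=> k; rewrite /a lerD2r fine_le//.
  + by rewrite HE// leq_maxr.
  + by rewrite HE// leq_maxr.
  + apply: entropy_antimono; apply: half_mono.
    by rewrite geq_max leq_maxr leq_max leqnSn.
- move=> n x k n0.
  have [N [c [Nc cP]]] := dyadic_cover x n0 (half0 (maxn k k1))
    (eq_ind_r (fun z => (z <= (H (maxn k k1))%:E)%E) (lexx _) (HE _ (leq_maxr _ _))).
  exists N, c; split=> // pi /cP[i lti]; exists i; apply: lt_le_trans lti _.
  rewrite ler_pM2l ?ltr0n// lerXn2r ?nnegrE ?(ltW (half0 _))//.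
  by apply: half_mono; exact: leq_maxl.
- move=> k0 M; rewrite lerBrDl.
  have [k0M|Mk0] := leqP k0 M.
    by rewrite -big_cat_nat//; exact: nondecreasing_cvgn_le.
  by rewrite [X in _ + X]big_geq ?addr0 1?ltnW//; exact: nondecreasing_cvgn_le.
- by rewrite -(subrr (limn T)); apply: cvgB => //; exact: cvg_cst.
Qed.

End UniformEntropy.

(** * Chaining over the traces of a finite family of policies *)

Section PolicyChaining.
Context {X : Type} {R : realType}.
Variables (C : set (X -> bool)) (a W : nat -> R).
Hypothesis a0 : forall k, 0 <= a k.
Hypothesis a_mono : forall k, a k <= a k.+1.
Hypothesis entC : dyadic_entropy C a.
Hypothesis sumW : forall k0 M,
  \sum_(k0 <= k < M) 2^-1 ^+ k * (1 + Num.sqrt (a k)) <= W k0.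

Variables (n : nat) (J : finType) (s : J -> X -> bool) (x : 'I_n -> X).
Hypothesis n0 : (0 < n)%N.
Hypothesis Cs : forall j, C (s j).

Definition trace (j : J) : 'I_n -> R := fun i => trt (s j (x i)).

Definition trace_dist2 (j j' : J) : R := \sum_i (trace j i - trace j' i) ^+ 2.

Lemma trace_dist2E j j' : trace_dist2 j j' =
  dot (fun i => trace j i - trace j' i) (fun i => trace j i - trace j' i).
Proof. by apply: eq_bigr => i _; rewrite expr2. Qed.

(** The centers of a cover need not be traces, so each ball in use is represented by a member of the
    family; this doubles the radius, hence the factor 4. [pr j] depends on [j] only through its
    ball, which bounds the number of net points. *)
Lemma trace_net k : exists (pr : J -> J) (N : {set J}),
  [/\ forall j, pr j \in N, #|N|%:R <= expR (a k) &
      forall j, trace_dist2 j (pr j) <= 4 * (n%:R * (2^-1 ^+ k) ^+ 2)].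
Proof.
have [N [c [Nle cP]]] := entC x k n0.
have /choice[idx idxP] : forall j, exists i, \sum_i0 (trace j i0 - c i i0) ^+ 2 <
    n%:R * (2^-1 ^+ k) ^+ 2 by move=> j; exact: cP.
pose pr j := odflt j [pick j' | idx j' == idx j].
have prI j : idx (pr j) = idx j.
  by rewrite /pr; case: pickP => [j' /eqP|] //=.
have prE j j' : idx j = idx j' -> pr j = pr j'.
  move=> e; rewrite /pr e; case: pickP => //= /(_ j').
  by rewrite eqxx.
exists pr, (pr @: J)%SET; split=> [j||j].
- exact: imset_f.
- apply: le_trans Nle; rewrite ler_nat -(@card_in_imset _ _ idx).
    by apply: leq_trans (max_card _) _; rewrite card_ord.
  by move=> _ _ /imsetP[j _ ->] /imsetP[j' _ ->]; rewrite !prI => /prE ->.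
- have := idxP j; have := idxP (pr j); rewrite prI => lt1 lt2.
  rewrite trace_dist2E.
  apply: le_trans (dot_le2 (y := c (idx j)) (b := n%:R * (2^-1 ^+ k) ^+ 2)
     (b' := n%:R * (2^-1 ^+ k) ^+ 2) _ _) _; last by lra.
  + by apply: le_trans (ltW lt2); rewrite le_eqVlt; apply/orP; left; apply/eqP;
      apply: eq_bigr => i _; rewrite expr2.
  + by apply: le_trans (ltW lt1); rewrite le_eqVlt; apply/orP; left; apply/eqP;
      apply: eq_bigr => i _; ring.
Qed.

(** Traces are {-1, 1}-valued, so a single disagreement already costs 4. This ends the chain after
    finitely many scales. *)
Lemma trace_eq j j' : trace_dist2 j j' < 4 -> trace j =1 trace j'.
Proof.
move=> lt4 i; apply/eqP; rewrite -subr_eq0; apply/negPn/negP => ne.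
move: lt4; rewrite /trace_dist2 (bigD1 i)//= ltNge => /negP; apply.
rewrite -[leLHS]addr0; apply: lerD; last by apply: sumr_ge0 => ? _; exact: sqr_ge0.
move: ne; rewrite /trace /trt; case: (s j _); case: (s j' _) => //=;
  rewrite ?subrr ?eqxx// => _; lra.
Qed.

Lemma policy_chaining K k0 : 0 < K ->
  subgauss_dominated K
    (fun e => \big[Num.max/0]_(u : J * J |
        trace_dist2 u.1 u.2 <= 4 * (n%:R * (2^-1 ^+ k0) ^+ 2))
       `|dot (fun i => trace u.1 i - trace u.2 i) e|)
    (64 * K * Num.sqrt n%:R * W k0).
Proof.
move=> K0.
have /choice[prN prNP] : forall k, exists p : (J -> J) * {set J},
    [/\ forall j, p.1 j \in p.2, #|p.2|%:R <= expR (a k) &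
      forall j, trace_dist2 j (p.1 j) <= 4 * (n%:R * (2^-1 ^+ k) ^+ 2)].
  by move=> k; have [pr [N ?]] := trace_net k; exists (pr, N).
have rhoE k : (2 * 2^-1 ^+ k * Num.sqrt n%:R) ^+ 2 = 4 * (n%:R * (2^-1 ^+ k) ^+ 2) :> R.
  by rewrite !exprMn sqr_sqrtr//; ring.
have half_le (k : nat) : (2^-1 ^+ k) ^+ 2 <= 2^-1 ^+ k :> R.
  by rewrite expr2 ger_pMl ?exprn_gt0// exprn_ile1 ?invr_ge0// invf_le1// ler1n.
have h1 k j : (prN k).1 j \in (prN k).2 by case: (prNP k).
have h2 k : #|(prN k).2|%:R <= expR (a k) by case: (prNP k).
have h3 k j : trace_dist2 j ((prN k).1 j) <= (2 * 2^-1 ^+ k * Num.sqrt n%:R) ^+ 2.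
  by rewrite rhoE; case: (prNP k).
(* At scale [k0 + n] the squared radius [4 n 4^-(k0+n)] is below 4 because [n < 2^n]. *)
have h4 j : trace ((prN (k0 + n)%N).1 j) =1 trace j.
  apply: fsym; apply: trace_eq; apply: le_lt_trans (h3 _ _) _; rewrite rhoE.
  rewrite -[ltRHS]mulr1 ltr_pM2l//; apply: le_lt_trans (_ : n%:R * 2^-1 ^+ n < _).
    rewrite ler_pM2l ?ltr0n//; apply: le_trans (half_le _) _.
    by rewrite exprD ger_pMl ?exprn_gt0// exprn_ile1 ?invr_ge0// invf_le1// ler1n.
  by rewrite exprVn ltr_pdivrMr ?exprn_gt0// mul1r -natrX ltr_nat ltn_expl.
have := @chaining R K n J trace a (fun k => (prN k).2) (fun k => (prN k).1)
  K0 n0 a0 a_mono h1 h2 _ k0 n h4.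
move=> chain; apply: le_subgauss_dominated (chain _) => [e||k j].
- rewrite le_eqVlt; apply/orP; left; apply/eqP; apply: eq_bigl => u.
  by rewrite rhoE trace_dist2E.
- by rewrite ler_pM2l ?sumW// !mulr_gt0// sqrtr_gt0 ltr0n.
- by apply: le_trans (h3 k j); rewrite trace_dist2E.
Qed.
End PolicyChaining.

(** * Random signs and symmetrization *)

Section SubGaussian.
Context {R : realType}.

(** By symmetry [t >= 0]. From 1/2 on, [cosh t <= exp t] is enough; below, [exp u <= 1 / (1 - u)]
    gives [1 / (1 - t^2) <= 1 + 2 t^2]. The constant 2, in place of the sharp 1/2, is what turns a
    bound [K] into the sub-Gaussian parameter [2 K] below. *)
Lemma cosh_le (t : R) : (expR t + expR (- t)) / 2 <= expR (2 * t ^+ 2).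
Proof.
wlog t0 : t / 0 <= t.
  have [t0|t0] := lerP 0 t; first by apply.
  move=> /(_ (- t)); rewrite oppr_ge0 opprK sqrrN addrC; apply; exact: ltW.
have [t2|t2] := lerP (2^-1) t.
  apply: le_trans (_ : expR t <= _); last by rewrite ler_expR; nra.
  have : expR (- t) <= expR t by rewrite ler_expR; lra.
  by lra.
have inv (u : R) : 0 < 1 - u -> expR u <= (1 - u)^-1.
  move=> u1; rewrite -[u in expR u]opprK expRN lef_pV2 ?posrE ?expR_gt0//.
  exact: expR_ge1Dx.
have t1 : 0 < 1 - t by lra.
have t1' : 0 < 1 - - t by lra.
apply: le_trans (_ : ((1 - t)^-1 + (1 - - t)^-1) / 2 <= _).
  by rewrite ler_pM2r ?invr_gt0// lerD ?inv.
have -> : ((1 - t)^-1 + (1 - - t)^-1) / 2 = (1 - t ^+ 2)^-1.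
  field; apply/and3P; split; rewrite gt_eqF//; nra.
apply: le_trans (_ : 1 + 2 * t ^+ 2 <= _); last exact: expR_ge1Dx.
have tt : 0 < 1 - t ^+ 2 by nra.
rewrite -[leLHS]mul1r ler_pdivrMr//.
have : 0 <= t ^+ 2 by exact: sqr_ge0.
have : t ^+ 2 <= 4^-1 by nra.
nra.
Qed.

(** Convexity on the interval from [- K] to [K]. The chord is affine in [e]: its linear part
    vanishes for centered noise, and its value at 0 is a hyperbolic cosine. *)
Lemma expR_le_chord (K c e : R) : 0 < K -> `|e| <= K ->
  expR (c * e) <= (expR (c * K) + expR (- (c * K))) / 2 +
     e * ((expR (c * K) - expR (- (c * K))) / (2 * K)).
Proof.
move=> K0; rewrite ler_norml => /andP[eK Ke].
have th0 : 0 <= (K + e) / (2 * K) by apply: divr_ge0; lra.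
have th1 : (K + e) / (2 * K) <= 1 by rewrite ler_pdivrMr ?mulr_gt0//; lra.
have := @convex_expR R (Itv01 th0 th1) (c * K) (- (c * K)).
rewrite !convRE /= /unstable.onem.
rewrite [X in expR X <= _](_ : _ = c * e); last by field; rewrite gt_eqF.
move/le_trans; apply; rewrite le_eqVlt; apply/orP; left; apply/eqP.
by field; rewrite gt_eqF.
Qed.

Definition sign_mean n (F : ('I_n -> R) -> R) : R :=
  2^-1 ^+ n * \sum_(eps : {ffun 'I_n -> bool}) F (fun i => trt (eps i)).

Lemma sign_mean_cst n (r : R) : sign_mean (fun _ : 'I_n -> R => r) = r.
Proof.
rewrite /sign_mean sumr_const card_ffun card_bool card_ord -(mulr_natl r).
by rewrite mulrA natrX exprVn mulVf ?mul1r// expf_neq0.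
Qed.

Lemma sign_meanD n (F G : ('I_n -> R) -> R) :
  sign_mean (fun e => F e + G e) = sign_mean F + sign_mean G.
Proof. by rewrite /sign_mean big_split mulrDr. Qed.

Lemma sign_meanZ n (r : R) (F : ('I_n -> R) -> R) :
  sign_mean (fun e => r * F e) = r * sign_mean F.
Proof. by rewrite /sign_mean -mulr_sumr mulrCA. Qed.

Lemma sign_mean_sum n I (s : seq I) (F : I -> ('I_n -> R) -> R) :
  sign_mean (fun e => \sum_(i <- s) F i e) = \sum_(i <- s) sign_mean (F i).
Proof. by rewrite /sign_mean exchange_big mulr_sumr. Qed.

Lemma le_sign_mean n (F G : ('I_n -> R) -> R) :
  (forall e, (forall i, `|e i| <= 1) -> F e <= G e) -> sign_mean F <= sign_mean G.
Proof.
move=> FG; rewrite ler_pM2l ?exprn_gt0//; apply: ler_sum => eps _; apply: FG => i.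
by rewrite /trt; case: (eps i); rewrite ?normrN normr1.
Qed.

Lemma sign_mean_expR n (K : R) (c y : 'I_n -> R) : 0 <= K -> (forall i, `|y i| <= K) ->
  sign_mean (fun e => expR (dot c (fun i => e i * y i))) <=
  expR ((2 * K) ^+ 2 * dot c c / 2).
Proof.
move=> K0 yK; rewrite /sign_mean.
under eq_bigr do rewrite /dot expR_sum.
rewrite -(bigA_distr_bigA (fun i (b : bool) => expR (c i * (trt b * y i)))).
rewrite -[X in _ ^+ X]card_ord -prodr_const -big_split /=.
rewrite /dot mulr_sumr mulr_suml expR_sum; apply: ler_prod => i _.
apply/andP; split.
  by rewrite mulr_ge0// sumr_ge0// => b _; exact: expR_ge0.
rewrite big_bool /= /trt mulN1r mulrN mul1r.
have := cosh_le (c i * y i); rewrite mulrC => /le_trans; apply.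
rewrite ler_expR exprMn.
have : y i ^+ 2 <= K ^+ 2 by rewrite -real_normK ?num_real// lerXn2r ?nnegrE.
have : 0 <= c i ^+ 2 by exact: sqr_ge0.
by rewrite !expr2; nra.
Qed.

Lemma sign_mean_dominated n (K b : R) (y : 'I_n -> R) (F : ('I_n -> R) -> R) :
  0 <= K -> (forall i, `|y i| <= K) -> subgauss_dominated (2 * K) F b ->
  sign_mean (fun e => F (fun i => e i * y i)) <= b.
Proof.
move=> K0 yK [L [a0 [al [c [al0 Fle Fb]]]]]; apply: le_trans Fb.
apply: le_trans (le_sign_mean (fun e _ => Fle _)) _.
rewrite sign_meanD sign_mean_cst lerD2l sign_mean_sum; apply: ler_sum => l _.
by rewrite sign_meanZ; apply: ler_wpM2l => //; exact: sign_mean_expR.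
Qed.

End SubGaussian.

Section TupleLaw.
Context d d' (Om : measurableType d) (T : measurableType d') (R : realType).
Variables (mu : probability Om R) (N : nat).

Definition tuple_of_fun (Y : 'I_N -> Om -> T) (w : Om) : N.-tuple T :=
  [tuple Y i w | i < N].

Lemma measurable_tuple_of_fun (Y : 'I_N -> Om -> T) :
  (forall i, measurable_fun setT (Y i)) -> measurable_fun setT (tuple_of_fun Y).
Proof.
move=> mY; apply/measurable_fun_tnthP => i.
by rewrite (_ : _ \o _ = Y i)//; apply/funext => w /=; rewrite tnth_mktuple.
Qed.

Let box (C : 'I_N -> set T) : set (N.-tuple T) :=
  \bigcap_(i in [set: 'I_N]) [set t | C i (tnth t i)].

Let boxes : set (set (N.-tuple T)) :=
  [set box C | C in [set C | forall i, measurable (C i)]].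

Let measurable_boxes : (measurable : set (set (N.-tuple T))) = <<s boxes >>.
Proof.
have mbox C : (forall i, measurable (C i)) -> measurable (box C).
  move=> mC; apply: fin_bigcap_measurable => // i _.
  by have := measurable_tnth i measurableT (mC i); rewrite setTI.
apply/seteqP; split; last first.
  apply: smallest_sub; first exact: sigma_algebra_measurable.
  by move=> _ [C mC <-]; exact: mbox.
apply: smallest_sub; first exact: smallest_sigma_algebra.
rewrite -bigcup_seq /= => A [i _ [B mB <-]].
apply: sub_sigma_algebra; exists (fun j => if j == i then B else setT).
  by move=> j /=; case: ifP.
apply/seteqP; split=> t /=.
  by move=> /(_ i I); rewrite eqxx.
by move=> [_ Bt] j _ /=; case: ifPn => // /eqP ->.
Qed.

Lemma eq_mean_tuple (Y Y' : 'I_N -> Om -> T) (G : N.-tuple T -> R) :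
  (forall i, measurable_fun setT (Y i)) -> (forall i, measurable_fun setT (Y' i)) ->
  (forall C : 'I_N -> set T, (forall i, measurable (C i)) ->
    mu (\bigcap_(i in [set: 'I_N]) (Y i @^-1` C i)) =
    mu (\bigcap_(i in [set: 'I_N]) (Y' i @^-1` C i))) ->
  bmeas G ->
  mean mu (G \o tuple_of_fun Y) = mean mu (G \o tuple_of_fun Y').
Proof.
move=> mY mY' YY' bG.
have mT := measurable_tuple_of_fun mY; have mT' := measurable_tuple_of_fun mY'.
rewrite /mean /Rintegral.
have push (Z : Om -> N.-tuple T) : measurable_fun setT Z ->
    (\int[mu]_w ((G \o Z) w)%:E = \int[pushforward mu Z]_t (G t)%:E)%E.
  move=> mZ; rewrite integral_pushforward//.
  - by apply/measurable_EFinP; case: bG.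
  - by rewrite preimage_setT; apply: bmeas_integrable; exact: bmeas_comp.
rewrite !push//; congr fine.
pose m1 : {measure set (N.-tuple T) -> \bar R} := pushforward mu (tuple_of_fun Y).
pose m2 : {measure set (N.-tuple T) -> \bar R} := pushforward mu (tuple_of_fun Y').
apply: (eq_measure_integral (m2 mT') (m1 := m1 mT)) => // A mA _.
apply: (@measure_unique _ _ _ boxes (fun=> setT) measurable_boxes _ _ _
  (m1 mT) (m2 mT')) => //.
- move=> _ _ [C mC <-] [D mD <-]; exists (fun i => C i `&` D i).
    by move=> i; apply: measurableI.
  apply/seteqP; split=> t /=.
    by move=> CD; split=> i _; have [] := CD i I.
  by move=> [Ct Dt] i _; split; [exact: Ct|exact: Dt].
- move=> _; exists (fun=> setT) => //.
  by apply/seteqP; split=> t.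
- by apply/seteqP; split=> t // _; exists 0%N.
- move=> _ [C mC <-]; rewrite /= /pushforward.
  have preE Z : tuple_of_fun Z @^-1` box C = \bigcap_(i in [set: 'I_N]) (Z i @^-1` C i).
    apply/seteqP; split=> w /= h i _; have := h i I; rewrite /= ?tnth_mktuple//.
  by rewrite !preE; exact: YY'.
- move=> _; rewrite /= /pushforward preimage_setT.
  by rewrite -ge0_fin_numE// fin_num_measure.
Qed.
End TupleLaw.

Lemma mean_fst d (Om : measurableType d) (R : realType) (Pr : probability Om R)
    (f : Om -> R) : bmeas f -> (forall w, 0 <= f w) ->
  mean (Pr \x Pr)%E (fun ww => f ww.1) = mean Pr f.
Proof.
move=> bf f0; rewrite /mean /Rintegral fubini_tonelli1; first last.
- by move=> ww; rewrite lee_fin.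
- by apply/measurable_EFinP; apply: measurableT_comp => //; case: bf.
congr fine; apply: eq_integral => w _; rewrite /fubini_F /=.
by rewrite integral_cst// -[RHS]mule1; congr (_ * _)%E; exact: probability_setT.
Qed.

Lemma mean_snd d (Om : measurableType d) (R : realType) (Pr : probability Om R)
    (f : Om -> R) : bmeas f -> (forall w, 0 <= f w) ->
  mean (Pr \x Pr)%E (fun ww => f ww.2) = mean Pr f.
Proof.
move=> bf f0; rewrite /mean /Rintegral fubini_tonelli1; first last.
- by move=> ww; rewrite lee_fin.
- by apply/measurable_EFinP; apply: measurableT_comp => //; case: bf.
congr fine; rewrite /fubini_F /= integral_cst// -[RHS]mule1.
by congr (_ * _)%E; exact: probability_setT.
Qed.

Section Symmetrization.
Context d d' (Om : measurableType d) (T : measurableType d') (R : realType).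
Variables (Pr : probability Om R) (nu : probability T R) (Xs : nat -> Om -> T).
Hypothesis mX : forall i, measurable_fun setT (Xs i).
Hypothesis iidX : forall N (C : 'I_N -> set T), (forall i, measurable (C i)) ->
  Pr (\bigcap_(i in [set: 'I_N]) (Xs i @^-1` C i)) = (\prod_(i < N) nu (C i))%E.

Lemma iid_marginal i (C : set T) : measurable C -> Pr (Xs i @^-1` C) = nu C.
Proof.
move=> mC.
have mD (j : 'I_i.+1) : measurable (if j == ord_max then C else setT) by case: ifP.
have := iidX mD; rewrite big_ord_recr /= eqxx big1 ?mul1e => [<-|j _]; last first.
  by rewrite ifN ?probability_setT// -val_eqE /= neq_ltn ltn_ord.
congr (Pr _); apply/seteqP; split=> w /=.
  by move=> Cw j _ /=; case: ifPn => // /eqP ->.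
by move=> /(_ ord_max I); rewrite eqxx.
Qed.

Lemma mean_marginal i (h : T -> R) : bmeas h -> mean Pr (h \o Xs i) = mean nu h.
Proof.
move=> bh; rewrite /mean /Rintegral; congr fine.
transitivity (\int[pushforward Pr (Xs i)]_t (h t)%:E)%E.
  rewrite integral_pushforward//.
  - by apply/measurable_EFinP; case: bh.
  - by rewrite preimage_setT; apply: bmeas_integrable; exact: bmeas_comp.
pose m1 : {measure set T -> \bar R} := pushforward Pr (Xs i).
apply: (eq_measure_integral nu (m1 := m1 (mX i))) => // A mA _.
exact: iid_marginal.
Qed.

Variables (n : nat) (J : finType) (h : J -> T -> R) (S : pred J).
Hypothesis bh : forall j, bmeas (h j).

Let maxS (F : J -> R) : R := \big[Num.max/0]_(j | S j) `|F j|.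

Let le_maxS (F G : J -> R) : (forall j, S j -> `|F j| <= `|G j|) -> maxS F <= maxS G.
Proof. by move=> FG; apply: le_bigmax2. Qed.

Let maxSB (F G : J -> R) : maxS (fun j => F j - G j) <= maxS F + maxS G.
Proof.
apply: bigmax_le => [|j Sj]; first by rewrite addr_ge0 ?bigmax_ge_id.
apply: le_trans (ler_normB _ _) _; apply: lerD.
  exact: (le_bigmax_cond 0 (fun j => `|F j|)).
exact: (le_bigmax_cond 0 (fun j => `|G j|)).
Qed.

Let bmaxS d1 (U : measurableType d1) (F : J -> U -> R) : (forall j, bmeas (F j)) ->
  bmeas (fun u => maxS (F ^~ u)).
Proof. by move=> bF; apply: bmeas_bigmax => j _; exact: bmeas_norm. Qed.

Let bX j i : bmeas (h j \o Xs i).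
Proof. exact: bmeas_comp. Qed.

(* Independent copy of the sample on the second coordinate of [Om * Om]. *)
Let ghost (eps : 'I_n -> bool) (k : 'I_(n + n)) (w : Om * Om) : T :=
  match fintype.split k with
  | inl i => if eps i then Xs i w.1 else Xs i w.2
  | inr i => if eps i then Xs i w.2 else Xs i w.1
  end.

Let mghost eps k : measurable_fun setT (ghost eps k).
Proof.
rewrite /ghost; case: fintype.split => i; case: (eps i);
  by apply: measurableT_comp.
Qed.

Let ghost_law eps (C : 'I_(n + n) -> set T) : (forall i, measurable (C i)) ->
  (Pr \x Pr)%E (\bigcap_(i in [set: 'I_(n + n)]) (ghost eps i @^-1` C i)) =
  (\prod_(i < n + n) nu (C i))%E.
Proof.
move=> mC.
pose D1 i := if eps i then C (lshift n i) else C (rshift n i).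
pose D2 i := if eps i then C (rshift n i) else C (lshift n i).
have mD1 i : measurable (D1 i) by rewrite /D1; case: ifP.
have mD2 i : measurable (D2 i) by rewrite /D2; case: ifP.
have mcap (D : 'I_n -> set T) : (forall i, measurable (D i)) ->
    measurable (\bigcap_(i in [set: 'I_n]) (Xs i @^-1` D i)).
  move=> mD; apply: fin_bigcap_measurable => // i _.
  by rewrite -[X in measurable X]setTI; exact: mX.
have -> : \bigcap_(i in [set: 'I_(n + n)]) (ghost eps i @^-1` C i) =
  (\bigcap_(i in [set: 'I_n]) (Xs i @^-1` D1 i)) `*`
  (\bigcap_(i in [set: 'I_n]) (Xs i @^-1` D2 i)).
  apply/seteqP; split=> [[w w']|[w w'] [/= w1 w2]] /=.
    move=> Cw; split=> i _ /=.
      rewrite /D1; have := Cw (lshift n i) I; have := Cw (rshift n i) I.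
      by rewrite /ghost /= !(unsplitK (inl i), unsplitK (inr i)) /=; case: (eps i).
    rewrite /D2; have := Cw (lshift n i) I; have := Cw (rshift n i) I.
    by rewrite /ghost /= !(unsplitK (inl i), unsplitK (inr i)) /=; case: (eps i).
  move=> k _; rewrite /ghost /= -[in C k](splitK k).
  case: (fintype.split k) => i /=; have := w1 i I; have := w2 i I;
    by rewrite /D1 /D2 /=; case: (eps i).
have -> : (Pr \x Pr)%E ((\bigcap_(i in [set: 'I_n]) (Xs i @^-1` D1 i)) `*`
    (\bigcap_(i in [set: 'I_n]) (Xs i @^-1` D2 i))) =
  (Pr (\bigcap_(i in [set: 'I_n]) (Xs i @^-1` D1 i)) *
   Pr (\bigcap_(i in [set: 'I_n]) (Xs i @^-1` D2 i)))%E.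
  by apply: product_measure1E; exact: mcap.
rewrite (iidX mD1) (iidX mD2) -big_split /= big_split_ord /= -big_split.
by apply: eq_bigr => i _; rewrite /D1 /D2; case: (eps i); rewrite // muleC.
Qed.

(** The means under [nu] are averages over an independent copy, and the maximum moves inside this
    average. Exchanging the two samples at any set of places preserves the law, so signs may be
    inserted and averaged; the triangle inequality then separates the two samples, whence the factor
    2. *)
Lemma symmetrization :
  mean Pr (fun w => maxS (fun j => \sum_(i < n) (h j (Xs i w) - mean nu (h j)))) <=
  2 * mean Pr (fun w => sign_mean (fun e : 'I_n -> R =>
        maxS (fun j => \sum_(i < n) e i * h j (Xs i w)))).
Proof.
pose D (w w' : Om) := maxS (fun j => \sum_(i < n) (h j (Xs i w) - h j (Xs i w'))).
pose G (t : (n + n).-tuple T) := maxS (fun j => \sum_(i < n)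
  (h j (tnth t (lshift n i)) - h j (tnth t (rshift n i)))).
have bG : bmeas G.
  apply: bmaxS => j; apply: bmeas_sum => i _; apply: bmeasB.
    by apply: (bmeas_comp (h := @tnth _ T ^~ (lshift n i)) (bh j)); exact: measurable_tnth.
  by apply: (bmeas_comp (h := @tnth _ T ^~ (rshift n i)) (bh j)); exact: measurable_tnth.
pose Deps (eps : 'I_n -> bool) (ww : Om * Om) := maxS (fun j => \sum_(i < n)
  trt (eps i) * (h j (Xs i ww.1) - h j (Xs i ww.2))).
have DE eps : Deps eps = G \o tuple_of_fun (ghost eps).
  apply/funext => ww; rewrite /Deps /G /=; congr maxS; apply/funext => j.
  apply: eq_bigr => i _; rewrite !tnth_mktuple /ghost.
  rewrite (unsplitK (inl i)) (unsplitK (inr i)) /trt.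
  by case: (eps i); ring.
have bDeps eps : bmeas (Deps eps).
  by rewrite DE; apply: bmeas_comp => //; exact: measurable_tuple_of_fun.
have mean_eps eps : mean (Pr \x Pr)%E (Deps eps) = mean (Pr \x Pr)%E (Deps xpredT).
  rewrite !DE; apply: eq_mean_tuple => // C mC.
  exact: etrans (ghost_law _ mC) (esym (ghost_law _ mC)).
have DT w w' : Deps xpredT (w, w') = D w w'.
  rewrite /Deps /D; congr maxS; apply/funext => j.
  by apply: eq_bigr => i _; rewrite /trt mul1r.
have bDw w : bmeas (D w).
  apply: bmaxS => j; apply: bmeas_sum => i _.
  by apply: bmeasB; [exact: bmeas_cst|exact: bX].
have bL : bmeas (fun w => maxS (fun j => \sum_(i < n) (h j (Xs i w) - mean nu (h j)))).
  apply: bmaxS => j; apply: bmeas_sum => i _.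
  by apply: bmeasB; [exact: bX|exact: bmeas_cst].
have L_le w : maxS (fun j => \sum_(i < n) (h j (Xs i w) - mean nu (h j))) <= mean Pr (D w).
  apply: bigmax_le => [|j Sj]; first by apply: mean_ge0 => w'; exact: bigmax_ge_id.
  have bj : bmeas (fun w' => \sum_(i < n) (h j (Xs i w) - h j (Xs i w'))).
    by apply: bmeas_sum => i _; apply: bmeasB; [exact: bmeas_cst|exact: bX].
  have -> : \sum_(i < n) (h j (Xs i w) - mean nu (h j)) =
      mean Pr (fun w' => \sum_(i < n) (h j (Xs i w) - h j (Xs i w'))).
    rewrite mean_sum => [|i _]; last by apply: bmeasB; [exact: bmeas_cst|exact: bX].
    apply: eq_bigr => i _; rewrite meanB; [|exact: bmeas_cst|exact: bX].
    by rewrite mean_cst -(mean_marginal i (bh j)).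
  apply: le_trans (mean_norm _ bj) _; apply: le_mean => //; first exact: bmeas_norm.
  by move=> w'; exact: (le_bigmax_cond 0 (fun j => `|_ j|)).
have D_ge0 w w' : 0 <= D w w' by exact: bigmax_ge_id.
have D_intE w : (\int[Pr]_w' (Deps xpredT (w, w'))%:E = (mean Pr (D w))%:E)%E.
  rewrite fineK; last exact: (integrable_fin_num measurableT (bmeas_integrable Pr (bDw w))).
  by apply: eq_integral => w' _; rewrite DT.
have mDeps : measurable_fun setT (EFin \o Deps xpredT).
  by apply/measurable_EFinP; case: (bDeps xpredT).
have Deps_ge0 ww : (0 <= (EFin \o Deps xpredT) ww)%E.
  by rewrite lee_fin; exact: bigmax_ge_id.
have fub : mean (Pr \x Pr)%E (Deps xpredT) = mean Pr (fun w => mean Pr (D w)).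
  rewrite [LHS]/mean /Rintegral fubini_tonelli1//.
  by rewrite {1}/mean /Rintegral; congr fine; apply: eq_integral => w _; rewrite -D_intE.
have bMD : bmeas (fun w => mean Pr (D w)).
  split.
    apply/measurable_EFinP.
    have := @measurable_fun_fubini_tonelli_F _ _ _ _ _ Pr _ mDeps Deps_ge0.
    congr (measurable_fun _ _); apply/funext => w.
    by rewrite /fubini_F /= D_intE.
  have [K DK] := (bDeps xpredT).2.
  by exists K => w; apply: norm_mean_le => // w'; rewrite -DT.
pose Reps (eps : 'I_n -> bool) w := maxS (fun j => \sum_(i < n) trt (eps i) * h j (Xs i w)).
have bReps eps : bmeas (Reps eps).
  by apply: bmaxS => j; apply: bmeas_sum => i _; apply: bmeasZ; exact: bX.
have Reps0 eps w : 0 <= Reps eps w by exact: bigmax_ge_id.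
have bR1 eps : bmeas (fun ww : Om * Om => Reps eps ww.1) by exact: (bmeas_comp (h := fst)).
have bR2 eps : bmeas (fun ww : Om * Om => Reps eps ww.2) by exact: (bmeas_comp (h := snd)).
have mean_Deps eps : mean (Pr \x Pr)%E (Deps eps) <= 2 * mean Pr (Reps eps).
  apply: le_trans (_ : mean (Pr \x Pr)%E (fun ww => Reps eps ww.1 + Reps eps ww.2) <= _).
    apply: le_mean => // [|ww]; first exact: bmeasD.
    apply: le_trans (maxSB _ _); rewrite /Deps le_eqVlt; apply/orP; left; apply/eqP.
    congr maxS; apply/funext => j; rewrite -sumrB.
    by apply: eq_bigr => i _; rewrite mulrBr.
  by rewrite meanD// mean_fst// mean_snd//; lra.
apply: le_trans (le_mean _ bL bMD L_le) _; rewrite -fub.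
rewrite -[leLHS](sign_mean_cst n) /sign_mean.
rewrite meanZ; last by apply: bmeas_sum => eps _; exact: bReps.
rewrite mulrCA ler_pM2l ?exprn_gt0// mean_sum => [|eps _]; last exact: bReps.
rewrite mulr_sumr; apply: ler_sum => eps _.
by rewrite -(mean_eps eps); exact: mean_Deps.
Qed.
End Symmetrization.

(** * Maximal inequalities over the increments of policies *)

Section PolicyEmpirical.
Context d d' d'' (Om : measurableType d) (T : measurableType d')
  (X : measurableType d'') (R : realType).
Variables (Pr : probability Om R) (nu : probability T R) (V : nat -> Om -> T).
Hypothesis mV : forall i, measurable_fun setT (V i).
Hypothesis iidV : forall N (C : 'I_N -> set T), (forall i, measurable (C i)) ->
  Pr (\bigcap_(i in [set: 'I_N]) (V i @^-1` C i)) = (\prod_(i < N) nu (C i))%E.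
Variable xval : T -> X.
Hypothesis mxval : measurable_fun setT xval.

Variables (C : set (X -> bool)) (a W : nat -> R).
Hypothesis a0 : forall k, 0 <= a k.
Hypothesis a_mono : forall k, a k <= a k.+1.
Hypothesis entC : dyadic_entropy C a.
Hypothesis sumW : forall k0 M,
  \sum_(k0 <= k < M) 2^-1 ^+ k * (1 + Num.sqrt (a k)) <= W k0.

Lemma W_ge0 k : 0 <= W k.
Proof. by apply: le_trans (sumW k 0); rewrite big_geq. Qed.

Variables (J : finType) (s : J -> X -> bool).
Hypothesis ms : forall j, measurable_fun setT (s j).
Hypothesis Cs : forall j, C (s j).

Definition gap (u : J * J) (x : X) : R := trt (s u.1 x) - trt (s u.2 x).

Lemma bmeas_trt d0 (U : measurableType d0) (p : U -> bool) :
  measurable_fun setT p -> bmeas (fun x => trt (p x) : R).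
Proof.
move=> mp; split; first exact: measurable_fun_ifT.
by exists 1 => x; rewrite /trt; case: (p x); rewrite ?normrN normr1.
Qed.

Lemma bmeas_gap u : bmeas (gap u \o xval).
Proof.
by apply: bmeas_comp => //; apply: bmeasB; apply: bmeas_trt; exact: ms.
Qed.

Lemma bmeas_gap2 u : bmeas (fun v => gap u (xval v) ^+ 2).
Proof. by under eq_fun do rewrite expr2; apply: bmeasM; exact: bmeas_gap. Qed.

Lemma gap2E u x : gap u x ^+ 2 = 4 * (s u.1 x != s u.2 x)%:R.
Proof.
by rewrite /gap /trt; case: (s _ _); case: (s _ _); rewrite ?subrr ?expr0n /=; ring.
Qed.

Variable n : nat.
Hypothesis n0 : (0 < n)%N.

(** One net suffices instead of a chain, as only an [o(n)] bound is wanted. Pairs of net points are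
    handled by the finite maximum, each vector having squared norm at most [16 n]; the second term
    is the error of projecting on the net. *)
Lemma sign_mean_gap2_le (x : 'I_n -> X) k :
  sign_mean (fun e => \big[Num.max/0]_(u : J * J) `|\sum_i e i * gap u (x i) ^+ 2|) <=
  16 * Num.sqrt n%:R * (1 + Num.sqrt (2 * a k)) + 16 * n%:R * (2^-1 ^+ k) ^+ 2.
Proof.
have [pr [N [prN cardN prd]]] := trace_net entC x n0 Cs k.
pose A := finset.setX N N.
pose v (u : J * J) (i : 'I_n) : R := gap u (x i) ^+ 2.
have sqn0 : 0 < Num.sqrt n%:R :> R by rewrite sqrtr_gt0 ltr0n.
have ak2 : 0 <= 2 * a k by rewrite mulr_ge0.
have dom : subgauss_dominated (2 * 1)
    (fun e => \big[Num.max/0]_(u in A) `|dot (v u) e|)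
    (2 * 1 * (4 * Num.sqrt n%:R) * Num.sqrt (2 * ln (3 * expR (2 * a k)))).
  apply: subgauss_dominated_max => //; first by rewrite mulr_gt0.
  - by apply: le_trans (expR_ge1Dx _); rewrite lerDl.
  - rewrite cardsX natrM mulr2n mulrDl mul1r expRD.
    by apply: ler_pM.
  - move=> u _; rewrite exprMn sqr_sqrtr// /dot.
    apply: le_trans (_ : \sum_(i < n) (4 ^+ 2 : R) <= _); last first.
      by rewrite sumr_const card_ord mulr_natr.
    by apply: ler_sum => i _; rewrite /v gap2E; case: (_ != _);
      rewrite /= ?mulr1 ?mulr0 expr2; lra.
pose pu (u : J * J) := (pr u.1, pr u.2).
apply: le_trans (_ : sign_mean (fun e => \big[Num.max/0]_(u in A) `|dot (v u) e| +
   8 * n%:R * (2^-1 ^+ k) ^+ 2) <= _).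
  apply: le_sign_mean => e e1; apply: bigmax_le => [|u _].
    by rewrite addr_ge0 ?bigmax_ge_id// !mulr_ge0// exprn_ge0// exprn_ge0.
  have -> : \sum_i e i * gap u (x i) ^+ 2 =
      dot (v (pu u)) e + \sum_i e i * (v u i - v (pu u) i).
    by rewrite /dot -big_split; apply: eq_bigr => i _ /=; rewrite /v; ring.
  apply: le_trans (ler_normD _ _) _; apply: lerD.
    apply: (le_bigmax_cond 0 (fun u => `|dot (v u) e|)).
    by rewrite inE /= !prN.
  apply: le_trans (ler_norm_sum _ _ _) _.
  (* If the squared gap changes at a point, one of the two policies differs there from its
     projection, and this alone contributes 4 to the trace distance. *)
  apply: le_trans (_ : trace_dist2 s x u.1 (pr u.1) + trace_dist2 s x u.2 (pr u.2) <= _).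
    rewrite /trace_dist2 -big_split; apply: ler_sum => i _ /=.
    rewrite normrM; apply: le_trans (_ : `|v u i - v (pu u) i| <= _).
      by rewrite ler_piMl.
    rewrite /v !gap2E /trace /pu /trt /=.
    by case: (s u.1 _); case: (s u.2 _); case: (s (pr u.1) _); case: (s (pr u.2) _);
      rewrite /= ?ler_norml ?mulr1 ?mulr0 ?expr2; lra.
  by have := prd u.1; have := prd u.2; lra.
rewrite sign_meanD sign_mean_cst; apply: lerD; last first.
  by rewrite ler_pM2r ?exprn_gt0// ler_pM2r ?ltr0n//; lra.
have n11 (i : 'I_n) : `|1 : R| <= 1 by rewrite normr1.
apply: le_trans (le_trans _ (sign_mean_dominated ler01 n11 dom)) _.
  apply: le_sign_mean => e _; rewrite (_ : (fun i => e i * 1) = e)//.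
  by apply/funext => i; rewrite mulr1.
have := sqrt_ln3expR_le ak2; rewrite -(ler_pM2l (mulr_gt0 _ sqn0 : 0 < 8 * _))//.
by clear n11; lra.
Qed.

Let x_ w (i : 'I_n) : X := xval (V i w).

Definition mean_gap2 (u : J * J) : R := mean nu (fun v => gap u (xval v) ^+ 2).

Definition gap2_dev (w : Om) : R := \big[Num.max/0]_(u : J * J)
  `|\sum_(i < n) (gap u (xval (V i w)) ^+ 2 - mean_gap2 u)|.

Lemma bmeas_gapV u i : bmeas (fun w => gap u (xval (V i w))).
Proof. exact: (bmeas_comp (bmeas_gap u)). Qed.

Lemma bmeas_gap2V u i : bmeas (fun w => gap u (xval (V i w)) ^+ 2).
Proof. exact: (bmeas_comp (bmeas_gap2 u)). Qed.

Lemma bmeas_gap2_dev : bmeas gap2_dev.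
Proof.
apply: bmeas_bigmax => u _; apply: bmeas_norm; apply: bmeas_sum => i _.
by apply: bmeasB; [exact: bmeas_gap2V|exact: bmeas_cst].
Qed.

Lemma mean_gap2_dev_le k :
  mean Pr gap2_dev <=
  32 * Num.sqrt n%:R * (1 + Num.sqrt (2 * a k)) + 32 * n%:R * (2^-1 ^+ k) ^+ 2.
Proof.
apply: le_trans (symmetrization mV iidV n xpredT bmeas_gap2) _.
have /(ler_wpM2l (ler0n R 2)) : mean Pr (fun w => sign_mean (fun e : 'I_n -> R =>
    \big[Num.max/0]_(u : J * J) `|\sum_i e i * gap u (xval (V i w)) ^+ 2|)) <=
    16 * Num.sqrt n%:R * (1 + Num.sqrt (2 * a k)) + 16 * n%:R * (2^-1 ^+ k) ^+ 2.
  rewrite -[leRHS](mean_cst Pr); apply: le_mean; last by move=> w; exact: sign_mean_gap2_le.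
    apply: bmeasZ; apply: bmeas_sum => eps _; apply: bmeas_bigmax => u _.
    apply: bmeas_norm; apply: bmeas_sum => i _; apply: bmeasZ; exact: bmeas_gap2V.
  exact: bmeas_cst.
by move/le_trans; apply; lra.
Qed.

Variables (S : pred (J * J)) (k0 : nat).
Hypothesis SP : forall u, S u -> (0 < k0)%N -> mean_gap2 u <= 2 * (2^-1 ^+ k0) ^+ 2.

Let close w k : Prop := forall u, S u ->
  trace_dist2 s (x_ w) u.1 u.2 <= 4 * (n%:R * (2^-1 ^+ k) ^+ 2) :> R.

(** Stands for the indicator that some pair of [S] is farther apart on the sample than [close]
    allows: such a pair exceeds twice its mean allowance, so [far_weight] is at least 1 there. Its
    mean is small by the uniform law of large numbers, and it is a function of the traces only. *)
Let far_weight w : R := gap2_dev w / (2 * n%:R * (2^-1 ^+ k0) ^+ 2).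

Let scale_gt0 : 0 < 2 * n%:R * (2^-1 ^+ k0) ^+ 2 :> R.
Proof. by rewrite !mulr_gt0 ?ltr0n// exprn_gt0// exprn_gt0. Qed.

Let far_weight_ge0 w : 0 <= far_weight w.
Proof. by rewrite divr_ge0 ?bigmax_ge_id// ltW. Qed.

Let bmeas_far_weight : bmeas far_weight.
Proof. by apply: bmeasM; [exact: bmeas_gap2_dev|exact: bmeas_cst]. Qed.

Let close0 w : close w 0.
Proof.
move=> u _; rewrite /trace_dist2 expr0 expr1n mulr1.
apply: le_trans (_ : \sum_(i < n) (4 : R) <= _).
  apply: ler_sum => i _; rewrite -/(gap u _) /trace -/(gap u (x_ w i)) gap2E.
  by case: (_ != _); rewrite /= ?mulr1 ?mulr0.
by rewrite sumr_const card_ord mulr_natr.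
Qed.

Let close_or_far w : close w k0 \/ 1 <= far_weight w.
Proof.
have [cl|nc] := pselect (close w k0); [by left|right].
have k0_gt0 : (0 < k0)%N.
  by case: (posnP k0) nc => // -> nc; case: nc; exact: close0.
move: nc => /existsNP[u /not_implyP[Su /negP]]; rewrite -ltNge => far.
rewrite ler_pdivlMr// mul1r; apply: le_trans (le_bigmax 0 (fun u => `|\sum_(i < n)
  (gap u (xval (V i w)) ^+ 2 - mean_gap2 u)|) u).
apply: le_trans (ler_norm _); rewrite sumrB sumr_const card_ord -(mulr_natl (mean_gap2 u)).
have := SP Su k0_gt0; rewrite -(ler_pM2l (_ : 0 < n%:R :> R)) ?ltr0n// => le.
have {}far : 4 * (n%:R * (2^-1 ^+ k0) ^+ 2) < \sum_(i < n) gap u (xval (V i w)) ^+ 2 by [].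
lra.
Qed.

(** When the pairs of [S] are close on the sample, chaining starts at [k0]; otherwise it starts at
    scale 0, at the price [W 0], which [far_weight w >= 1] pays. *)
Lemma chaining_bound w K : 0 < K -> exists (F : ('I_n -> R) -> R) b,
  [/\ subgauss_dominated K F b,
      b <= 64 * K * Num.sqrt n%:R * (W k0 + W 0 * far_weight w) &
      forall e, \big[Num.max/0]_(u | S u) `|\sum_i gap u (x_ w i) * e i| <= F e].
Proof.
move=> K0.
have c0 : 0 <= 64 * K * Num.sqrt n%:R by rewrite !mulr_ge0// ltW.
have sub k : close w k -> forall e,
    \big[Num.max/0]_(u | S u) `|\sum_i gap u (x_ w i) * e i| <=
    \big[Num.max/0]_(u : J * J | trace_dist2 s (x_ w) u.1 u.2 <= 4 * (n%:R * (2^-1 ^+ k) ^+ 2) :> R)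
       `|dot (fun i => trace s (x_ w) u.1 i - trace s (x_ w) u.2 i) e|.
  by move=> cl e; apply: sub_bigmax => u /cl.
have [cl|far] := close_or_far w.
  have := policy_chaining a0 a_mono entC sumW (x_ w) n0 Cs k0 K0; set F := (F in subgauss_dominated _ F _).
  move=> dom; exists F; eexists; split; [exact: dom| |exact: sub].
  by rewrite ler_wpM2l// lerDl mulr_ge0// W_ge0.
have := policy_chaining a0 a_mono entC sumW (x_ w) n0 Cs 0 K0; set F := (F in subgauss_dominated _ F _).
move=> dom; exists F; eexists; split; [exact: dom| |apply: sub; exact: close0].
rewrite ler_wpM2l//; have := W_ge0 0; have := W_ge0 k0.
by have : W 0 * 1 <= W 0 * far_weight w by [rewrite ler_wpM2l ?W_ge0]; lra.
Qed.

Variable be : R.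
Hypothesis far_mean : mean Pr gap2_dev <= be * (2 * n%:R * (2^-1 ^+ k0) ^+ 2).

Let mean_far_weight : mean Pr far_weight <= be.
Proof.
have -> : mean Pr far_weight = (2 * n%:R * (2^-1 ^+ k0) ^+ 2)^-1 * mean Pr gap2_dev.
  rewrite -meanZ; last exact: bmeas_gap2_dev.
  by apply: eq_mean => w; rewrite mulrC.
by rewrite ler_pdivrMl// mulrC.
Qed.

Let mean_bound c : 0 <= c ->
  mean Pr (fun w => c * (W k0 + W 0 * far_weight w)) <= c * (W k0 + W 0 * be).
Proof.
move=> c0; have bW : bmeas (fun w => W 0 * far_weight w) by exact: bmeasZ.
rewrite meanZ; last by apply: bmeasD => //; exact: bmeas_cst.
rewrite ler_wpM2l// meanD ?mean_cst//; last exact: bmeas_cst.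
by rewrite lerD2l meanZ// ler_wpM2l// W_ge0.
Qed.

(** After symmetrization the factors [b (V i)] are attached to the signs, so that the vectors being
    chained are again the gaps. Symmetrization and the parameter [2 K] of the weighted signs each
    contribute a factor 2 to [256 = 4 * 64]. *)
Lemma iid_process_le (b : T -> R) K : 0 < K -> bmeas b -> (forall v, `|b v| <= K) ->
  mean Pr (fun w => \big[Num.max/0]_(u | S u) `|\sum_(i < n)
      (gap u (xval (V i w)) * b (V i w) - mean nu (fun v => gap u (xval v) * b v))|) <=
  256 * K * Num.sqrt n%:R * (W k0 + W 0 * be).
Proof.
move=> K0 bb bK.
have bh u : bmeas (fun v => gap u (xval v) * b v).
  by apply: bmeasM => //; exact: bmeas_gap.
apply: le_trans (symmetrization mV iidV n S bh) _.
have K2 : 0 < 2 * K by rewrite mulr_gt0.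
have c0 : 0 <= 64 * (2 * K) * Num.sqrt n%:R by rewrite !mulr_ge0// ltW.
have := mean_bound c0; rewrite -(ler_pM2l (ltr0n R 2)) => /(le_trans _) le_b.
apply: le_trans (le_b _ _) _; last first.
  by rewrite le_eqVlt; apply/orP; left; apply/eqP; ring.
rewrite ler_pM2l//; apply: le_mean => [||w].
- apply: bmeasZ; apply: bmeas_sum => eps _; apply: bmeas_bigmax => u _.
  apply: bmeas_norm; apply: bmeas_sum => i _; apply: bmeasZ.
  exact: (bmeas_comp (bh u)).
- by apply: bmeasZ; apply: bmeasD; [exact: bmeas_cst|exact: bmeasZ].
have [F [b0 [dom b0_le Fle]]] := chaining_bound w K2.
apply: le_trans b0_le.
have bKw (i : 'I_n) : `|b (V i w)| <= K by exact: bK.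
apply: le_trans (sign_mean_dominated (ltW K0) bKw dom).
apply: le_sign_mean => e _; apply: le_trans (Fle _).
by rewrite le_eqVlt; apply/orP; left; apply/eqP; apply: eq_bigr => u _;
  congr (`|_|); apply: eq_bigr => i _; rewrite mulrCA.
Qed.

Let cell (ta : {ffun J * 'I_n -> bool}) : set Om :=
  [set w | [forall ji, s ji.1 (x_ w ji.2) == ta ji]].

(** Conditioning on the covariates is done cell by cell. On a cell the gaps and [far_weight] are
    constant, so a single dominating function serves there; it is integrated using the
    sub-Gaussianity of the noise on that cell, and the indicators of the cells sum to 1. *)
Lemma noise_process_le (e : 'I_n -> Om -> R) K : 0 < K -> (forall i, bmeas (e i)) ->
  (forall (ta : {ffun J * 'I_n -> bool}) (c : 'I_n -> R),
     mean Pr (fun w => \1_(cell ta) w * expR (dot c (e ^~ w))) <=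
     expR (K ^+ 2 * dot c c / 2) * mean Pr (\1_(cell ta) : Om -> R)) ->
  mean Pr (fun w => \big[Num.max/0]_(u | S u) `|\sum_(i < n)
      gap u (xval (V i w)) * e i w|) <=
  64 * K * Num.sqrt n%:R * (W k0 + W 0 * be).
Proof.
move=> K0 be_ hsub; pose M w := \big[Num.max/0]_(u | S u) `|\sum_(i < n)
      gap u (xval (V i w)) * e i w|.
have c0 : 0 <= 64 * K * Num.sqrt n%:R by rewrite !mulr_ge0// ltW.
pose Bd w := 64 * K * Num.sqrt n%:R * (W k0 + W 0 * far_weight w).
apply: le_trans (mean_bound c0); rewrite -/M -/Bd.
have mcell ta : measurable (cell ta).
  rewrite (_ : cell ta = \bigcap_(ji in [set: J * 'I_n]) [set w | s ji.1 (x_ w ji.2) = ta ji]).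
    apply: fin_bigcap_measurable => // -[j i] _ /=.
    have msV : measurable_fun setT (fun w => s j (x_ w i)).
      by apply: measurableT_comp; [exact: ms|exact: measurableT_comp].
    by have := msV measurableT [set ta (j, i)] I; rewrite setTI.
  by apply/seteqP; split=> [w /forallP h ji _|w h]; [apply/eqP; exact: h|
    apply/forallP => ji; apply/eqP; exact: h].
have bcell ta : bmeas (\1_(cell ta) : Om -> R) by exact: bmeas_indic.
have bM : bmeas M.
  apply: bmeas_bigmax => u _; apply: bmeas_norm; apply: bmeas_sum => i _.
  by apply: bmeasM => //; exact: bmeas_gapV.
have bBd : bmeas Bd.
  by apply: bmeasZ; apply: bmeasD; [exact: bmeas_cst|exact: bmeasZ].
have sum_cell w : \sum_(ta : {ffun J * 'I_n -> bool}) \1_(cell ta) w = 1 :> R.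
  pose ta0 := [ffun ji : J * 'I_n => s ji.1 (x_ w ji.2)].
  rewrite (bigD1 ta0)//= indicE mem_set ?big1 ?addr0//; last first.
    by apply/forallP => ji; rewrite ffunE.
  move=> ta ne; rewrite indicE memNset// => /forallP h.
  by move/eqP: ne; apply; apply/ffunP => ji; rewrite ffunE; apply/esym/eqP.
have split_cell (f : Om -> R) : bmeas f ->
    mean Pr f = \sum_(ta : {ffun J * 'I_n -> bool}) mean Pr (fun w => \1_(cell ta) w * f w).
  move=> bf; rewrite -mean_sum => [|ta _]; last exact: bmeasM.
  by apply: eq_mean => w; rewrite -mulr_suml sum_cell mul1r.
rewrite (split_cell M)// (split_cell Bd)//; apply: ler_sum => ta _.
have [[w0 cw0]|empty] := pselect (cell ta !=set0); last first.
  have cell0 w : \1_(cell ta) w = 0 :> R.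
    by rewrite indicE memNset// => cw; apply: empty; exists w.
  by rewrite le_eqVlt; apply/orP; left; apply/eqP; apply: eq_mean => w; rewrite !cell0 !mul0r.
have xE w : cell ta w -> forall j (i : 'I_n), s j (xval (V i w)) = s j (xval (V i w0)).
  move=> /forallP cw j i; have /eqP := cw (j, i) => /= ->.
  by move: cw0 => /forallP /(_ (j, i)) /eqP.
have gapE w u (i : 'I_n) : cell ta w -> gap u (xval (V i w)) = gap u (xval (V i w0)).
  by move=> cw; rewrite /gap !(xE w cw _ i).
have BdE w : \1_(cell ta) w * Bd w = Bd w0 * \1_(cell ta) w.
  rewrite indicE; case: (boolP (w \in cell ta)) => [/set_mem cw|_]; last by rewrite mul0r mulr0.
  rewrite mul1r mulr1 /Bd /far_weight /gap2_dev; congr (_ * (_ + _ * (_ / _))).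
  apply: eq_bigr => u _; congr (`|_|); apply: eq_bigr => i _.
  by rewrite gapE.
have -> : mean Pr (fun w => \1_(cell ta) w * Bd w) = Bd w0 * mean Pr (\1_(cell ta) : Om -> R).
  by rewrite -meanZ//; apply: eq_mean => w; exact: BdE.
have [F [b0 [[L [al0 [al [c [al_ge0 Fexp expb]]]]] b0_le Fle]]] := chaining_bound w0 K0.
have cell_ge0 w : 0 <= \1_(cell ta) w :> R by rewrite indicE.
have bexp l : bmeas (fun w => \1_(cell ta) w * expR (dot (c l) (e ^~ w))).
  apply: bmeasM => //; apply: bmeas_expR; apply: bmeas_sum => i _; exact: bmeasZ.
apply: le_trans (_ : mean Pr (fun w => al0 * \1_(cell ta) w +
    \sum_l al l * (\1_(cell ta) w * expR (dot (c l) (e ^~ w)))) <= _).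
  apply: le_mean => [||w]; first exact: bmeasM.
    by apply: bmeasD; [exact: bmeasZ|apply: bmeas_sum => l _; exact: bmeasZ].
  have -> : al0 * \1_(cell ta) w + \sum_l al l * (\1_(cell ta) w * expR (dot (c l) (e^~ w))) =
    \1_(cell ta) w * (al0 + \sum_l al l * expR (dot (c l) (e^~ w))).
    rewrite mulrDr mulrC mulr_sumr; congr (_ + _); apply: eq_bigr => l _; ring.
  rewrite indicE; case: (boolP (w \in cell ta)) => [/set_mem cw|_]; last by rewrite !mul0r.
  rewrite !mul1r; apply: le_trans (Fexp _); apply: le_trans (Fle _).
  rewrite le_eqVlt; apply/orP; left; apply/eqP; apply: eq_bigr => u _.
  by congr (`|_|); apply: eq_bigr => i _; rewrite gapE.
rewrite meanD ?meanZ//; [|exact: bmeasZ|by apply: bmeas_sum => l _; exact: bmeasZ].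
rewrite mean_sum => [|l _]; last exact: bmeasZ.
apply: le_trans (_ : b0 * mean Pr (\1_(cell ta) : Om -> R) <= _); last first.
  by rewrite ler_wpM2r// mean_ge0.
apply: le_trans (_ : (al0 + \sum_l al l * expR (K ^+ 2 * dot (c l) (c l) / 2)) *
    mean Pr (\1_(cell ta) : Om -> R) <= _); last by rewrite ler_wpM2r// mean_ge0.
rewrite mulrDl lerD2l mulr_suml; apply: ler_sum => l _.
by rewrite meanZ// -mulrA ler_wpM2l// hsub.
Qed.
End PolicyEmpirical.

(** * The sequential design as a martingale *)

Section Martingale.
Context d d' d'' (Om : measurableType d) (T : measurableType d')
  (X : measurableType d'') (R : realType).
Variables (Pr : probability Om R) (nu : probability T R).
Variables (V : nat -> Om -> T) (A : nat -> Om -> bool).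
Hypothesis mV : forall i, measurable_fun setT (V i).
Hypothesis mA : forall i, measurable_fun setT (A i).
Hypothesis iidV : forall N (C : 'I_N -> set T), (forall i, measurable (C i)) ->
  Pr (\bigcap_(i in [set: 'I_N]) (V i @^-1` C i)) = (\prod_(i < N) nu (C i))%E.
Variable xval : T -> X.
Hypothesis mxval : measurable_fun setT xval.

Definition before_gen (l : nat) : set (set Om) :=
  [set E | (exists j C, measurable C /\ E = V j @^-1` C) \/
           (exists j b, (j < l)%N /\ E = A j @^-1` [set b])].

Variable n : nat.

Definition boxes (k : nat) : set (set Om) :=
  [set E | exists (C : 'I_n -> set T) (D : set X),
    [/\ forall i, measurable (C i), measurable D &
        E = (\bigcap_(i in [set i : 'I_n | val i != k]) (V i @^-1` C i)) `&`
            ((xval \o V k) @^-1` D)]].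

(* All of the sample of size [n] except the outcomes at time [k], and the
   treatments before time [l]. *)
Definition masked_gen (k l : nat) : set (set Om) :=
  [set E | boxes k E \/ exists j b, (j < l)%N /\ E = A j @^-1` [set b]].

Lemma boxes_setI k : setI_closed (boxes k).
Proof.
move=> _ _ [C [D [mC mD ->]]] [C' [D' [mC' mD' ->]]].
exists (fun i => C i `&` C' i), (D `&` D'); split.
- by move=> i; exact: measurableI.
- exact: measurableI.
- apply/seteqP; split=> w /=.
    move=> [[Cw Dw] [Cw' Dw']]; split=> // i ik.
    by split; [exact: Cw|exact: Cw'].
  move=> [CC [Dw Dw']]; split; split=> // i ik; first exact: (CC i ik).1.
  exact: (CC i ik).2.
Qed.

Let preV_measurable i C : measurable C -> measurable (V i @^-1` C).
Proof. by move=> mC; rewrite -[X in measurable X]setTI; exact: mV. Qed.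

Lemma boxes_before k l E : (k < n)%N -> boxes k E -> <<s before_gen l >> E.
Proof.
move=> kn [C [D [mC mD ->]]].
have sub F : before_gen l F -> <<s before_gen l >> F by exact: sub_gen_smallest.
pose G := g_sigma_algebraType (before_gen l).
have : (measurable : set (set G)) ((\bigcap_(i in [set i : 'I_n | val i != k]) (V i @^-1` C i)) `&`
            ((xval \o V k) @^-1` D)).
  apply: measurableI.
    apply: fin_bigcap_measurable => // i _.
    by apply: sub; left; exists i, (C i).
  apply: sub; left; exists k, (xval @^-1` D); split=> //.
  by rewrite -[X in measurable X]setTI; exact: mxval.
by [].
Qed.

Lemma masked_before k l E : (k < n)%N -> <<s masked_gen k l >> E -> <<s before_gen l >> E.
Proof.
move=> kn; apply: smallest_sub; first exact: smallest_sigma_algebra.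
move=> F [bF|[j [b [jl ->]]]]; first exact: boxes_before bF.
by apply: sub_gen_smallest; right; exists j, b.
Qed.

Lemma before_measurable l E : <<s before_gen l >> E -> measurable E.
Proof.
apply: smallest_sub; first exact: sigma_algebra_measurable.
move=> _ [[j [C [mC ->]]]|[j [b [_ ->]]]]; first exact: preV_measurable.
by rewrite -[X in measurable X]setTI; exact: mA.
Qed.

Local Notation masked k l := (g_sigma_algebraType (masked_gen k l)).
Local Notation before l := (g_sigma_algebraType (before_gen l)).

Lemma measurable_masked_V k l (i : nat) : (i < n)%N -> i != k ->
  measurable_fun setT (V i : masked k l -> T).
Proof.
move=> iN ik _ C mC; rewrite setTI; apply: sub_gen_smallest; left.
exists (fun j => if val j == i then C else setT), setT; split=> //.
  by move=> j; case: ifP.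
apply/seteqP; split=> w /=.
  by move=> Cw; split=> // j _ /=; case: ifPn => // /eqP ->.
by move=> [/(_ (Ordinal iN) ik)]; rewrite /= eqxx.
Qed.

Lemma measurable_masked_X k l (i : nat) : (i < n)%N ->
  measurable_fun setT (xval \o V i : masked k l -> X).
Proof.
move=> iN; have [->|ik] := eqVneq i k; last first.
  by apply: measurableT_comp => //; exact: measurable_masked_V.
move=> _ D mD; rewrite setTI; apply: sub_gen_smallest; left.
exists (fun=> setT), D; split=> //.
by apply/seteqP; split=> w //= [].
Qed.

Lemma measurable_masked_A k l (j : nat) : (j < l)%N ->
  measurable_fun setT (A j : masked k l -> bool).
Proof.
move=> jl; apply: (measurable_fun_bool true); rewrite setTI.
by apply: sub_gen_smallest; right; exists j, true.
Qed.

Lemma measurable_before_V l i : measurable_fun setT (V i : before l -> T).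
Proof.
by move=> _ C mC; rewrite setTI; apply: sub_gen_smallest; left; exists i, C.
Qed.

Lemma measurable_before_masked d0 (U : measurableType d0) k l (f : Om -> U) :
  (k < n)%N -> measurable_fun setT (f : masked k l -> U) ->
  measurable_fun setT (f : before l -> U).
Proof.
by move=> kn mf _ C mC; rewrite setTI; apply: (@masked_before k l _ kn);
  have := mf measurableT C mC; rewrite setTI.
Qed.

Lemma masked_measurable d0 (U : measurableType d0) k l (f : Om -> U) :
  (k < n)%N -> measurable_fun setT (f : masked k l -> U) -> measurable_fun setT f.
Proof.
move=> kn mf _ C mC; rewrite setTI; apply: (@before_measurable l); apply: (@masked_before k l _ kn).
by have := mf measurableT C mC; rewrite setTI.
Qed.

Variable gt : nat -> Om -> R.
Hypothesis gt01 : forall l w, (l < n)%N -> 0 <= gt l w <= 1.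
Hypothesis mgt : forall k l, (l <= k)%N -> (k < n)%N ->
  measurable_fun setT (gt l : masked k l -> R).
Hypothesis draw : forall l E, (l < n)%N -> <<s before_gen l >> E ->
  mean Pr (fun w => (A l w)%:R * \1_E w) = mean Pr (fun w => gt l w * \1_E w).

Lemma bmeas_gt l : (l < n)%N -> bmeas (gt l).
Proof.
move=> ln; split; first exact: (masked_measurable ln (mgt (leqnn l) ln)).
by exists 1 => w; have /andP[g0 g1] := gt01 w ln; rewrite ger0_norm.
Qed.

Lemma bmeas_A l : bmeas (fun w => (A l w)%:R : R).
Proof. exact: bmeas_natr. Qed.

Lemma draw_orth l (W : Om -> R) : (l < n)%N -> bmeas W ->
  measurable_fun setT (W : before l -> R) ->
  mean Pr (fun w => (A l w)%:R * W w) = mean Pr (fun w => gt l w * W w).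
Proof.
move=> ln bW mW; have [K WK] := bW.2; have bg := bmeas_gt ln; have bA := bmeas_A l.
apply/eqP; rewrite -subr_eq0 -meanB; try exact: bmeasM.
apply/eqP; transitivity (mean Pr (fun w => ((A l w)%:R - gt l w) * W w)).
  by apply: eq_mean => w; rewrite mulrBl.
apply: (orth_bounded (H := before_gen l) _ _ mW WK); first exact: bmeasB.
move=> E sE; have mE := before_measurable sE; split=> //.
transitivity (mean Pr (fun w => (A l w)%:R * \1_E w - gt l w * \1_E w)).
  by apply: eq_mean => w; rewrite mulrBl.
by rewrite meanB ?draw ?subrr//; apply: bmeasM => //; exact: bmeas_indic.
Qed.

(** The treatment being binary, the sets described by one masked set where [A l] is true and by
    another where it is false form a sigma-algebra, and it contains the generators. *)
Lemma masked_split k l E : <<s masked_gen k l.+1 >> E ->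
  exists E1 E0, [/\ <<s masked_gen k l >> E1, <<s masked_gen k l >> E0 &
    forall w, E w <-> if A l w then E1 w else E0 w].
Proof.
move: E; apply: smallest_sub => [|E].
  split.
  - exists set0, set0; split; [exact: (@measurable0 _ (masked k l))|
      exact: (@measurable0 _ (masked k l))|].
    by move=> w; case: (A l w).
  - move=> E [E1 [E0 [mE1 mE0 EP]]]; exists (~` E1), (~` E0); split.
    + exact: (@measurableC _ (masked k l)).
    + exact: (@measurableC _ (masked k l)).
    + move=> w; rewrite setTD /=; have := EP w; case: (A l w) => /= h;
        by split=> nE /h.
  - move=> F /choice[F1 /choice[F0 FP]].
    exists (\bigcup_i F1 i), (\bigcup_i F0 i); split.
    + by apply: (@bigcup_measurable _ (masked k l)) => i _; have [] := FP i.
    + by apply: (@bigcup_measurable _ (masked k l)) => i _; have [] := FP i.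
    + move=> w; split=> [[i _ Fw]|].
        have [_ _ /(_ w) [/(_ Fw) + _]] := FP i.
        by case: (A l w) => Fi; exists i.
      by case Alw: (A l w) => -[i _ Fw]; exists i => //; have [_ _ /(_ w)] := FP i;
        rewrite Alw => h; apply/h.
case=> [bE|[j [b [jl ->]]]].
  by exists E, E; split; [apply: sub_gen_smallest; left|apply: sub_gen_smallest; left|
    move=> w; case: (A l w)].
move: jl; rewrite ltnS leq_eqVlt => /predU1P[->|jl].
  exists [set _ | b = true], [set _ | b = false].
  have cst (Q : Prop) : <<s masked_gen k l >> [set _ : Om | Q].
    have [q|q] := pselect Q.
      rewrite (_ : [set _ | Q] = setT); first exact: (@measurableT _ (masked k l)).
      by apply/seteqP; split.
    rewrite (_ : [set _ | Q] = set0); first exact: (@measurable0 _ (masked k l)).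
    by apply/seteqP; split.
  by split=> // w /=; case: (A l w); split=> /esym.
exists (A j @^-1` [set b]), (A j @^-1` [set b]).
by split; [apply: sub_gen_smallest; right; exists j, b|
  apply: sub_gen_smallest; right; exists j, b|move=> w; case: (A l w)].
Qed.

Section Centered.
Variable psi : T -> R.
Hypothesis bpsi : bmeas psi.
Hypothesis psi0 : forall D : set X, measurable D ->
  mean nu (fun v => psi v * \1_D (xval v)) = 0.

(** A box bears on [V k] only through [D]; its other part [F] is independent of [V k]. Hence
    [1_F - Pr F] is orthogonal to every bounded function of [V k], in particular to [psi (V k) 1_D],
    whose mean is zero. *)
Lemma box_orth k E : (k < n)%N -> boxes k E ->
  mean Pr (fun w => psi (V k w) * \1_E w) = 0.
Proof.
move=> kn [C [D [mC mD ->]]].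
pose F := \bigcap_(i in [set i : 'I_n | val i != k]) (V i @^-1` C i).
have mF : measurable F.
  by apply: fin_bigcap_measurable => // i _; exact: preV_measurable.
pose Y w : R := \1_F w - fine (Pr F).
have bY : bmeas Y by apply: bmeasB; [exact: bmeas_indic|exact: bmeas_cst].
pose H := [set V k @^-1` B | B in (measurable : set (set T))].
have HP E0 : <<s H >> E0 -> measurable E0 /\ mean Pr (fun w => Y w * \1_E0 w) = 0.
  apply: orth_sigma => //.
  - move=> _ _ [B mB <-] [B' mB' <-]; exists (B `&` B') => //.
    exact: measurableI.
  - by move=> _ [B mB <-]; exact: preV_measurable.
  - rewrite meanB; [|exact: bmeas_indic|exact: bmeas_cst].
    by rewrite mean_cst mean_indic// subrr.
  - move=> _ [B mB <-].
    have mB' := preV_measurable k mB.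
    transitivity (mean Pr (fun w => \1_(F `&` V k @^-1` B) w - fine (Pr F) * \1_(V k @^-1` B) w)).
      by apply: eq_mean => w; rewrite indicI /Y /=; ring.
    rewrite meanB; [|by apply: bmeas_indic; exact: measurableI|
      by apply: bmeasZ; exact: bmeas_indic].
    rewrite meanZ ?mean_indic//; [|exact: measurableI|exact: bmeas_indic].
    have bigE (B0 : set T) : measurable B0 -> Pr (F `&` V k @^-1` B0) =
        (\prod_(i < n | val i != k) nu (C i) * nu B0)%E.
      move=> mB0; pose C' (i : 'I_n) := if val i == k then B0 else C i.
      have mC' i : measurable (C' i) by rewrite /C'; case: ifP.
      rewrite (_ : F `&` _ = \bigcap_(i in [set: 'I_n]) (V i @^-1` C' i)).
        rewrite (iidV mC') (bigD1 (Ordinal kn))//= muleC /C' eqxx; congr (_ * _)%E.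
        by apply: eq_big => i; [rewrite -val_eqE|move=> ik; rewrite ifN].
      apply/seteqP; split=> w /=.
        by move=> [Fw Bw] i _; rewrite /C' /=; case: ifPn => [/eqP ->//|]; exact: Fw.
      move=> Cw; split=> [i ik|]; have := Cw _ I; rewrite /C' /=.
        by move=> /(_ i); rewrite ifN.
      by move=> /(_ (Ordinal kn)); rewrite /= eqxx.
    have := bigE setT measurableT; rewrite preimage_setT setIT probability_setT mule1 => FE.
    have := bigE B mB; rewrite -FE -(iid_marginal iidV k mB) => ->.
    by rewrite fineM ?subrr// fin_num_measure.
have [K psiK] := bpsi.2.
pose W w := psi (V k w) * \1_D (xval (V k w)).
have bW0 : bmeas (fun v => psi v * \1_D (xval v)).
  by apply: bmeasM => //; exact: (bmeas_comp (bmeas_indic mD)).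
have [K' WK] := bW0.2.
have mW : measurable_fun setT (W : g_sigma_algebraType H -> R).
  move=> _ B mB; rewrite setTI; apply: sub_gen_smallest.
  exists ((fun v => psi v * \1_D (xval v)) @^-1` B) => //.
  by rewrite -[X in measurable X]setTI; apply: bW0.1.
have := orth_bounded bY HP mW (fun w => WK (V k w)).
have bW : bmeas W by exact: (bmeas_comp bW0).
have -> : (fun w => Y w * W w) = (fun w => psi (V k w) * \1_(F `&` (xval \o V k) @^-1` D) w
    - fine (Pr F) * W w).
  apply/funext => w; rewrite indicI /Y /W /= /indic; ring.
have bE : bmeas (fun w => psi (V k w) * \1_(F `&` (xval \o V k) @^-1` D) w).
  apply: bmeasM; first exact: (bmeas_comp bpsi).
  apply: bmeas_indic; apply: measurableI => //.
  by rewrite -[X in measurable X]setTI; apply: measurableT_comp.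
rewrite meanB ?meanZ//; last exact: bmeasZ.
by rewrite (mean_marginal mV iidV k bW0) psi0// mulr0 subr0.
Qed.

(** Induction on the number of revealed treatments. Splitting [E] along [A l] leaves products of
    [A l] with [psi (V k)] and the indicator of a set of the masked sigma-algebra at [l]. As the
    draw is specified given all the full data, outcomes at time [k] included, [A l] may be replaced
    by [gt l], which is itself measurable for that sigma-algebra, and the induction hypothesis
    applies. *)
Lemma masked_orth k l E : (l <= k)%N -> (k < n)%N -> <<s masked_gen k l >> E ->
  measurable E /\ mean Pr (fun w => psi (V k w) * \1_E w) = 0.
Proof.
move=> + kn; elim: l E => [|l IH] E lk.
  have -> : masked_gen k 0 = boxes k.
    by apply/seteqP; split=> F; [case=> // -[j [b []]]|left].
  apply: orth_sigma.
  - exact: (bmeas_comp bpsi).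
  - exact: boxes_setI.
  - by move=> F bF; apply: (@before_measurable 0); exact: boxes_before bF.
  - rewrite (mean_marginal mV iidV k bpsi) -(psi0 measurableT).
    by apply: eq_mean => v; rewrite indicT mulr1.
  - by move=> F; exact: box_orth.
have ln : (l < n)%N by exact: ltn_trans kn.
have lk' : (l <= k)%N by exact: ltnW.
have bpV : bmeas (psi \o V k) by exact: (bmeas_comp bpsi).
move=> sE; split.
  by apply: (@before_measurable l.+1); exact: masked_before kn _.
have [E1 [E0 [sE1 sE0 EP]]] := masked_split sE.
have [mE1 orth1] := IH _ lk' sE1; have [mE0 orth0] := IH _ lk' sE0.
have draw_psi F : <<s masked_gen k l >> F ->
    mean Pr (fun w => (A l w)%:R * (psi (V k w) * \1_F w)) = 0.
  move=> sF; have [mF _] := IH _ lk' sF.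
  have bF : bmeas (\1_F : Om -> R) by exact: bmeas_indic.
  rewrite draw_orth//; first last.
  - apply: measurable_funM.
      by apply: measurableT_comp; [case: bpsi|exact: measurable_before_V].
    apply: measurable_indic; exact: masked_before kn _.
  - exact: bmeasM.
  have [K gK] := (bmeasM (bmeas_gt ln) bF).2.
  transitivity (mean Pr (fun w => psi (V k w) * (gt l w * \1_F w))).
    by apply: eq_mean => w; rewrite mulrCA.
  apply: (orth_bounded (H := masked_gen k l) _ _ _ gK) => //.
  - by move=> F'; exact: IH.
  - apply: measurable_funM; first exact: mgt.
    exact: measurable_indic.
have bA := bmeas_A l.
have bi F : measurable F -> bmeas (fun w => (A l w)%:R * (psi (V k w) * \1_F w)).
  by move=> mF; apply: bmeasM => //; apply: bmeasM => //; exact: bmeas_indic.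
transitivity (mean Pr (fun w => (A l w)%:R * (psi (V k w) * \1_E1 w) +
   (psi (V k w) * \1_E0 w - (A l w)%:R * (psi (V k w) * \1_E0 w)))).
  apply: eq_mean => w; have -> : \1_E w = (if A l w then \1_E1 w else \1_E0 w) :> R.
    rewrite !indicE; have := EP w; case: (A l w) => h;
      by congr (_%:R); congr nat_of_bool; apply/idP/idP => /set_mem /h /mem_set.
  by case: (A l w) => /=; ring.
have bp0 : bmeas (fun w => psi (V k w) * \1_E0 w) by apply: bmeasM => //; exact: bmeas_indic.
rewrite meanD; [|exact: bi|by apply: bmeasB => //; exact: bi].
by rewrite draw_psi// meanB//; [rewrite orth0 draw_psi// subrr addr0|exact: bi].
Qed.

Lemma masked_orth_bounded k (W : Om -> R) : (k < n)%N -> bmeas W ->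
  measurable_fun setT (W : masked k k -> R) ->
  mean Pr (fun w => psi (V k w) * W w) = 0.
Proof.
move=> kn bW mW; have [K WK] := bW.2.
apply: (orth_bounded (H := masked_gen k k) _ _ mW WK) => //.
- exact: (bmeas_comp bpsi).
- by move=> E; exact: masked_orth.
Qed.

End Centered.

Section Noise.
Variables (phi : bool -> T -> R) (K : R).
Hypothesis K0 : 0 < K.
Hypothesis bphi : forall b, bmeas (phi b).
Hypothesis phiK : forall b v, `|phi b v| <= K.
Hypothesis phi0 : forall b (D : set X), measurable D ->
  mean nu (fun v => phi b v * \1_D (xval v)) = 0.

Definition noise (k : nat) (w : Om) : R := phi (A k w) (V k w).

Lemma noise_ifE k : noise k = (fun w => if A k w then phi true (V k w) else phi false (V k w)).
Proof. by apply/funext => w; rewrite /noise; case: (A k w). Qed.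

Lemma bmeas_noise k : bmeas (noise k).
Proof.
split; last by exists K => w; exact: phiK.
rewrite noise_ifE; apply: measurable_fun_ifT => //.
  by apply: measurableT_comp => //; case: (bphi true).
by apply: measurableT_comp => //; case: (bphi false).
Qed.

(** The treatment [A k] is removed in the same way: the noise is affine in it, and once [A k] is
    replaced by [gt k] only centered functions of [V k] against masked weights remain. *)
Lemma noise_orth k (W : Om -> R) : (k < n)%N -> bmeas W ->
  measurable_fun setT (W : masked k k -> R) ->
  mean Pr (fun w => noise k w * W w) = 0.
Proof.
move=> kn bW mW.
pose psi v := phi true v - phi false v.
have bpsi : bmeas psi by exact: bmeasB.
have psi0 (D : set X) : measurable D -> mean nu (fun v => psi v * \1_D (xval v)) = 0.
  move=> mD; have bD b : bmeas (fun v => phi b v * \1_D (xval v)).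
    by apply: bmeasM => //; exact: (bmeas_comp (bmeas_indic mD)).
  transitivity (mean nu (fun v => phi true v * \1_D (xval v) - phi false v * \1_D (xval v))).
    by apply: eq_mean => v; rewrite mulrBl.
  by rewrite meanB// !phi0// subrr.
have bpsiV : bmeas (psi \o V k) by exact: (bmeas_comp bpsi).
have bfV : bmeas (phi false \o V k) by exact: (bmeas_comp (bphi false)).
have bA := bmeas_A k; have bg := bmeas_gt kn.
transitivity (mean Pr (fun w => (A k w)%:R * (psi (V k w) * W w) + phi false (V k w) * W w)).
  by apply: eq_mean => w; rewrite /noise /psi; case: (A k w) => /=; ring.
rewrite meanD; [|by apply: bmeasM => //; exact: bmeasM|exact: bmeasM].
rewrite (masked_orth_bounded (bphi false) (phi0 false))// addr0 draw_orth//.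
- rewrite -[RHS](masked_orth_bounded bpsi psi0 kn (bmeasM bg bW)).
    by apply: eq_mean => w; rewrite mulrCA.
  by apply: measurable_funM => //; exact: mgt.
- exact: bmeasM.
- apply: measurable_funM; last exact: measurable_before_masked mW.
  by apply: measurableT_comp; [case: bpsi|exact: measurable_before_V].
Qed.

(** Azuma-Hoeffding recursion. The last factor lies below its chord, whose linear part is orthogonal
    to the earlier factors; these, like [E], are measurable for the masked sigma-algebra at [m]. As
    [E] belongs to every masked sigma-algebra, it may fix the covariates of all times, future ones
    included. *)
Lemma noise_expR_le (E : set Om) (c : nat -> R) m : (m <= n)%N ->
  (forall k l, (k < n)%N -> <<s masked_gen k l >> E) ->
  mean Pr (fun w => \1_E w * expR (\sum_(i < m) c i * noise i w)) <=
  expR ((2 * K) ^+ 2 * (\sum_(i < m) c i ^+ 2) / 2) * mean Pr (\1_E : Om -> R).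
Proof.
move=> + mE; elim: m => [_|m IH mn].
  rewrite !big_ord0 mulr0 mul0r expR0 mul1r le_eqVlt; apply/orP; left; apply/eqP.
  by apply: eq_mean => w; rewrite big_ord0 expR0 mulr1.
have {}IH := IH (ltnW mn).
have bE : bmeas (\1_E : Om -> R).
  by apply: bmeas_indic; apply: (@before_measurable 0); exact: masked_before mn (mE _ _ mn).
pose W w := \1_E w * expR (\sum_(i < m) c i * noise i w).
have bW : bmeas W.
  apply: bmeasM => //; apply: bmeas_expR; apply: bmeas_sum => i _.
  by apply: bmeasZ; exact: bmeas_noise.
have mW : measurable_fun setT (W : masked m m -> R).
  apply: measurable_funM; first by apply: measurable_indic; exact: mE.
  apply: measurableT_comp => //; apply: measurable_sum => i.
  apply: measurable_funM => //; rewrite noise_ifE.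
  have mVi : measurable_fun setT (V i : masked m m -> T).
    by apply: measurable_masked_V; [exact: ltn_trans mn|rewrite neq_ltn ltn_ord].
  apply: measurable_fun_ifT; first exact: measurable_masked_A.
    by apply: measurableT_comp => //; case: (bphi true).
  by apply: measurableT_comp => //; case: (bphi false).
set ch := (expR (c m * K) + expR (- (c m * K))) / 2.
set sh := (expR (c m * K) - expR (- (c m * K))) / (2 * K).
have W0 w : 0 <= W w by rewrite mulr_ge0 ?expR_ge0// indicE.
have bN := bmeas_noise m.
apply: le_trans (_ : mean Pr (fun w => ch * W w + sh * (noise m w * W w)) <= _).
  apply: le_mean => [||w].
  - apply: bmeasM => //; apply: bmeas_expR; apply: bmeas_sum => i _.
    by apply: bmeasZ; exact: bmeas_noise.
  - by apply: bmeasD; apply: bmeasZ => //; exact: bmeasM.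
  rewrite big_ord_recr /= expRD [leLHS]mulrA -/(W w).
  rewrite (_ : ch * W w + _ = W w * (ch + noise m w * sh)); last by ring.
  by apply: ler_wpM2l => //; apply: expR_le_chord => //; exact: phiK.
rewrite meanD; [|exact: bmeasZ|by apply: bmeasZ; exact: bmeasM].
rewrite !meanZ//; last exact: bmeasM.
rewrite noise_orth// mulr0 addr0 big_ord_recr /= mulrDr mulrDl expRD.
apply: le_trans (_ : expR ((2 * K) ^+ 2 * c m ^+ 2 / 2) * mean Pr W <= _).
  rewrite ler_wpM2r ?mean_ge0//; apply: le_trans (cosh_le _) _.
  by rewrite ler_expR le_eqVlt; apply/orP; left; apply/eqP; field.
by rewrite [X in _ <= X * _]mulrC -[leRHS]mulrA; apply: ler_wpM2l => //; exact: expR_ge0.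
Qed.

Lemma noise_subgauss (E : set Om) (c : 'I_n -> R) :
  (forall k l, (k < n)%N -> <<s masked_gen k l >> E) ->
  mean Pr (fun w => \1_E w * expR (dot c (fun i => noise i w))) <=
  expR ((2 * K) ^+ 2 * dot c c / 2) * mean Pr (\1_E : Om -> R).
Proof.
move=> mE; pose c' i := if insub i is Some j then c j else 0.
have c'E (i : 'I_n) : c' i = c i by rewrite /c' valK.
have := noise_expR_le c' (leqnn n) mE.
rewrite (_ : \sum_(i < n) c' i ^+ 2 = dot c c); last first.
  by apply: eq_bigr => i _; rewrite c'E expr2.
move/(le_trans _); apply; rewrite le_eqVlt; apply/orP; left; apply/eqP.
apply: eq_mean => w; congr (_ * expR _).
by apply: eq_bigr => i _; rewrite c'E.
Qed.

End Noise.

End Martingale.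

(** The identity on sets extends to step functions, then to [F] by uniform approximation; the
    tolerance is divided by [1 + L0 + L1], which bounds the total mass of the two sides. *)
Lemma mean_mixture d d' (T : measurableType d) (U : measurableType d') (R : realType)
    (mu : probability T R) (nu : probability U R) (o : bool -> T -> U)
    (wt : bool -> T -> R) :
  (forall b, measurable_fun setT (o b)) -> (forall b, bmeas (wt b)) ->
  (forall C, measurable C ->
     fine (nu C) = mean mu (fun v => \sum_b wt b v * \1_C (o b v))) ->
  forall F, bmeas F -> mean nu F = mean mu (fun v => \sum_b wt b v * F (o b v)).
Proof.
move=> mo bwt nuE F bF; have [K FK] := bF.2.
have bo G b : bmeas G -> bmeas (fun v => wt b v * G (o b v)).
  by move=> bG; apply: bmeasM => //; exact: (bmeas_comp bG).
have bsum G : bmeas G -> bmeas (fun v => \sum_b wt b v * G (o b v)).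
  by move=> bG; apply: bmeas_sum => b _; exact: bo.
have [L0 wL0] := (bwt true).2; have [L1 wL1] := (bwt false).2.
have L0_ge0 : 0 <= L0 by exact: le_trans (wL0 point).
have L1_ge0 : 0 <= L1 by exact: le_trans (wL1 point).
apply/eqP; rewrite -subr_eq0 -normr_le0; apply/ler_addgt0Pl => e e0; rewrite addr0.
have d0 : 0 < e / (1 + L0 + L1) by rewrite divr_gt0// -addrA ltr_pwDl// addr_ge0.
have [M [c [S [mS FS]]]] := simple_approx bF.1 FK d0.
have bS i : bmeas (\1_(S i) : U -> R) by exact: bmeas_indic.
pose Fn (x : U) := \sum_i c i * \1_(S i) x.
have bFn : bmeas Fn by apply: bmeas_sum => i _; exact: bmeasZ.
have FnE : mean nu Fn = mean mu (fun v => \sum_b wt b v * Fn (o b v)).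
  rewrite mean_sum => [|i _]; last exact: bmeasZ.
  transitivity (mean mu (fun v => \sum_i c i * (\sum_b wt b v * \1_(S i) (o b v)))).
    rewrite mean_sum => [|i _]; last by apply: bmeasZ; exact: bsum.
    apply: eq_bigr => i _; rewrite !meanZ//; last exact: bsum.
    by rewrite mean_indic// nuE.
  apply: eq_mean => v; under eq_bigr do rewrite mulr_sumr.
  rewrite exchange_big; apply: eq_bigr => b _; rewrite /Fn mulr_sumr.
  by apply: eq_bigr => i _; rewrite mulrCA.
have -> : mean nu F - mean mu (fun v => \sum_b wt b v * F (o b v)) =
    mean nu (fun x => F x - Fn x) -
    mean mu (fun v => \sum_b wt b v * (F (o b v) - Fn (o b v))).
  rewrite meanB//.
  have -> : mean mu (fun v => \sum_b wt b v * (F (o b v) - Fn (o b v))) =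
    mean mu (fun v => \sum_b wt b v * F (o b v) - \sum_b wt b v * Fn (o b v)).
    by apply: eq_mean => v; rewrite -sumrB; apply: eq_bigr => b _; rewrite mulrBr.
  by rewrite meanB; [rewrite FnE; ring|exact: bsum|exact: bsum].
set dl := e / (1 + L0 + L1) in d0 FS *.
have bFF : bmeas (fun x => F x - Fn x) by exact: bmeasB.
apply: le_trans (ler_normB _ _) _.
apply: le_trans (lerD (norm_mean_le _ bFF FS) (norm_mean_le (K := (L0 + L1) * dl) _ (bsum _ bFF) _)) _.
- move=> v; rewrite big_bool /=; apply: le_trans (ler_normD _ _) _.
  by rewrite mulrDl !normrM lerD// ler_pM// FS.
- rewrite -{1}[dl]mul1r -mulrDl /dl mulrCA addrA divff ?mulr1//.
  by rewrite gt_eqF// -addrA ltr_pwDl// addr_ge0.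
Qed.

(** * The reference law *)

Section SamplingLaw.
Context d (X : measurableType d) (R : realType) (PP : probability (fulldata X R) R).
Variable g : bool -> X -> R.
Hypothesis g_ge0 : forall a x, 0 <= g a x.
Hypothesis g_sum : forall x, g true x + g false x = 1.
Hypothesis mg : forall a, measurable_fun setT (g a).

Let g01 x : 0 <= g true x <= 1.
Proof. by rewrite g_ge0 -(g_sum x) lerDl g_ge0. Qed.

Lemma bmeas_g a : bmeas (g a).
Proof.
split=> //; exists 1 => x; rewrite ger0_norm//.
by rewrite -(g_sum x); case: a; rewrite ?lerDl ?lerDr g_ge0.
Qed.

Definition sample_point (a : bool) (v : fulldata X R) : obs X R * R :=
  (observe v a, g a v.1.1).

Lemma measurable_potential a :
  measurable_fun setT (fun v : fulldata X R => potential v a).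
Proof.
by case: a; [exact: measurable_snd|exact: measurableT_comp].
Qed.

Lemma measurable_xval : measurable_fun setT (fun v : fulldata X R => v.1.1).
Proof. exact: measurableT_comp. Qed.

Lemma measurable_observe a :
  measurable_fun setT (fun v : fulldata X R => observe v a).
Proof.
apply: measurable_fun_pair; last exact: measurable_potential.
by apply: measurable_fun_pair; [exact: measurable_xval|].
Qed.

Lemma measurable_sample_point a : measurable_fun setT (sample_point a).
Proof.
apply: measurable_fun_pair; first exact: measurable_observe.
by apply: measurableT_comp; [exact: mg|exact: measurable_xval].
Qed.

Let mix (C : set (obs X R * R)) (v : fulldata X R) : R :=
  \sum_a g a v.1.1 * \1_C (sample_point a v).

Let bernoulli_mix C v :
  bernoulli_prob (g true v.1.1) [set a | C (observe v a, g a v.1.1)] = (mix C v)%:E.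
Proof.
have mixE : mix C v = g true v.1.1 * \1_C (sample_point true v) +
    g false v.1.1 * \1_C (sample_point false v) by rewrite /mix big_bool.
rewrite bernoulli_probE//.
have -> : unstable.onem (g true v.1.1) = g false v.1.1.
  by rewrite /unstable.onem -(g_sum v.1.1) addrC addKr.
rewrite mixE EFinD !EFinM !diracE.
congr (_ * _ + _ * _)%E; rewrite indicE /sample_point;
  by congr ((nat_of_bool _)%:R%:E); apply/idP/idP => /set_mem /mem_set.
Qed.

Let bmix C : measurable C -> bmeas (mix C).
Proof.
move=> mC; apply: bmeas_sum => a _; apply: bmeasM.
  by apply: (bmeas_comp (bmeas_g a)); exact: measurable_xval.
by apply: (bmeas_comp (bmeas_indic mC)); exact: measurable_sample_point.
Qed.

Lemma sampling_law_mean C : measurable C ->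
  sampling_law PP g C = (mean PP (mix C))%:E.
Proof.
move=> mC; rewrite /sampling_law; under eq_integral do rewrite bernoulli_mix.
rewrite /mean /Rintegral fineK//.
exact: integrable_fin_num (bmeas_integrable PP (bmix mC)).
Qed.

Lemma sampling_law0 : sampling_law PP g set0 = 0%E.
Proof.
rewrite sampling_law_mean// -[0%E]/(0%:E); congr EFin.
rewrite -[RHS](mean_cst PP 0); apply: eq_mean => v; rewrite /mix big1// => a _.
by rewrite indic0 mulr0.
Qed.

Lemma sampling_law_ge0 C : (0 <= sampling_law PP g C)%E.
Proof. by apply: integral_ge0 => v _; exact: measure_ge0. Qed.

Lemma sampling_law_sigma_additive : semi_sigma_additive (sampling_law PP g).
Proof.
move=> F mF tF mUF.
have -> : sampling_law PP g (\bigcup_n F n) = (\sum_(n <oo) sampling_law PP g (F n))%E.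
  rewrite /sampling_law -integral_nneseries//.
  - apply: eq_integral => v _.
    rewrite -(@measure_semi_bigcup _ _ _ (bernoulli_prob (g true v.1.1))
      (fun n => [set a | F n (observe v a, g a v.1.1)]))//.
    move=> i j _ _ [a [/= Fi Fj]]; apply: tF => //.
    by exists (observe v a, g a v.1.1).
  - move=> n; under eq_fun do rewrite bernoulli_mix.
    by apply/measurable_EFinP; case: (bmix (mF n)).
by apply: is_cvg_nneseries => n _ _; exact: sampling_law_ge0.
Qed.

Lemma sampling_lawT : sampling_law PP g setT = 1%E.
Proof.
rewrite sampling_law_mean// -[1%E]/(1%:E); congr EFin.
rewrite -[RHS](mean_cst PP 1); apply: eq_mean => v; rewrite /mix big_bool /=.
by rewrite !indicT !mulr1 g_sum.
Qed.

HB.instance Definition _ := isMeasure.Build _ _ _ (sampling_law PP g)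
  sampling_law0 sampling_law_ge0 sampling_law_sigma_additive.

HB.instance Definition _ := Measure_isProbability.Build _ _ _ (sampling_law PP g)
  sampling_lawT.

(** In [Gtilde] the integral is taken against the bare set function; with this structure it becomes
    the mean under a probability. *)
Definition sampling_prob : probability (obs X R * R)%type R := sampling_law PP g.

Lemma mean_sampling_prob F : bmeas F ->
  mean sampling_prob F = mean PP (fun v => \sum_a g a v.1.1 * F (sample_point a v)).
Proof.
move=> bF; apply: (mean_mixture (o := sample_point) (wt := fun a v => g a v.1.1)) => //.
- exact: measurable_sample_point.
- by move=> a; apply: (bmeas_comp (bmeas_g a)); exact: measurable_xval.
- by move=> C mC; have /= := sampling_law_mean mC => ->.
Qed.

End SamplingLaw.

(** * Truncated versions of propensity and regression, and the centering of [f_pol] *)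

Definition clamp {R : realType} (r : R) : R := Num.max 0 (Num.min r 1).

Lemma clamp01 {R : realType} (r : R) : 0 <= clamp r <= 1.
Proof. by rewrite /clamp le_max lexx/= ge_max ler01/= ge_min lexx orbT. Qed.

Lemma clampK {R : realType} (r : R) : 0 <= r <= 1 -> clamp r = r.
Proof. by move=> /andP[r0 r1]; rewrite /clamp min_l// max_r. Qed.

Lemma bmeas_clamp d (T : measurableType d) (R : realType) (f : T -> R) :
  measurable_fun setT f -> bmeas (fun x => clamp (f x)).
Proof.
move=> mf; split.
  by apply: measurable_maxr => //; exact: measurable_minr.
by exists 1 => x; have /andP[f0 f1] := clamp01 (f x); rewrite ger0_norm.
Qed.

Section Regression.
Context d (X : measurableType d) (R : realType).
Variables (P : probability (obs X R) R) (p m : bool -> X -> R) (delta : R).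
Hypotheses (hp : is_propensity P p) (hm : is_regression P m).
Hypothesis hdelta : 0 < delta < 2^-1.
Hypothesis hoverlap : {ae P, forall o, delta <= p true o.1.1 <= 1 - delta}.
Variable PP : probability (fulldata X R) R.
Hypothesis hZ : {ae PP, forall v, forall a, 0 <= potential v a <= 1}.
Hypothesis hY : {ae P, forall o, 0 <= o.2 <= 1}.
Hypothesis hconsistent : forall C : set (obs X R), measurable C ->
  P C = sampling_law PP p [set ow | C ow.1].

Let p_ge0 a x : 0 <= p a x. Proof. by case: hp => _ + _ _; apply. Qed.
Let p_sum x : p true x + p false x = 1. Proof. by case: hp. Qed.
Let mp a : measurable_fun setT (p a). Proof. by case: hp. Qed.
Let mm a : measurable_fun setT (m a). Proof. by case: hm. Qed.
Let delta_gt0 : 0 < delta. Proof. by case/andP: hdelta. Qed.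

Let obs_x : obs X R -> X := fun o => o.1.1.
Let obs_a : obs X R -> bool := fun o => o.1.2.
Let mobs_x : measurable_fun setT obs_x. Proof. exact: measurableT_comp. Qed.
Let mobs_a : measurable_fun setT obs_a. Proof. exact: measurableT_comp. Qed.

Lemma mean_obs (F : obs X R -> R) : bmeas F ->
  mean P F = mean PP (fun v => \sum_a p a v.1.1 * F (observe v a)).
Proof.
move=> bF; apply: (mean_mixture (o := fun a v => observe v a) (wt := fun a v => p a v.1.1)) => //.
- by move=> a; exact: measurable_observe.
- by move=> a; apply: (bmeas_comp (bmeas_g p_ge0 p_sum mp a)); exact: measurable_xval.
- move=> C mC.
  have mC' : measurable [set ow : obs X R * R | C ow.1].
    by rewrite -[X in measurable X]setTI; exact: measurable_fst.
  by rewrite hconsistent// sampling_law_mean.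
Qed.

Lemma mean_obs_x (F : X -> R) : bmeas F ->
  mean P (fun o => F o.1.1) = mean PP (fun v => F v.1.1).
Proof.
move=> bF; rewrite mean_obs; last exact: (bmeas_comp bF).
by apply: eq_mean => v; rewrite big_bool /= -mulrDl p_sum mul1r.
Qed.

Lemma mset_obs_x (D : set X) : measurable D -> measurable [set o : obs X R | D o.1.1].
Proof. by move=> mD; rewrite -[X in measurable X]setTI; exact: mobs_x. Qed.

Lemma mset_x (D : set X) : measurable D -> measurable [set v : fulldata X R | D v.1.1].
Proof.
move=> mD; rewrite -[X in measurable X]setTI.
exact: (@measurable_xval _ X R measurableT D).
Qed.

Lemma law_obs_x (D : set X) : measurable D ->
  P [set o | D o.1.1] = PP [set v | D v.1.1].
Proof.
move=> mD; have mDo := mset_obs_x mD; have mDv := mset_x mD.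
rewrite -[LHS]fineK ?fin_num_measure// -[RHS]fineK ?fin_num_measure//; congr EFin.
rewrite -!mean_indic//.
have := mean_obs_x (bmeas_indic mD); congr (_ = _); apply: eq_mean => o;
  by rewrite !indicE; congr ((nat_of_bool _)%:R); apply/idP/idP => /set_mem /mem_set.
Qed.

Lemma ae_obs_x (D : set X) : measurable D -> {ae P, forall o, D o.1.1} ->
  {ae PP, forall v, D v.1.1}.
Proof.
move=> mD aeD; have mDC : measurable (~` D) by exact: measurableC.
apply/negligibleP; first exact: measurableC (mset_x mD).
have := law_obs_x mDC; rewrite /= => <-.
by apply/negligibleP => //; exact: mset_obs_x mDC.
Qed.

(** [p] and [m] are versions, hence in their natural range only almost surely. [pc], its inverse and
    [mc] are bounded everywhere, and [pc] and [mc] agree with [p] and [m] at [sound] points. *)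
Definition pc (a : bool) (x : X) : R := Num.max (p a x) delta.
Definition mc (a : bool) (x : X) : R := clamp (m a x).

Lemma pc_ge a x : delta <= pc a x.
Proof. by rewrite /pc le_max lexx orbT. Qed.

Lemma pc_gt0 a x : 0 < pc a x.
Proof. exact: lt_le_trans (pc_ge a x). Qed.

Lemma bmeas_mc a : bmeas (mc a).
Proof. exact: bmeas_clamp. Qed.

Lemma bmeas_pcV a : bmeas (fun x => (pc a x)^-1).
Proof.
split; last first.
  exists delta^-1 => x; rewrite ger0_norm ?invr_ge0 ?(ltW (pc_gt0 a x))//.
  by rewrite lef_pV2 ?posrE ?pc_gt0 ?pc_ge.
rewrite (_ : (fun _ => _) = (fun x => expR (- ln (pc a x)))); last first.
  by apply/funext => x; rewrite expRN lnK ?posrE ?pc_gt0.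
apply: measurableT_comp => //; apply: measurableT_comp => //.
by apply: measurableT_comp => //; exact: measurable_maxr.
Qed.

Lemma mean_regression a (D : set X) (h : X -> R) : measurable D -> bmeas h ->
  (forall x, D x -> m a x = h x) ->
  mean P (fun o => \1_[set o | D o.1.1 /\ o.1.2 = a] o * (clamp o.2 - h o.1.1)) = 0.
Proof.
move=> mD bh mh; set E := [set o : obs X R | _].
have mE : measurable E.
  apply: measurableI.
    by rewrite -[X in measurable X]setTI; exact: mobs_x.
  by have := mobs_a measurableT (I : measurable [set a]); rewrite setTI.
have bE : bmeas (\1_E : obs X R -> R) by exact: bmeas_indic.
have by_ : bmeas (fun o : obs X R => clamp o.2) by exact: bmeas_clamp.
have bhx : bmeas (fun o : obs X R => h o.1.1) by exact: (bmeas_comp bh).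
transitivity (mean P (fun o => \1_E o * clamp o.2 - \1_E o * h o.1.1)).
  by apply: eq_mean => o; rewrite mulrBr.
rewrite meanB; [|exact: bmeasM|exact: bmeasM]; apply/eqP; rewrite subr_eq0; apply/eqP.
have toint (f : obs X R -> R) : (\int[P]_o (\1_E o * f o)%:E = \int[P]_(o in E) (f o)%:E)%E.
  rewrite [RHS]integral_mkcond; apply: eq_integral => o _.
  by rewrite restrict_EFin patch_indic /= mulrC.
rewrite /mean /Rintegral !toint; congr fine.
have [_ _ /(_ a D mD)] := hm; rewrite -/E => intE.
transitivity (\int[P]_(o in E) o.2%:E)%E.
  apply: ae_eq_integral => //.
  - by apply: (measurable_funS measurableT) => //; apply/measurable_EFinP; case: by_.
  - by apply: (measurable_funS measurableT) => //; apply/measurable_EFinP.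
  - by apply: filterS hY => o /= y01 _; rewrite clampK.
by rewrite intE; apply: eq_integral => o /set_mem[Do _]; rewrite mh.
Qed.

Lemma propensity_ge : {ae PP, forall v, forall a, delta <= p a v.1.1}.
Proof.
have mD : measurable [set x | (delta <= p true x) && (p true x <= 1 - delta)].
  have mc0 (r : R) : measurable_fun setT (fun _ : X => r) by [].
  have := measurable_and (measurable_fun_ler (mc0 delta) (mp true))
    (measurable_fun_ler (mp true) (mc0 (1 - delta))).
  by move=> /(_ measurableT [set true] I); rewrite setTI.
have := ae_obs_x mD hoverlap; apply: filterS => v /= /andP[p1 p2] [] //.
by have := p_sum v.1.1; lra.
Qed.

Let bp a : bmeas (p a). Proof. exact: (bmeas_g p_ge0 p_sum mp a). Qed.

Let bmeas_x (F : X -> R) : bmeas F -> bmeas (fun v : fulldata X R => F v.1.1).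
Proof. by move=> bF; apply: (bmeas_comp bF); exact: measurable_xval. Qed.

Let mean_event a (D : set X) (F : obs X R -> R) : measurable D -> bmeas F ->
  mean P (fun o => \1_[set o | D o.1.1 /\ o.1.2 = a] o * F o) =
  mean PP (fun v => p a v.1.1 * \1_D v.1.1 * F (observe v a)).
Proof.
move=> mD bF; have mE : measurable [set o : obs X R | D o.1.1 /\ o.1.2 = a].
  apply: measurableI; first exact: mset_obs_x.
  by have := mobs_a measurableT (I : measurable [set a]); rewrite setTI.
rewrite mean_obs; last by apply: bmeasM => //; exact: bmeas_indic.
apply: eq_mean => v; rewrite (bigD1 a)//= big1 ?addr0 => [|a' a'a].
  rewrite -!mulrA; congr (_ * (_ * _)); rewrite !indicE.
  by congr ((nat_of_bool _)%:R); apply/idP/idP => /set_mem => [[? _]|?]; apply/mem_set.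
rewrite [\1__ _]indicE memNset ?mul0r ?mulr0//= => -[_ ea].
by rewrite ea eqxx in a'a.
Qed.

(** The outcome lies in [0, 1] almost surely, so where the regression leaves this range by [e], the
    regression identity gives probability zero to treatment [a] jointly with [D]; the lower bound on
    the propensity then makes [D] itself null. *)
Lemma out_of_range a (D : set X) (h : X -> R) (e : R) : measurable D -> bmeas h ->
  (forall x, D x -> m a x = h x) -> 0 < e ->
  (forall x, D x -> 1 + e <= h x) \/ (forall x, D x -> h x <= - e) ->
  PP.-negligible [set v | D v.1.1].
Proof.
move=> mD bh mh e0 hD; have := mean_regression mD bh mh; set E := [set o | _] => meanE.
have mE : measurable E.
  apply: measurableI; first exact: mset_obs_x.
  by have := mobs_a measurableT (I : measurable [set a]); rewrite setTI.
have bE : bmeas (\1_E : obs X R -> R) by exact: bmeas_indic.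
have bF : bmeas (fun o : obs X R => clamp o.2 - h o.1.1).
  by apply: bmeasB; [exact: bmeas_clamp|exact: (bmeas_comp bh)].
have E0 : mean P (\1_E : obs X R -> R) <= 0.
  rewrite -(ler_pM2l e0) mulr0 -meanZ//.
  (* The sign [sg] makes the integrand of the regression identity at least [e] on [E]. *)
  have [sg sgP] : exists sg : R, forall o, e * \1_E o <= sg * (\1_E o * (clamp o.2 - h o.1.1)).
    case: hD => hD; [exists (-1)|exists 1] => o; rewrite indicE;
      case: (boolP (o \in E)) => [/set_mem[/hD ho _]|_]; rewrite /= ?mul0r ?mulr0// ?mulr1 ?mul1r;
      have /andP[c0 c1] := clamp01 o.2.
      by rewrite mulN1r opprB lerBrDr (le_trans _ ho)// addrC lerD2r.
    by rewrite lerBrDr (le_trans _ c0)// addrC -lerBrDr sub0r.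
  apply: le_trans (le_mean P _ _ sgP) _; [exact: bmeasZ|by apply: bmeasZ; exact: bmeasM|].
  by rewrite meanZ ?meanE ?mulr0//; exact: bmeasM.
apply/negligibleP; first exact: mset_x.
have bD : bmeas (\1_D : X -> R) by exact: bmeas_indic.
have : mean PP (fun v => p a v.1.1 * \1_D v.1.1) <= 0.
  apply: le_trans E0; rewrite le_eqVlt; apply/orP; left; apply/eqP.
  transitivity (mean P (fun o => \1_E o * 1)); last by apply: eq_mean => o; rewrite mulr1.
  rewrite mean_event//; last exact: bmeas_cst.
  by apply: eq_mean => v; rewrite mulr1.
rewrite (ae_eq_mean (g := fun v => pc a v.1.1 * \1_D v.1.1)); first last.
- by apply: filterS propensity_ge => v /= /(_ a) pd; rewrite /pc max_l.
- apply: measurable_funM; last by case: (bmeas_x bD).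
  by apply: measurableT_comp; [exact: measurable_maxr|exact: measurable_xval].
- by apply: measurable_funM; [case: (bmeas_x (bp a))|case: (bmeas_x bD)].
have bpc : bmeas (pc a) by apply: bmeas_max => //; exact: bmeas_cst.
move=> le0; have : delta * mean PP (fun v => \1_D v.1.1 : R) <= 0.
  apply: le_trans le0; rewrite -meanZ; last exact: bmeas_x.
  apply: le_mean => [||v]; first by apply: bmeasZ; exact: bmeas_x.
    by apply: bmeasM; exact: bmeas_x.
  by rewrite ler_wpM2r ?pc_ge// indicE.
rewrite pmulr_rle0// (eq_mean _ (g := \1_[set v | D v.1.1])); last first.
  by move=> v; rewrite !indicE; congr ((nat_of_bool _)%:R);
    apply/idP/idP => /set_mem /mem_set.
rewrite mean_indic; last exact: mset_x.
move=> le0'; have : fine (PP [set v | D v.1.1]) = 0.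
  by apply/eqP; rewrite eq_le le0'/= fine_ge0.
by move=> f0; rewrite -[LHS]fineK ?f0// fin_num_measure//; exact: mset_x.
Qed.

Lemma regression_range : {ae PP, forall v, forall a, 0 <= m a v.1.1 <= 1}.
Proof.
have range1 a : {ae PP, forall v, 0 <= m a v.1.1 <= 1}.
  (* Pieces on which [m a] is bounded as well as out of range: there it coincides with the bounded
     [tr k], and together they exhaust the exceptional set. *)
  pose hi k x := (1 + k.+1%:R^-1 <= m a x) && (m a x <= k.+1%:R) : bool.
  pose lo k x := (- k.+1%:R <= m a x) && (m a x <= - k.+1%:R^-1) : bool.
  have mitv (l r : R) : measurable [set x | (l <= m a x) && (m a x <= r)].
    have mc0 (z : R) : measurable_fun setT (fun _ : X => z) by [].
    have := measurable_and (measurable_fun_ler (mc0 l) (mm a))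
      (measurable_fun_ler (mm a) (mc0 r)).
    by move=> /(_ measurableT [set true] I); rewrite setTI.
  pose tr k x := Num.max (- k.+1%:R) (Num.min (m a x) k.+1%:R) : R.
  have btr k : bmeas (tr k).
    split; first by apply: measurable_maxr => //; exact: measurable_minr.
    exists k.+1%:R => x; rewrite ler_norml /tr le_max lexx /= ge_max ge_min lexx orbT andbT.
    by rewrite (le_trans (_ : _ <= 0))// oppr_le0.
  have V0 k : 0 < k.+1%:R^-1 :> R by rewrite invr_gt0.
  have V1 k : k.+1%:R^-1 <= 1 :> R by rewrite invf_le1// ler1n.
  have neg_hi k : PP.-negligible [set v | hi k v.1.1].
    apply: (@out_of_range a [set x | hi k x] (tr k) k.+1%:R^-1) => //.
    - exact: mitv.
    - move=> x /andP[h1 h2]; rewrite /tr min_l// max_r//.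
      by apply: le_trans h1; apply: (@le_trans _ _ 0); rewrite ?oppr_le0 ?addr_ge0// ltW.
    - left=> x /andP[h1 h2]; rewrite /tr min_l// le_max h1 orbT//.
  have neg_lo k : PP.-negligible [set v | lo k v.1.1].
    apply: (@out_of_range a [set x | lo k x] (tr k) k.+1%:R^-1) => //.
    - exact: mitv.
    - move=> x /andP[h1 h2]; rewrite /tr min_l ?max_r//.
      by apply: le_trans h2 _; apply: (@le_trans _ _ 0); rewrite ?oppr_le0// ltW.
    - right=> x /andP[h1 h2]; rewrite /tr ge_max ge_min h2 /= andbT.
      by rewrite lerN2; apply: (le_trans (V1 k)); rewrite ler1n.
  apply: (negligibleS _ (negligible_bigcup (F := fun k =>
    [set v | hi k v.1.1] `|` [set v | lo k v.1.1]) _)); last first.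
    by move=> k; exact: negligibleU.
  move=> v /= /negP; rewrite negb_and -!ltNge => /orP[m0|m1].
    have [k1 hk1] : exists k, (- m a v.1.1)^-1 + - m a v.1.1 <= k.+1%:R.
      by eexists; apply: ltW; exact: truncnS_gt.
    exists k1 => //; right; rewrite /lo /=.
    have i0 : 0 < (- m a v.1.1)^-1 by rewrite invr_gt0 oppr_gt0.
    apply/andP; split; first by lra.
    rewrite lerNr -[leRHS]invrK lef_pV2 ?posrE//; lra.
  have [k1 hk1] : exists k, (m a v.1.1 - 1)^-1 + m a v.1.1 <= k.+1%:R.
    by eexists; apply: ltW; exact: truncnS_gt.
  exists k1 => //; left; rewrite /hi /=.
  have i0 : 0 < (m a v.1.1 - 1)^-1 by rewrite invr_gt0 subr_gt0.
  apply/andP; split; last by lra.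
  rewrite -lerBrDl -[leRHS]invrK lef_pV2 ?posrE//; lra.
by apply: filterS2 (range1 true) (range1 false) => v h1 h2 [].
Qed.

Definition sound (v : fulldata X R) : Prop := forall a,
  [/\ 0 <= potential v a <= 1, delta <= p a v.1.1 & 0 <= m a v.1.1 <= 1].

Lemma ae_sound : {ae PP, forall v, sound v}.
Proof.
apply: filterS3 hZ propensity_ge regression_range => v h1 h2 h3 a.
by split; [exact: h1|exact: h2|exact: h3].
Qed.

Lemma sound_pc a v : sound v -> pc a v.1.1 = p a v.1.1.
Proof. by move=> /(_ a)[_ + _]; rewrite /pc => pd; rewrite max_l. Qed.

Lemma sound_mc a v : sound v -> mc a v.1.1 = m a v.1.1.
Proof. by move=> /(_ a)[_ _ ?]; rewrite /mc clampK. Qed.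

Lemma mean_orth_x (Y : fulldata X R -> R) (W : X -> R) : bmeas Y -> bmeas W ->
  (forall D, measurable D -> mean PP (fun v => Y v * \1_D v.1.1) = 0) ->
  mean PP (fun v => Y v * W v.1.1) = 0.
Proof.
move=> bY [mW [K WK]] YD.
pose xv : fulldata X R -> X := fun v => v.1.1.
pose H : set (set (fulldata X R)) := [set E | exists D, measurable D /\ E = xv @^-1` D].
have indE D v : \1_(xv @^-1` D) v = \1_D v.1.1 :> R.
  by rewrite !indicE; congr ((nat_of_bool _)%:R); apply/idP/idP => /set_mem /mem_set.
apply: (orth_bounded (H := H) bY (W := fun v => W v.1.1) (K := K)) => //.
- apply: orth_sigma => //.
  + move=> _ _ [D [mD ->]] [D' [mD' ->]]; exists (D `&` D').
    by split=> //; exact: measurableI.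
  + by move=> _ [D [mD ->]]; exact: mset_x.
  + have := YD setT measurableT; congr (_ = _); apply: eq_mean => v.
    by rewrite indicT mulr1.
  + move=> _ [D [mD ->]]; rewrite -[RHS](YD D mD); apply: eq_mean => v.
    by rewrite indE.
- apply: (measurableT_comp mW) => _ D mD; rewrite setTI.
  by apply: sub_gen_smallest; exists D.
Qed.

Definition residual (a : bool) (v : fulldata X R) : R := clamp (potential v a) - mc a v.1.1.

Lemma bmeas_residual a : bmeas (residual a).
Proof.
apply: bmeasB; last exact: bmeas_x (bmeas_mc a).
exact: bmeas_clamp (measurable_potential a).
Qed.

(** Under [PP] the potential outcome at [a] has regression [m a] on the covariates. On the event
    that the treatment is [a] this is the defining property of [m]; written under [PP], it carries
    the extra weight [p a], which is bounded below and is divided out. *)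
Lemma mean_residual a (W : X -> R) : bmeas W ->
  mean PP (fun v => residual a v * W v.1.1) = 0.
Proof.
move=> bW; have bpc : bmeas (pc a) by apply: bmeas_max => //; exact: bmeas_cst.
have bY : bmeas (fun v => residual a v * pc a v.1.1).
  by apply: bmeasM; [exact: bmeas_residual|exact: bmeas_x].
rewrite -(@mean_orth_x (fun v => residual a v * pc a v.1.1)
  (fun x => (pc a x)^-1 * W x)) //; first last.
- move=> D mD; pose D' := D `&` [set x | 0 <= m a x <= 1].
  have mD' : measurable D'.
    apply: measurableI => //; have mc0 (z : R) : measurable_fun setT (fun _ : X => z) by [].
    have := measurable_and (measurable_fun_ler (mc0 0) (mm a))
      (measurable_fun_ler (mm a) (mc0 1)).
    by move=> /(_ measurableT [set true] I); rewrite setTI.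
  have bF : bmeas (fun o : obs X R => clamp o.2 - mc a o.1.1).
    by apply: bmeasB; [exact: bmeas_clamp|exact: (bmeas_comp (bmeas_mc a))].
  rewrite -[RHS](mean_regression mD' (bmeas_mc a) (a := a)); last first.
    by move=> x [_ m01]; rewrite /mc clampK.
  rewrite mean_event//; apply: ae_eq_mean.
  + by case: (bmeasM bY (bmeas_x (bmeas_indic mD))).
  + apply: (proj1 (_ : bmeas _)); apply: bmeasM; last exact: bmeas_residual.
    by apply: bmeasM; [exact: bmeas_x|exact: bmeas_x (bmeas_indic mD')].
  apply: filterS ae_sound => v sv; rewrite (sound_pc a sv) mulrAC mulrC.
  rewrite -[RHS]mulrA; congr (_ * _); rewrite [RHS]mulrC; congr (_ * _).
  have [_ _ m01] := sv a.
  by rewrite !indicE; congr ((nat_of_bool _)%:R); apply/idP/idP => /set_mem Dv;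
    apply/mem_set; [split|case: Dv].
- by apply: bmeasM => //; exact: bmeas_pcV.
by apply: eq_mean => v; rewrite mulrA mulfK ?gt_eqF ?pc_gt0.
Qed.

(** Since [1{a = pi x} = (1 + trt a trt (pi x)) / 2], this is the coefficient of [trt (pi x)] in the
    weighted residual of [f_pol], after truncation. *)
Definition half_residual (a : bool) (v : fulldata X R) : R :=
  trt a * residual a v / (2 * pc a v.1.1).

Lemma bmeas_half_residual a : bmeas (half_residual a).
Proof.
rewrite (_ : half_residual a = fun v => trt a / 2 * (residual a v * (pc a v.1.1)^-1)).
  by apply: bmeasZ; apply: bmeasM; [exact: bmeas_residual|exact: bmeas_x (bmeas_pcV a)].
by apply/funext => v; rewrite /half_residual invfM; ring.
Qed.

Lemma half_residual_le a v : `|half_residual a v| <= delta^-1.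
Proof.
have pV : 0 <= (pc a v.1.1)^-1 <= delta^-1.
  by rewrite invr_ge0 (ltW (pc_gt0 _ _)) lef_pV2 ?posrE ?pc_gt0 ?pc_ge.
have r1 : `|residual a v| <= 1.
  have /andP[c0 c1] := clamp01 (potential v a); have /andP[m0 m1] := clamp01 (m a v.1.1).
  by rewrite /residual /mc ler_norml; apply/andP; split; lra.
have t1 : `|trt a| = 1 :> R by rewrite /trt; case: (a); rewrite ?normrN normr1.
rewrite /half_residual invfM !normrM t1 mul1r.
case/andP: pV => p0 p1; rewrite (ger0_norm p0) [`|2^-1|]ger0_norm ?invr_ge0//.
apply: le_trans p1; rewrite mulrA ler_piMl//.
by have := normr_ge0 (residual a v); lra.
Qed.

Lemma mean_half_residual a (W : X -> R) : bmeas W ->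
  mean PP (fun v => half_residual a v * W v.1.1) = 0.
Proof.
move=> bW; rewrite -(@mean_residual a (fun x => trt a / 2 * ((pc a x)^-1 * W x))).
  by apply: eq_mean => v; rewrite /half_residual invfM; ring.
by apply: bmeasZ; apply: bmeasM => //; exact: bmeas_pcV.
Qed.

Definition half_effect (x : X) : R := (mc true x - mc false x) / 2.

Lemma bmeas_half_effect : bmeas half_effect.
Proof.
rewrite (_ : half_effect = fun x => 2^-1 * (mc true x - mc false x)).
  by apply: bmeasZ; apply: bmeasB; exact: bmeas_mc.
by apply/funext => x; rewrite mulrC.
Qed.

Lemma half_effect_le x : `|half_effect x| <= 1.
Proof.
have /andP[c0 c1] := clamp01 (m true x); have /andP[m0 m1] := clamp01 (m false x).
by rewrite /half_effect /mc ler_norml; apply/andP; split; lra.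
Qed.

Lemma mcE b x : mc b x = (mc true x + mc false x) / 2 + trt b * half_effect x.
Proof. by rewrite /half_effect /trt; case: b; field. Qed.

Section Policy.
Variable pi : X -> bool.
Hypothesis mpi : measurable_fun setT pi.

Let bmeas_trt_pi : bmeas (fun x => trt (pi x) : R).
Proof.
split; first exact: measurable_fun_ifT.
by exists 1 => x; rewrite /trt; case: (pi x); rewrite ?normrN normr1.
Qed.

Let bmeas_mc_pi : bmeas (fun x => mc (pi x) x).
Proof.
rewrite (_ : (fun _ => _) =
    fun x => 2^-1 * (mc true x + mc false x) + trt (pi x) * half_effect x); last first.
  by apply/funext => x; rewrite mcE [_ / 2]mulrC.
apply: bmeasD; first by apply: bmeasZ; apply: bmeasD; exact: bmeas_mc.
by apply: bmeasM => //; exact: bmeas_half_effect.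
Qed.

Lemma value_mean : value P m pi = mean PP (fun v => mc (pi v.1.1) v.1.1).
Proof.
rewrite /value expectation.unlock -(mean_obs_x bmeas_mc_pi).
have mm_pi : measurable_fun setT (fun x => m (pi x) x).
  rewrite (_ : (fun _ => _) = fun x => if pi x then m true x else m false x).
    exact: measurable_fun_ifT.
  by apply/funext => x; case: (pi x).
apply: (@ae_eq_mean _ _ _ P) => [||].
- exact: (measurableT_comp mm_pi mobs_x).
- by case: (bmeas_comp bmeas_mc_pi mobs_x).
have mD : measurable [set x | (0 <= m (pi x) x) && (m (pi x) x <= 1)].
  have mc0 (z : R) : measurable_fun setT (fun _ : X => z) by [].
  have := measurable_and (measurable_fun_ler (mc0 0) mm_pi)
    (measurable_fun_ler mm_pi (mc0 1)).
  by move=> /(_ measurableT [set true] I); rewrite setTI.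
have : {ae P, forall o, 0 <= m (pi o.1.1) o.1.1 <= 1}.
  apply/negligibleP; first exact: measurableC (mset_obs_x mD).
  have := law_obs_x (measurableC mD); rewrite /= => ->.
  apply/negligibleP; first exact: mset_x (measurableC mD).
  by apply: filterS regression_range => v /(_ (pi v.1.1)).
by apply: filterS => o m01; rewrite /mc clampK.
Qed.

Let f_clamped (o : obs X R) : R :=
  let r b := (b == pi o.1.1)%:R * (pc b o.1.1)^-1 * (clamp o.2 - mc b o.1.1) in
  (if o.1.2 then r true else r false) + mc (pi o.1.1) o.1.1 - value P m pi.

Let bmeas_if (h : obs X R -> bool) (f g : obs X R -> R) : measurable_fun setT h ->
  bmeas f -> bmeas g -> bmeas (fun o => if h o then f o else g o).
Proof.
move=> mh bf bg; rewrite (_ : (fun _ => _) =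
    fun o => (h o)%:R * f o + (1 - (h o)%:R) * g o); last first.
  by apply/funext => o; case: (h o); rewrite /= ?mul1r ?mul0r ?subrr ?subr0 ?mul0r ?mul1r ?addr0 ?add0r.
have bh : bmeas (fun o => (h o)%:R : R) by exact: bmeas_natr.
apply: bmeasD; apply: bmeasM => //; apply: bmeasB => //; exact: bmeas_cst.
Qed.

Let meq_pi b : measurable_fun setT (fun o : obs X R => b == pi o.1.1).
Proof.
have mpo : measurable_fun setT (fun o : obs X R => pi o.1.1) by exact: (measurableT_comp mpi mobs_x).
case: b; first by rewrite (_ : (fun _ => _) = fun o : obs X R => pi o.1.1)//;
  apply/funext => o; case: (pi _).
rewrite (_ : (fun _ => _) = fun o : obs X R => ~~ pi o.1.1).
  exact: measurable_neg.
by apply/funext => o; case: (pi _).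
Qed.

Let bmeas_f_clamped : bmeas f_clamped.
Proof.
apply: bmeasB; last exact: bmeas_cst.
apply: bmeasD; last exact: (bmeas_comp bmeas_mc_pi).
have br b : bmeas (fun o : obs X R =>
    (b == pi o.1.1)%:R * (pc b o.1.1)^-1 * (clamp o.2 - mc b o.1.1)).
  apply: bmeasM; first apply: bmeasM.
  - exact: bmeas_natr.
  - exact: (bmeas_comp (bmeas_pcV b)).
  - by apply: bmeasB; [exact: bmeas_clamp|exact: (bmeas_comp (bmeas_mc b))].
exact: bmeas_if.
Qed.

Lemma measurable_f_pol : measurable_fun setT (f_pol P p m pi).
Proof.
(* The inverse of [p] is expressed by exponential and logarithm, which are measurable; its value at
   0 is 0. *)
pose r b (o : obs X R) := (b == pi o.1.1)%:R *
   (if p b o.1.1 == 0 then 0 else expR (- ln (p b o.1.1))) * (o.2 - m b o.1.1) : R.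
rewrite (_ : f_pol P p m pi = fun o => (if o.1.2 then r true o else r false o) +
    (if pi o.1.1 then m true o.1.1 else m false o.1.1) - value P m pi); last first.
  apply/funext => -[[x a] y] /=; congr (_ + _ - _); last by case: (pi x).
  have pE b : (if p b x == 0 then 0 else expR (- ln (p b x))) = (p b x)^-1.
    case: eqVneq => [->|pn0]; first by rewrite invr0.
    by rewrite expRN lnK// posrE lt_neqAle eq_sym pn0 p_ge0.
  by rewrite /r /= !pE; case: (a).
have mr b : measurable_fun setT (r b).
  apply: measurable_funM; first apply: measurable_funM.
  - by case: (bmeas_natr R (meq_pi b)).
  - have mpb : measurable_fun setT (fun o : obs X R => p b o.1.1).
      exact: (measurableT_comp (mp b) mobs_x).
    apply: measurable_fun_ifT => //; first exact: measurable_fun_eqr.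
    by do 2 apply: measurableT_comp => //; exact: measurableT_comp.
  - by apply: measurable_funB => //; exact: (measurableT_comp (mm b) mobs_x).
apply: measurable_funB => //; apply: measurable_funD.
  exact: measurable_fun_ifT.
apply: measurable_fun_ifT; first exact: (measurableT_comp mpi mobs_x).
  exact: (measurableT_comp (mm true) mobs_x).
exact: (measurableT_comp (mm false) mobs_x).
Qed.

Let f_clampedE v a : sound v -> f_pol P p m pi (observe v a) = f_clamped (observe v a).
Proof.
move=> sv; rewrite /f_clamped /= -(sound_pc a sv) -!(sound_mc _ sv).
rewrite clampK; first by case: (a).
by have [] := sv a.
Qed.

(** Holds whatever the sampling rule [g]: given the covariates the residual of each treatment is
    centered, and the remaining term is the regression at [pi] minus its mean, the value. The
    compensators in [Gtilde] therefore vanish on the class. *)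
Lemma mean_f_pol (g : bool -> X -> R) : (forall a x, 0 <= g a x) ->
  (forall x, g true x + g false x = 1) -> (forall a, measurable_fun setT (g a)) ->
  fine (\int[sampling_law PP g]_ow (f_pol P p m pi ow.1)%:E)%E = 0.
Proof.
move=> g0 g1 mg; pose S := sampling_prob PP g0 g1 mg.
have mf1 : measurable_fun setT (fun ow : obs X R * R => f_pol P p m pi ow.1).
  exact: (measurableT_comp measurable_f_pol).
have bc1 : bmeas (fun ow : obs X R * R => f_clamped ow.1) by exact: (bmeas_comp bmeas_f_clamped).
change (mean S (fun ow => f_pol P p m pi ow.1) = 0).
rewrite (ae_eq_mean (g := fun ow => f_clamped ow.1)) //; first last.
- pose C := [set ow : obs X R * R | (f_pol P p m pi ow.1 == f_clamped ow.1) = false].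
  have mC : measurable C.
    have := measurable_fun_eqr mf1 bc1.1.
    by move=> /(_ measurableT [set false] I); rewrite setTI.
  apply: (negligibleS (A := C)).
    by move=> ow /eqP/negbTE.
  apply/negligibleP => //; rewrite [LHS](sampling_law_mean PP g0 g1 mg mC) -[0%E]/(0%:E).
  congr EFin; rewrite -[RHS](mean_cst PP 0); apply: ae_eq_mean => //.
    apply: (proj1 (_ : bmeas _)); apply: bmeas_sum => a _; apply: bmeasM.
      exact: bmeas_x (bmeas_g g0 g1 mg a).
    apply: (bmeas_comp (bmeas_indic mC)); exact: measurable_sample_point.
  apply: filterS ae_sound => v sv; apply: big1 => a _.
  by rewrite indicE memNset ?mulr0// => /negP; apply; apply/eqP; exact: f_clampedE.
- by case: bc1.
rewrite mean_sampling_prob//.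
(* The square of [trt a] is 1, so this weight turns [half_residual] back into the full weighted
   residual. *)
pose w a x : R := 2 * trt a * (g a x * (a == pi x)%:R).
have bw a : bmeas (w a).
  apply: bmeasZ; apply: bmeasM; first exact: (bmeas_g g0 g1 mg).
  apply: bmeas_natr; case: (a); last exact: measurable_neg.
  by rewrite (_ : (fun _ => _) = pi)//; apply/funext => x; case: (pi x).
have bhw a : bmeas (fun v => half_residual a v * w a v.1.1).
  by apply: bmeasM; [exact: bmeas_half_residual|exact: bmeas_x].
transitivity (mean PP (fun v => (\sum_a half_residual a v * w a v.1.1) +
    (mc (pi v.1.1) v.1.1 - value P m pi))).
  apply: eq_mean => v; rewrite !big_bool /f_clamped /= /w /half_residual /residual.
  rewrite (_ : g false v.1.1 = 1 - g true v.1.1); last by rewrite -(g1 v.1.1) addrC addKr.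
  rewrite !invfM /trt; set x := v.1.1; set iT := (pc true x)^-1; set iF := (pc false x)^-1.
  by field.
rewrite meanD; [|by apply: bmeas_sum|]; last first.
  by apply: bmeasB; [exact: bmeas_x bmeas_mc_pi|exact: bmeas_cst].
rewrite mean_sum// big1 ?add0r => [|a _]; last exact: mean_half_residual.
rewrite meanB ?mean_cst ?value_mean ?subrr//; first exact: bmeas_x bmeas_mc_pi.
exact: bmeas_cst.
Qed.

End Policy.

Lemma value_diff pi pi' : measurable_fun setT pi -> measurable_fun setT pi' ->
  value P m pi - value P m pi' =
  mean PP (fun v => (trt (pi v.1.1) - trt (pi' v.1.1)) * half_effect v.1.1).
Proof.
have bm (q : X -> bool) : measurable_fun setT q -> bmeas (fun v : fulldata X R => mc (q v.1.1) v.1.1).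
  move=> mq; apply: (bmeas_x (F := fun x => mc (q x) x)).
  rewrite (_ : (fun _ => _) = fun x => mc false x + (q x)%:R * (mc true x - mc false x)).
    apply: bmeasD; first exact: bmeas_mc.
    by apply: bmeasM; [exact: bmeas_natr|apply: bmeasB; exact: bmeas_mc].
  by apply/funext => x; case: (q x); rewrite /= ?mul1r ?mul0r ?addr0// addrC subrK.
move=> mpi mpi'; rewrite !value_mean// -meanB; [|exact: bm..].
by apply: eq_mean => v; rewrite [mc (pi _) _]mcE [mc (pi' _) _]mcE mulrBl; ring.
Qed.

Lemma f_pol_diff pi pi' v a : measurable_fun setT pi -> measurable_fun setT pi' -> sound v ->
  f_pol P p m pi (observe v a) - f_pol P p m pi' (observe v a) =
  (trt (pi v.1.1) - trt (pi' v.1.1)) * half_residual a v +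
  ((trt (pi v.1.1) - trt (pi' v.1.1)) * half_effect v.1.1 -
   mean PP (fun v => (trt (pi v.1.1) - trt (pi' v.1.1)) * half_effect v.1.1)).
Proof.
move=> mpi mpi' sv; rewrite -value_diff//= -!(sound_mc _ sv) -(sound_pc a sv).
rewrite (_ : potential v a = clamp (potential v a)); last first.
  by rewrite clampK//; have [] := sv a.
rewrite [mc (pi _) _]mcE [mc (pi' _) _]mcE /half_residual /residual invfM.
set i := (pc a _)^-1; set e := half_effect _; set y := clamp _.
by rewrite /trt; case: (a); case: (pi _); case: (pi' _); rewrite /=; field.
Qed.

End Regression.

(** [G n] is monotone with values [t n] and [1 - t n] beyond [- xi n] and [xi n], which are reached
    from [u] through a minimum or a maximum; [t n] is at least its positive limit. *)
Lemma tuning_range (R : realType) (t xi kappa : nat -> R) (G : nat -> R -> R) n u :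
  tuning t xi kappa G -> 0 <= G n u <= 1.
Proof.
move=> tun; have [l l0 tl] := tuning_t_lim tun.
have tn : 0 <= t n.
  apply/ltW/(lt_le_trans l0); rewrite -(cvg_lim _ tl)//.
  by apply: nonincreasing_cvgn_ge; [exact: tuning_t_noninc tun|apply/cvg_ex; exists l].
apply/andP; split.
  apply: (le_trans tn); rewrite -(@tuning_low _ _ _ _ _ tun n (Num.min u (- xi n))).
    by apply: (tuning_nondec tun); rewrite ge_min lexx.
  by rewrite ge_min lexx orbT.
apply: le_trans (_ : 1 - t n <= _); last by rewrite gerBl.
rewrite -(@tuning_high _ _ _ _ _ tun n (Num.max u (xi n))).
  by apply: (tuning_nondec tun); rewrite le_max lexx.
by rewrite le_max lexx orbT.
Qed.

(** * The increments of the process *)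

Section DesignProcess.
Context (R : realType) (dX dO : measure_display) (X : measurableType dX)
  (Omega : measurableType dO).
Variables (P : probability (obs X R) R) (p m : bool -> X -> R) (delta : R).
Hypotheses (hp : is_propensity P p) (hm : is_regression P m).
Hypothesis hdelta : 0 < delta < 2^-1.
Hypothesis hoverlap : {ae P, forall o, delta <= p true o.1.1 <= 1 - delta}.
Hypothesis hY : {ae P, forall o, 0 <= o.2 <= 1}.
Variable PP : probability (fulldata X R) R.
Hypothesis hZ : {ae PP, forall v, forall a, 0 <= potential v a <= 1}.
Hypothesis hconsistent : forall C : set (obs X R), measurable C ->
  P C = sampling_law PP p [set ow | C ow.1].
Variables (Pr : probability Omega R) (V : nat -> {RV Pr >-> fulldata X R})
  (A : nat -> {RV Pr >-> bool}).
Hypothesis hiid : iid_from PP V.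
Variables (t xi kappa : nat -> R) (G : nat -> R -> R).
Hypothesis htuning : tuning t xi kappa G.
Variables (I : Type) (Q : I -> bool -> X -> R) (B : nat -> set I).
Hypothesis hQmeas : forall n b, B n b -> forall a, measurable_fun setT (Q b a).
Variables (n0 : nat) (beta : forall n : nat, n.-tuple (obs X R) -> I).
Hypothesis hdesign : sequential_design V A p n0 G Q B beta.

Let p_ge0 a x : 0 <= p a x. Proof. by case: hp => _ + _ _; apply. Qed.
Let p_sum x : p true x + p false x = 1. Proof. by case: hp. Qed.
Let mp a : measurable_fun setT (p a). Proof. by case: hp. Qed.
Let g l w := g_ V A p n0 G Q beta l w.

Let mG l : measurable_fun setT (G l).
Proof. by apply: nondecreasing_measurable => //; exact: (tuning_nondec htuning). Qed.

Let g_ge0 l w a x : 0 <= g l w a x.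
Proof.
rewrite /g /g_; case: ifP => _; first exact: p_ge0.
by case: a; [|rewrite subr_ge0];
  have /andP[] := tuning_range l (Q (beta (data V A l w)) true x - Q (beta (data V A l w)) false x) htuning.
Qed.

Let g_sum l w x : g l w true x + g l w false x = 1.
Proof. by rewrite /g /g_; case: ifP => _; [exact: p_sum|rewrite addrC subrK]. Qed.

Let mg l w a : measurable_fun setT (g l w a).
Proof.
rewrite /g /g_; case: ltnP => [_|nl]; first exact: mp.
have [Bb _] := design_argmin hdesign w nl.
have mG1 : measurable_fun setT (fun x => G l (Q (beta (data V A l w)) true x -
    Q (beta (data V A l w)) false x)).
  by apply: measurableT_comp; [exact: mG|apply: measurable_funB; exact: (hQmeas Bb)].
by case: a => //; exact: measurable_funB.
Qed.

Let Vf (i : nat) : Omega -> fulldata X R := V i.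
Let Af (i : nat) : Omega -> bool := A i.
Let mV i : measurable_fun setT (Vf i). Proof. exact: measurable_funPT. Qed.
Let mA i : measurable_fun setT (Af i). Proof. exact: measurable_funPT. Qed.
Let xv : fulldata X R -> X := fun v => v.1.1.
Let mxv : measurable_fun setT xv. Proof. exact: measurable_xval. Qed.

Definition draw_prob (l : nat) (w : Omega) : R := g l w true (V l w).1.1.

Let draw_prob01 l w : 0 <= draw_prob l w <= 1.
Proof. by rewrite /draw_prob g_ge0/= -(g_sum l w (V l w).1.1) lerDl g_ge0. Qed.

(** The fit at time [l] uses observations of index below [l <= k], and the draw probability at time
    [l] adds only the covariate, so the outcomes at time [k] never enter. *)
Let mdraw_prob n k l : (l <= k)%N -> (k < n)%N ->
  measurable_fun setT (draw_prob l : g_sigma_algebraType (masked_gen Vf Af xv n k l) -> R).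
Proof.
move=> lk kn; have ln := leq_ltn_trans lk kn.
have mx : measurable_fun setT
    (fun w : g_sigma_algebraType (masked_gen Vf Af xv n k l) => (V l w).1.1).
  exact: (measurable_masked_X (V := Vf) (A := Af) mxv).
rewrite /draw_prob /g /g_; case: ltnP => [_|nl].
  exact: (measurableT_comp (mp true) mx).
have mdata : measurable_fun setT
    (data V A l : g_sigma_algebraType (masked_gen Vf Af xv n k l) -> _).
  apply/measurable_fun_tnthP => i.
  rewrite (_ : _ \o _ = fun w => if A i w then observe (V i w) true else observe (V i w) false).
    have mVi : measurable_fun setT (Vf i : g_sigma_algebraType (masked_gen Vf Af xv n k l) -> _).
      apply: (measurable_masked_V (V := Vf)); first exact: ltn_trans (ltn_ord i) ln.
      by rewrite neq_ltn (leq_trans (ltn_ord i) lk).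
    apply: measurable_fun_ifT; first exact: (measurable_masked_A (A := Af)).
      exact: (measurableT_comp (measurable_observe true) mVi).
    exact: (measurableT_comp (measurable_observe false) mVi).
  by apply/funext => w /=; rewrite tnth_mktuple /obs_at; case: (A i w).
have mQ a : measurable_fun setT
    (fun w : g_sigma_algebraType (masked_gen Vf Af xv n k l) =>
       Q (beta (data V A l w)) a (V l w).1.1).
  exact: (measurableT_comp (design_meas hdesign a nl) (measurable_fun_pair mdata mx)).
by apply: (measurableT_comp (mG l)); exact: measurable_funB.
Qed.

Let draw l E : <<s before_gen Vf Af l >> E ->
  mean Pr (fun w => (Af l w)%:R * \1_E w) = mean Pr (fun w => draw_prob l w * \1_E w).
Proof.
move=> bE; have mE : measurable E by exact: before_measurable bE.
have mAl : measurable (Af l @^-1` [set true]).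
  by rewrite -[X in measurable X]setTI; exact: mA.
have := design_draw hdesign bE => dr.
transitivity (fine (Pr (E `&` A l @^-1` [set true]))).
  rewrite -mean_indic; last exact: measurableI.
  apply: eq_mean => w; rewrite indicI /= mulrC; congr (_ * _).
  by rewrite indicE /Af; case: (boolP (A l w)) => [Aw|/negP Aw];
    [rewrite mem_set|rewrite memNset].
rewrite dr /mean /Rintegral; congr fine.
rewrite [LHS]integral_mkcond; apply: eq_integral => w _.
by rewrite restrict_EFin patch_indic /= mulrC.
Qed.

Let iidVf N (C : 'I_N -> set (fulldata X R)) : (forall i, measurable (C i)) ->
  Pr (\bigcap_(i in [set: 'I_N]) (Vf i @^-1` C i)) = (\prod_(i < N) PP (C i))%E.
Proof. exact: hiid. Qed.

Lemma ae_sound_sample : {ae Pr, forall w i, sound p m delta (V i w)}.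
Proof.
have [N [mN PN0 subN]] := ae_sound hp hm hdelta hoverlap hZ hY hconsistent.
apply: (negligibleS _ (negligible_bigcup (F := fun i => V i @^-1` N) _)).
  move=> w /= /existsNP[i ns]; exists i => //=; exact: subN.
move=> i; apply/negligibleP; first by rewrite -[X in measurable X]setTI; exact: (mV i).
by have := iid_marginal iidVf i mN; rewrite PN0.
Qed.

Let e_ := half_effect m.
Let h_ := half_residual p m delta.

(* The first sum is a martingale, the second one has i.i.d. terms. *)
Definition increment (n : nat) (w : Omega) (q q' : X -> bool) : R :=
  \sum_(i < n) (trt (q (V i w).1.1) - trt (q' (V i w).1.1)) * h_ (A i w) (V i w) +
  \sum_(i < n) ((trt (q (V i w).1.1) - trt (q' (V i w).1.1)) * e_ (V i w).1.1 -
     mean PP (fun v => (trt (q v.1.1) - trt (q' v.1.1)) * e_ v.1.1)).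

Lemma Gtilde_diff n w q q' : measurable_fun setT q -> measurable_fun setT q' ->
  (forall i, sound p m delta (V i w)) ->
  Gtilde PP V A p n0 G Q beta n w (fun ow => f_pol P p m q ow.1) -
  Gtilde PP V A p n0 G Q beta n w (fun ow => f_pol P p m q' ow.1) =
  (Num.sqrt n%:R)^-1 * increment n w q q'.
Proof.
move=> mq mq' sw; rewrite /Gtilde -mulrBr; congr (_ * _).
rewrite /increment -big_split -sumrB; apply: eq_bigr => i _ /=.
rewrite !(mean_f_pol hp hm hdelta hoverlap hZ hY hconsistent _ (g_ge0 i w) (g_sum i w) (mg i w))//.
rewrite !subr0 /obs_at.
exact: (f_pol_diff hp hm hdelta hoverlap hY hconsistent (A i w) mq mq' (sw i)).
Qed.

Section Family.
Variables (C : set (X -> bool)) (a W : nat -> R).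
Hypothesis a0 : forall k, 0 <= a k.
Hypothesis a_mono : forall k, a k <= a k.+1.
Hypothesis entC : dyadic_entropy C a.
Hypothesis sumW : forall k0 M,
  \sum_(k0 <= k < M) 2^-1 ^+ k * (1 + Num.sqrt (a k)) <= W k0.
Variables (J : finType) (s : J -> X -> bool).
Hypothesis ms : forall j, measurable_fun setT (s j).
Hypothesis Cs : forall j, C (s j).
Variable n : nat.
Hypothesis n_gt0 : (0 < n)%N.
Variables (S : pred (J * J)) (k0 : nat) (be : R).
Hypothesis SP : forall u, S u -> (0 < k0)%N ->
  mean_gap2 PP xv s u <= 2 * (2^-1 ^+ k0) ^+ 2.
Hypothesis far_mean : mean Pr (gap2_dev PP Vf xv s n) <= be * (2 * n%:R * (2^-1 ^+ k0) ^+ 2).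

Let delta_gt0 : 0 < delta. Proof. by case/andP: hdelta. Qed.

(** The noise of the martingale part is bounded by [delta^-1], hence has parameter [2 / delta], and
    [64 * 2 = 128]; the factor of the i.i.d. part is bounded by 1, which gives 256. *)
Lemma increment_max_le :
  mean Pr (fun w => \big[Num.max/0]_(u | S u) `|increment n w (s u.1) (s u.2)|) <=
  (128 * delta^-1 + 256) * (Num.sqrt n%:R * (W k0 + W 0 * be)).
Proof.
have dV0 : 0 < delta^-1 by rewrite invr_gt0.
pose M1 w := \big[Num.max/0]_(u | S u)
   `|\sum_(i < n) gap R s u (xv (Vf i w)) * noise Vf Af h_ i w| : R.
pose M2 w := \big[Num.max/0]_(u | S u) `|\sum_(i < n)
   (gap R s u (xv (Vf i w)) * e_ (xv (Vf i w)) - mean PP (fun v => gap R s u (xv v) * e_ (xv v)))| : R.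
have bh b : bmeas (h_ b) by exact: (bmeas_half_residual hp hm hdelta).
have bN i : bmeas (noise Vf Af h_ i).
  by apply: (bmeas_noise mV mA bh) => b v; exact: half_residual_le.
have be_ : bmeas (fun v => e_ (xv v)) by exact: (bmeas_comp (bmeas_half_effect hm)).
have M1le : mean Pr M1 <= 64 * (2 * delta^-1) * Num.sqrt n%:R * (W k0 + W 0 * be).
  apply: (noise_process_le mV mxv a0 a_mono entC sumW ms Cs n_gt0 SP far_mean) => //.
    by rewrite mulr_gt0.
  move=> ta c.
  apply: (noise_subgauss mV mA iidVf mxv (gt := draw_prob)) => //.
  - by move=> k l; exact: mdraw_prob.
  - by move=> l E _; exact: draw.
  - by move=> b v; exact: half_residual_le.
  - move=> b D mD.
    exact: (mean_half_residual hp hm hdelta hoverlap hZ hY hconsistent b (bmeas_indic mD)).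
  (* A cell constrains covariates only, and these are never masked. *)
  move=> k l kn; set E := [set w | _].
  change (measurable (E : set (g_sigma_algebraType (masked_gen Vf Af xv n k l)))).
  rewrite (_ : E = \bigcap_(ji in [set: J * 'I_n]) [set w | s ji.1 (xv (Vf ji.2 w)) = ta ji]).
    apply: fin_bigcap_measurable => // -[j i] _ /=.
    have msV : measurable_fun setT (fun w : g_sigma_algebraType (masked_gen Vf Af xv n k l) =>
        s j (xv (Vf i w))).
      apply: measurableT_comp; first exact: ms.
      exact: (measurable_masked_X (V := Vf) (A := Af) mxv).
    by have := msV measurableT [set ta (j, i)] Logic.I; rewrite setTI.
  apply/seteqP; split=> w /=; first by move=> /forallP tw ji _; exact/eqP.
  by move=> tw; apply/forallP => ji; apply/eqP; exact: tw.
have M2le : mean Pr M2 <= 256 * 1 * Num.sqrt n%:R * (W k0 + W 0 * be).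
  apply: (iid_process_le mV iidVf mxv a0 a_mono entC sumW ms Cs n_gt0 SP far_mean) => //.
  by move=> v; exact: half_effect_le.
have bg u i : bmeas (fun w => gap R s u (xv (Vf i w))).
  by have := bmeas_gapV R mV mxv ms u i; apply.
have beV i : bmeas (fun w => e_ (xv (Vf i w))) by exact: (bmeas_comp be_ (mV i)).
have bM1 : bmeas M1.
  apply: bmeas_bigmax => u _; apply: bmeas_norm; apply: bmeas_sum => i _.
  by apply: bmeasM => //; exact: bg.
have bM2 : bmeas M2.
  apply: bmeas_bigmax => u _; apply: bmeas_norm; apply: bmeas_sum => i _.
  apply: bmeasB; last exact: bmeas_cst.
  apply: bmeasM; first exact: bg.
  exact: beV.
apply: le_trans (_ : mean Pr (fun w => M1 w + M2 w) <= _).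
  apply: le_mean => [||w].
  - apply: bmeas_bigmax => u _; apply: bmeas_norm; apply: bmeasD.
      apply: bmeas_sum => i _; apply: bmeasM; last exact: bN.
      exact: bg.
    apply: bmeas_sum => i _; apply: bmeasB; last exact: bmeas_cst.
    apply: bmeasM; first exact: bg.
    exact: beV.
  - exact: bmeasD.
  apply: bigmax_le => [|u Su]; first by rewrite addr_ge0// bigmax_ge_id.
  apply: le_trans (ler_normD _ _) _; apply: lerD.
    exact: (le_bigmax_cond 0 (fun u => `|\sum_(i < n) gap R s u (xv (Vf i w)) * noise Vf Af h_ i w|)).
  exact: (le_bigmax_cond 0 (fun u => `|\sum_(i < n)
   (gap R s u (xv (Vf i w)) * e_ (xv (Vf i w)) - mean PP (fun v => gap R s u (xv v) * e_ (xv v)))|)).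
rewrite meanD//; apply: le_trans (lerD M1le M2le) _.
by rewrite le_eqVlt; apply/orP; left; apply/eqP; ring.
Qed.

End Family.

Definition policy_dist2 (q q' : X -> bool) : R :=
  mean PP (fun v => (trt (q v.1.1) - trt (q' v.1.1)) ^+ 2).

(** * From finite families to the whole class, through a countable dense family *)

Section Countable.
Variables (C : set (X -> bool)) (a W : nat -> R).
Hypothesis a0 : forall k, 0 <= a k.
Hypothesis a_mono : forall k, a k <= a k.+1.
Hypothesis entC : dyadic_entropy C a.
Hypothesis sumW : forall k0 M,
  \sum_(k0 <= k < M) 2^-1 ^+ k * (1 + Num.sqrt (a k)) <= W k0.
Hypothesis Wcvg : W @ \oo --> (0 : R).
Variable s : nat -> X -> bool.
Hypothesis ms : forall j, measurable_fun setT (s j).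
Hypothesis Cs : forall j, C (s j).

Let sN N (j : 'I_N) := s j.
Let msN N j : measurable_fun setT (@sN N j). Proof. exact: ms. Qed.
Let CsN N j : C (@sN N j). Proof. exact: Cs. Qed.

Let W0 k : 0 <= W k.
Proof. by apply: le_trans (sumW k 0); rewrite big_geq. Qed.

Let half_small (e : R) : 0 < e -> exists k, (2^-1 ^+ k) ^+ 2 <= e.
Proof.
move=> e0; have h1 : `|2^-1 : R| < 1 by rewrite ger0_norm ?invr_ge0// invf_lt1// ltr1n.
have /cvgrPdist_le /(_ _ e0) [k _ /(_ k (leqnn k))] := cvg_expr h1.
rewrite sub0r normrN => kE; exists k; apply: le_trans (ler_norm _) _.
rewrite normrX expr2; apply: le_trans kE; rewrite ler_piMr//.
by rewrite normrX exprn_ile1// ltW.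
Qed.

Let sqrt_large (c : R) : exists n1, (0 < n1)%N /\ forall n, (n1 <= n)%N -> c <= Num.sqrt n%:R.
Proof.
exists (Num.truncn (c ^+ 2)).+1; split=> // n nge.
apply: le_trans (ler_norm _) _; rewrite -sqrtr_sqr ler_sqrt//.
by apply: ltW; apply: lt_le_trans (truncnS_gt _) _; rewrite ler_nat.
Qed.

Let sqrtM n : Num.sqrt n%:R * Num.sqrt n%:R = n%:R :> R.
Proof. by rewrite -expr2 sqr_sqrtr. Qed.

Lemma far_small k0 (be : R) : 0 < be -> exists n1, (0 < n1)%N /\
  forall n N, (n1 <= n)%N ->
  mean Pr (gap2_dev PP Vf xv (@sN N) n) <= be * (2 * n%:R * (2^-1 ^+ k0) ^+ 2).
Proof.
move=> be0; set z : R := (2^-1 ^+ k0) ^+ 2.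
have z0 : 0 < z by rewrite !exprn_gt0.
have [k kP] : exists k, (2^-1 ^+ k) ^+ 2 <= be * z / 32.
  by apply: half_small; rewrite !mulr_gt0.
have [n1 [n1_gt0 n1P]] := sqrt_large (32 * (1 + Num.sqrt (2 * a k)) / (be * z)).
exists n1; split=> // n N n1n; have n_gt0 := leq_trans n1_gt0 n1n.
apply: le_trans (mean_gap2_dev_le mV iidVf mxv a0 entC (@msN N) (@CsN N) n_gt0 k) _.
have bez : 0 < be * z by rewrite mulr_gt0.
have := n1P n n1n; rewrite ler_pdivrMr// => h1.
have h2 : 32 * Num.sqrt n%:R * (1 + Num.sqrt (2 * a k)) <= n%:R * (be * z).
  rewrite -[X in _ <= X * _]sqrtM -mulrA mulrCA -mulrA.
  by apply: ler_wpM2l; rewrite ?sqrtr_ge0.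
have h3 : 32 * n%:R * (2^-1 ^+ k) ^+ 2 <= n%:R * (be * z).
  have -> : n%:R * (be * z) = 32 * n%:R * (be * z / 32) by field.
  by rewrite ler_wpM2l// mulr_ge0.
apply: le_trans (lerD h2 h3) _; rewrite le_eqVlt; apply/orP; left; apply/eqP; ring.
Qed.

(** Markov's inequality for each finite maximum, with a bound free of [N]. The exceptional events
    increase with [N], so their union obeys the same bound and serves all pairs at once. *)
Lemma pairs_markov (F : nat -> nat -> Omega -> R) (S : rel nat) (c r : R) :
  (forall j j', bmeas (F j j')) ->
  (forall N, mean Pr (fun w => \big[Num.max/0]_(u : 'I_N * 'I_N | S u.1 u.2)
      `|F u.1 u.2 w|) <= c * r) -> 0 < r ->
  exists E, [/\ measurable E, (Pr E <= c%:E)%E &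
    forall w, ~ E w -> forall j j', S j j' -> `|F j j' w| <= r].
Proof.
move=> bF FM r0.
pose M N w : R := \big[Num.max/0]_(u : 'I_N * 'I_N | S u.1 u.2) `|F u.1 u.2 w|.
have bM N : bmeas (M N) by apply: bmeas_bigmax => u _; exact: bmeas_norm.
have M_ge N (j j' : 'I_N) w : S j j' -> `|F j j' w| <= M N w.
  by move=> Sjj'; exact: (le_bigmax_cond 0 (fun u : 'I_N * 'I_N => `|F u.1 u.2 w|) (j := (j, j'))).
have M_mono N N' w : (N <= N')%N -> M N w <= M N' w.
  move=> NN'; apply: bigmax_le => [|u Su]; first exact: bigmax_ge_id.
  exact: (M_ge N' (widen_ord NN' u.1) (widen_ord NN' u.2)).
pose E N := [set w | r < M N w].
have mE N : measurable (E N).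
  have mr : measurable_fun setT (fun _ : Omega => r) by [].
  have := measurable_fun_ltr mr (bM N).1 => /(_ measurableT [set true] Logic.I).
  by rewrite setTI.
have mUE : measurable (\bigcup_N E N) by exact: bigcup_measurable.
have PE N : (Pr (E N) <= c%:E)%E.
  rewrite -[Pr (E N)]fineK ?fin_num_measure// lee_fin -mean_indic//.
  rewrite -(ler_pM2r r0); apply: le_trans (FM N); rewrite mulrC -meanZ; last exact: bmeas_indic.
  apply: le_mean => [||w]; [apply: bmeasZ; exact: bmeas_indic|exact: bM|].
  rewrite indicE; case: (boolP (w \in E N)) => [/set_mem rM|_].
    by rewrite mulr1 ltW.
  by rewrite mulr0; exact: bigmax_ge_id.
exists (\bigcup_N E N); split=> //.
  apply: cvge_le (nondecreasing_cvg_mu mE mUE _); first by near=> N; exact: PE.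
  move=> N N' NN'; apply/subsetPset => w; rewrite /E /= => h.
  by apply: lt_le_trans h _; exact: M_mono.
move=> w nE j j' Sjj'; rewrite leNgt; apply/negP => Fgt.
have jm : (j < (maxn j j').+1)%N by rewrite ltnS leq_maxl.
have jm' : (j' < (maxn j j').+1)%N by rewrite ltnS leq_maxr.
apply: nE; exists (maxn j j').+1 => //; apply: lt_le_trans Fgt _.
exact: (M_ge _ (Ordinal jm) (Ordinal jm')).
Unshelve. all: by end_near. Qed.

Let bgap i j j' : bmeas (fun w => trt (s j (V i w).1.1) - trt (s j' (V i w).1.1) : R).
Proof.
have mx : measurable_fun setT (fun w => (V i w).1.1) by exact: (measurableT_comp mxv (mV i)).
by apply: bmeasB; apply: bmeas_trt; exact: (measurableT_comp (ms _) mx).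
Qed.

Let bmeas_increment n j j' : bmeas (fun w => increment n w (s j) (s j')).
Proof.
have bN i : bmeas (noise Vf Af h_ i).
  apply: (bmeas_noise mV mA (K := delta^-1)) => [b|b v].
    exact: (bmeas_half_residual hp hm hdelta).
  exact: half_residual_le.
have be : bmeas (fun v => e_ (xv v)) by exact: (bmeas_comp (bmeas_half_effect hm)).
apply: bmeasD; apply: bmeas_sum => i _; first by apply: bmeasM; [exact: bgap|exact: bN].
apply: bmeasB; last exact: bmeas_cst.
by apply: bmeasM => //; exact: (bmeas_comp be (mV i)).
Qed.

Let CC : R := 128 * delta^-1 + 256.
Let CC_gt0 : 0 < CC.
Proof.
have /andP[d0 _] := hdelta.
by apply: addr_gt0; [apply: mulr_gt0; rewrite ?invr_gt0 ?ltr0n|rewrite ltr0n].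
Qed.

Lemma increment_small (e eta : R) : 0 < e -> 0 < eta -> exists k0 n1, (0 < n1)%N /\
  forall n, (n1 <= n)%N -> exists E, [/\ measurable E, (Pr E <= eta%:E)%E &
    forall w, ~ E w -> forall j j', policy_dist2 (s j) (s j') <= 2 * (2^-1 ^+ k0) ^+ 2 ->
      `|increment n w (s j) (s j')| <= e * Num.sqrt n%:R].
Proof.
(* Chosen so that [CC * (2 z) = eta * e], the level asked for by Markov's inequality; one [z] is for
   [W k0], the other for [W 0] times the far weight. *)
move=> e0 eta0; pose z := eta * e / (2 * CC).
have z0 : 0 < z by rewrite divr_gt0 ?mulr_gt0.
have /cvgrPdist_le /(_ _ z0) [k0 _ /(_ k0 (leqnn k0))] := Wcvg.
rewrite sub0r normrN => /(le_trans (ler_norm _)) Wz.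
have be0 : 0 < z / (W 0 + 1) by rewrite divr_gt0// ltr_wpDl.
have [n1 [n1_gt0 n1P]] := far_small k0 be0.
exists k0, n1; split=> // n n1n; have n_gt0 := leq_trans n1_gt0 n1n.
have sn0 : 0 < Num.sqrt n%:R :> R by rewrite sqrtr_gt0 ltr0n.
apply: (pairs_markov (F := fun j j' w => increment n w (s j) (s j'))
  (S := fun j j' => policy_dist2 (s j) (s j') <= 2 * (2^-1 ^+ k0) ^+ 2)) => //; last by rewrite mulr_gt0.
move=> N; apply: le_trans (increment_max_le a0 a_mono entC sumW (@msN N) (@CsN N) n_gt0
  (S := fun u => policy_dist2 (s u.1) (s u.2) <= 2 * (2^-1 ^+ k0) ^+ 2)
  (k0 := k0) _ (n1P n N n1n)) _ => //.
have h : W k0 + W 0 * (z / (W 0 + 1)) <= 2 * z.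
  have : W 0 * (z / (W 0 + 1)) <= z.
    by rewrite mulrCA ger_pMr// ler_pdivrMr ?ltr_wpDl// mul1r lerDl.
  by move=> h; rewrite (_ : 2 * z = z + z) ?lerD// mulr_natl mulr2n.
apply: le_trans (_ : CC * (Num.sqrt n%:R * (2 * z)) <= _).
  by rewrite ler_pM2l// ler_pM2l.
rewrite le_eqVlt; apply/orP; left; apply/eqP; rewrite /z; field.
by rewrite gt_eqF.
Qed.

Lemma increment_bounded (e eta : R) : 0 < e -> 0 < eta -> exists n1, (0 < n1)%N /\
  forall n, (n1 <= n)%N -> exists E, [/\ measurable E, (Pr E <= eta%:E)%E &
    forall w, ~ E w -> forall j j', `|increment n w (s j) (s j')| <= e * n%:R].
Proof.
move=> e0 eta0; have [n1 [n1_gt0 n1P]] := far_small 0 (ltr01 : 0 < 1 :> R).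
have [n2 [n2_gt0 n2P]] := sqrt_large (CC * (W 0 + W 0 * 1) / (eta * e)).
exists (maxn n1 n2); split; first by rewrite leq_max n1_gt0.
move=> n; rewrite geq_max => /andP[n1n n2n]; have n_gt0 := leq_trans n1_gt0 n1n.
have [] := pairs_markov (F := fun j j' w => increment n w (s j) (s j'))
  (S := fun j j' => true) (c := eta) (r := e * n%:R).
- by move=> j j'; exact: bmeas_increment.
- move=> N; apply: le_trans (increment_max_le a0 a_mono entC sumW (@msN N) (@CsN N) n_gt0
    (S := xpredT) (k0 := 0) _ (n1P n N n1n)) _ => //.
  have := n2P n n2n; rewrite ler_pdivrMr ?mulr_gt0// => h.
  rewrite -[X in _ <= _ * (_ * X)]sqrtM -/CC mulrCA.
  have -> : eta * (e * (Num.sqrt n%:R * Num.sqrt n%:R)) =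
    Num.sqrt n%:R * (Num.sqrt n%:R * (eta * e)) :> R by ring.
  by rewrite ler_wpM2l// sqrtr_ge0.
- by rewrite mulr_gt0// ltr0n.
by move=> E [mE PE h]; exists E; split=> // w nE j j'; exact: h.
Qed.

(** The event of agreement has probability at least 1/2, so it is not empty: one deterministic
    sample reproduces all the true distances up to [e]. *)
Lemma gap2_close (e : R) : 0 < e -> exists n w, (0 < n)%N /\ forall j j',
  `|\sum_(i < n) ((trt (s j (V i w).1.1) - trt (s j' (V i w).1.1)) ^+ 2 - policy_dist2 (s j) (s j'))|
    <= e * n%:R.
Proof.
move=> e0; have e4 : 0 < e / 4 by rewrite divr_gt0.
have [n [n_gt0 nP]] := far_small 0 e4; exists n.
have [] := pairs_markov (F := fun j j' w => \sum_(i < n)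
     ((trt (s j (V i w).1.1) - trt (s j' (V i w).1.1)) ^+ 2 - policy_dist2 (s j) (s j')))
  (S := fun j j' => true) (c := 2^-1) (r := e * n%:R).
- move=> j j'; apply: bmeas_sum => i _; apply: bmeasB; last exact: bmeas_cst.
  by rewrite (_ : (fun _ => _) = fun w => (trt (s j (V i w).1.1) - trt (s j' (V i w).1.1)) *
    (trt (s j (V i w).1.1) - trt (s j' (V i w).1.1)))//; exact: bmeasM.
- move=> N; apply: le_trans (nP n N (leqnn n)) _.
  by rewrite expr0 expr1n le_eqVlt; apply/orP; left; apply/eqP; field.
- by rewrite mulr_gt0// ltr0n.
move=> E [mE PE h].
have [w nEw] : exists w, ~ E w.
  apply/existsNP => allE; have ET : E = setT by apply/seteqP; split.
  move: PE; rewrite ET probability_setT lee_fin; lra.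
by exists w; split=> // j j'; exact: h.
Qed.

Hypothesis mC : forall q, C q -> measurable_fun setT q.
Hypothesis dense : forall q, C q -> exists u : nat -> nat, forall x,
  \forall k \near \oo, s (u k) x = q x.

Let differ (q q' : X -> bool) (v : fulldata X R) : R := (q v.1.1 != q' v.1.1)%:R.

Let bmeas_differ q q' : measurable_fun setT q -> measurable_fun setT q' ->
  bmeas (differ q q').
Proof.
move=> mq mq'; have bt (h : X -> bool) : measurable_fun setT h ->
    bmeas (fun v : fulldata X R => trt (h v.1.1) : R).
  by move=> mh; apply: bmeas_trt; exact: (measurableT_comp mh mxv).
rewrite (_ : differ q q' = fun v => 4^-1 * ((trt (q v.1.1) - trt (q' v.1.1)) *
    (trt (q v.1.1) - trt (q' v.1.1)))).
  by apply: bmeasZ; apply: bmeasM; apply: bmeasB; exact: bt.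
by apply/funext => v; rewrite /differ /trt; case: (q _); case: (q' _) => /=; field.
Qed.

(** Convergence of boolean values is eventual equality, which settles the finitely many sample
    points at once; dominated convergence settles the mean. *)
Let approx q n w (e : R) : C q -> 0 < e -> exists j,
  (forall i, (i < n)%N -> s j (V i w).1.1 = q (V i w).1.1) /\ mean PP (differ (s j) q) <= e.
Proof.
move=> Cq e0; have [u uq] := dense Cq.
have b k := bmeas_differ (ms (u k)) (mC Cq).
have /fine_cvgP[_ /cvgrPdist_le /(_ _ e0) small] :
    (\int[PP]_v (differ (s (u k)) q v)%:E)%E @[k --> \oo] --> (0%R)%:E.
  rewrite (_ : (0%R)%:E = \int[PP]_v 0%E)%E; last by rewrite integral0.
  apply: (@dominated_cvg _ _ _ PP setT measurableT
    (fun k v => (differ (s (u k)) q v)%:E) (fun=> 0%E) (fun=> 1%E)) => //.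
  - by move=> k; apply/measurable_EFinP; case: (b k).
  - move=> v _; apply: cvg_near_cst; near=> k.
    by rewrite /differ (near (uq v.1.1) k)// eqxx.
  - by apply: (bmeas_integrable PP (bmeas_cst (fulldata X R) 1)).
  - by move=> k v _; rewrite abse_EFin lee_fin /differ; case: (_ != _); rewrite ?normr1 ?normr0.
have agree : \forall k \near \oo, forall i, (i < n)%N -> s (u k) (V i w).1.1 = q (V i w).1.1.
  have : \forall k \near \oo, forall i : 'I_n, s (u k) (V i w).1.1 = q (V i w).1.1.
    by apply: filter_forall => i; exact: uq.
  by apply: filterS => k h i ni; exact: (h (Ordinal ni)).
have [k _ kP] : \forall k \near \oo,
    (forall i, (i < n)%N -> s (u k) (V i w).1.1 = q (V i w).1.1) /\
    mean PP (differ (s (u k)) q) <= e.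
  apply: filterS2 agree small => k h1 h2; split=> //.
  by move: h2; rewrite sub0r normrN; exact: le_trans (ler_norm _).
by exists (u k); exact: (kP k (leqnn k)).
Unshelve. all: by end_near. Qed.

Let bmeas_pair q q' (F : bool -> bool -> X -> R) : C q -> C q' ->
  (forall b b', bmeas (F b b')) -> bmeas (fun v : fulldata X R => F (q v.1.1) (q' v.1.1) v.1.1).
Proof.
move=> Cq Cq' bF; have bt (h : X -> bool) : C h -> bmeas (fun x => (h x)%:R : R).
  by move=> Ch; exact: bmeas_natr (mC Ch).
apply: (bmeas_comp (f := fun x => F (q x) (q' x) x)) => //.
rewrite (_ : (fun _ => _) = fun x => (q x)%:R * ((q' x)%:R * F true true x +
      (1 - (q' x)%:R) * F true false x) +
    (1 - (q x)%:R) * ((q' x)%:R * F false true x + (1 - (q' x)%:R) * F false false x)).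
  have bI (h : X -> bool) (f g0 : X -> R) : C h -> bmeas f -> bmeas g0 ->
      bmeas (fun x => (h x)%:R * f x + (1 - (h x)%:R) * g0 x).
    move=> Ch bf bg0; have bh := bt h Ch; apply: bmeasD; apply: bmeasM => //.
    by apply: bmeasB => //; exact: bmeas_cst.
  by apply: (bI q) => //; exact: bI.
by apply/funext => x; case: (q x); case: (q' x);
  rewrite /= ?subrr ?subr0 ?mul1r ?mul0r ?addr0 ?add0r.
Qed.

Let mean_pair_close q q' j j' (F : bool -> bool -> X -> R) (K e : R) :
  C q -> C q' -> (forall b b', bmeas (F b b')) -> (forall b b' x, `|F b b' x| <= K) ->
  mean PP (differ (s j) q) <= e -> mean PP (differ (s j') q') <= e ->
  `|mean PP (fun v => F (q v.1.1) (q' v.1.1) v.1.1) -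
    mean PP (fun v => F (s j v.1.1) (s j' v.1.1) v.1.1)| <= 4 * K * e.
Proof.
move=> Cq Cq' bF FK h h'; have K0 : 0 <= K by apply: le_trans (FK true true point).
have bq := bmeas_pair Cq Cq' bF; have bs := bmeas_pair (Cs j) (Cs j') bF.
have bd := bmeas_differ (ms j) (mC Cq); have bd' := bmeas_differ (ms j') (mC Cq').
rewrite -meanB//; apply: le_trans (mean_norm _ (bmeasB bq bs)) _.
apply: le_trans (_ : mean PP (fun v => 2 * K * (differ (s j) q v + differ (s j') q' v)) <= _).
  apply: le_mean => [||v]; [exact: bmeas_norm (bmeasB bq bs)|by apply: bmeasZ; exact: bmeasD|].
  rewrite /differ; have [->|ne] := eqVneq (s j v.1.1) (q v.1.1).
    have [->|ne'] := eqVneq (s j' v.1.1) (q' v.1.1).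
      by rewrite subrr normr0 addr0 mulr0.
    rewrite /= add0r mulr1; apply: le_trans (ler_normB _ _) _.
    by rewrite (_ : 2 * K = K + K) ?lerD// mulr_natl mulr2n.
  apply: le_trans (_ : 2 * K * 1 <= _).
    rewrite mulr1; apply: le_trans (ler_normB _ _) _.
    by rewrite (_ : 2 * K = K + K) ?lerD// mulr_natl mulr2n.
  by rewrite ler_wpM2l ?mulr_ge0// lerDl.
rewrite meanZ ?meanD//; last exact: bmeasD.
rewrite (_ : 4 * K * e = 2 * K * (e + e)); last by ring.
by rewrite ler_wpM2l ?mulr_ge0// lerD.
Qed.

Let approx_pair q q' n w (e : R) : C q -> C q' -> 0 < e -> exists j j',
  [/\ forall i, (i < n)%N -> s j (V i w).1.1 = q (V i w).1.1,
      forall i, (i < n)%N -> s j' (V i w).1.1 = q' (V i w).1.1,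
      `|policy_dist2 q q' - policy_dist2 (s j) (s j')| <= e &
      `|increment n w q q' - increment n w (s j) (s j')| <= e].
Proof.
(* A mean moves by at most [4 * K] times the tolerance, with [K = 4] for squared distances and
   [K = 2] for increments, where it is summed [n] times; [n.+1] also covers [n = 0]. *)
move=> Cq Cq' e0; pose c : R := 16 * n.+1%:R.
have c0 : 0 < c by rewrite mulr_gt0// ltr0n.
have ec0 : 0 < e / c by rewrite divr_gt0.
have [j [jq jd]] := approx n w Cq ec0; have [j' [jq' jd']] := approx n w Cq' ec0.
have ecE : 16 * (e / c) * n.+1%:R = e.
  by rewrite /c; field; rewrite nat1r pnatr_eq0.
exists j, j'; split=> //.
  apply: le_trans (mean_pair_close (F := fun b b' x => (trt b - trt b') ^+ 2) (K := 4)
    Cq Cq' _ _ jd jd') _.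
  - by move=> b b'; exact: bmeas_cst.
  - by move=> b b' x; rewrite /trt; case: b; case: b'; rewrite ?subrr ?expr0n ?normr0//;
      rewrite ger0_norm ?sqr_ge0//; lra.
  rewrite -natrM -[leRHS]ecE ler_peMr//; last by rewrite ler1n.
  by rewrite mulr_ge0// ltW.
have -> : increment n w (s j) (s j') =
  \sum_(i < n) (trt (q (V i w).1.1) - trt (q' (V i w).1.1)) * h_ (A i w) (V i w) +
  \sum_(i < n) ((trt (q (V i w).1.1) - trt (q' (V i w).1.1)) * e_ (V i w).1.1 -
     mean PP (fun v => (trt (s j v.1.1) - trt (s j' v.1.1)) * e_ v.1.1)).
  by congr (_ + _); apply: eq_bigr => i _; rewrite jq// jq'.
rewrite /increment opprD addrACA subrr add0r -sumrB.
apply: le_trans (ler_norm_sum _ _ _) _.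
apply: le_trans (_ : \sum_(i < n) 16 * (e / c) <= _); last first.
  rewrite sumr_const card_ord -[_ *+ n]mulr_natr -[leRHS]ecE ler_wpM2l ?ler_nat//.
  by rewrite mulr_ge0// ltW.
apply: ler_sum => i _; rewrite opprB addrC addrA subrK distrC.
apply: le_trans (mean_pair_close (F := fun b b' x => (trt b - trt b') * e_ x) (K := 2)
    Cq Cq' _ _ jd jd') _.
- by move=> b b'; apply: bmeasZ; exact: (bmeas_half_effect hm).
- move=> b b' x; rewrite normrM; apply: le_trans (_ : 2 * 1 <= _); last by rewrite mulr1.
  apply: ler_pM => //; last exact: half_effect_le.
  by rewrite /trt; case: b; case: b'; rewrite ?subrr ?normr0// ler_norml; apply/andP; split; lra.
by rewrite -natrM ler_wpM2r ?ler_nat// ltW.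
Qed.

Lemma increment_small_class (e eta : R) : 0 < e -> 0 < eta -> exists r n1, 0 < r /\
  forall n, (n1 <= n)%N -> exists E, [/\ measurable E, (Pr E <= eta%:E)%E &
    forall w, ~ E w -> forall q q', C q -> C q' -> policy_dist2 q q' <= r ->
      `|increment n w q q'| <= e * Num.sqrt n%:R].
Proof.
move=> e0 eta0; have [k0 [n1 [_ n1P]]] := increment_small e0 eta0.
have z0 : 0 < (2^-1 ^+ k0) ^+ 2 :> R by rewrite !exprn_gt0.
(* Half of the threshold of [increment_small]: the other half absorbs the change of distance in
   passing to the dense family. *)
exists ((2^-1 ^+ k0) ^+ 2), n1; split=> // n /n1P[E [mE PE EP]]; exists E; split=> //.
move=> w nE q q' Cq Cq' dqq'; apply/ler_addgt0Pr => c c0.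
have c'0 : 0 < Num.min c ((2^-1 ^+ k0) ^+ 2) by rewrite lt_min c0.
have [j [j' [_ _]]] := approx_pair n w Cq Cq' c'0.
rewrite !le_min => /andP[_ dd] /andP[ii _].
have := EP w nE j j'; rewrite (_ : policy_dist2 _ _ <= _ = true); last first.
  move: dd; rewrite distrC => /(le_trans (ler_norm _)); rewrite lerBlDr => /le_trans; apply.
  by rewrite mulr_natl mulr2n lerD.
move=> /(_ erefl) small; rewrite -[increment n w q q'](subrK (increment n w (s j) (s j'))) addrC.
by apply: le_trans (ler_normD _ _) _; exact: lerD.
Qed.

Lemma increment_bounded_class (e eta : R) : 0 < e -> 0 < eta -> exists n1,
  forall n, (n1 <= n)%N -> exists E, [/\ measurable E, (Pr E <= eta%:E)%E &
    forall w, ~ E w -> forall q q', C q -> C q' -> `|increment n w q q'| <= e * n%:R].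
Proof.
move=> e0 eta0; have [n1 [_ n1P]] := increment_bounded e0 eta0.
exists n1 => n /n1P[E [mE PE EP]]; exists E; split=> //.
move=> w nE q q' Cq Cq'; apply/ler_addgt0Pr => c c0.
have [j [j' [_ _ _ ii]]] := approx_pair n w Cq Cq' c0.
rewrite -[increment n w q q'](subrK (increment n w (s j) (s j'))) addrC.
by apply: le_trans (ler_normD _ _) _; apply: lerD => //; exact: EP.
Qed.

(** Policies are classified by their traces on the sample of [gap2_close]: equal traces have
    empirical distance zero, hence true distance at most [e]. *)
Lemma finite_partition (e : R) : 0 < e -> exists (T : finType) (cl : (X -> bool) -> T),
  forall q q', C q -> C q' -> cl q = cl q' -> policy_dist2 q q' <= e.
Proof.
move=> e0; have [n [w [n_gt0 close]]] := gap2_close e0.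
exists {ffun 'I_n -> bool}, (fun q => [ffun i => q (V (val i) w).1.1]) => q q' Cq Cq' /ffunP tr.
apply/ler_addgt0Pr => c c0; have [j [j' [jq jq' dd _]]] := approx_pair n w Cq Cq' c0.
have d2s : policy_dist2 (s j) (s j') <= e.
  have n0R : 0 < n%:R :> R by rewrite ltr0n.
  have := close j j'; rewrite (eq_bigr (fun=> - policy_dist2 (s j) (s j'))) => [|i _]; last first.
    have := tr i; rewrite !ffunE jq// jq'// => ->.
    by rewrite subrr expr0n /= sub0r.
  rewrite sumr_const card_ord -[_ *+ n]mulr_natr mulNr normrN => /(le_trans (ler_norm _)).
  by rewrite ler_pM2r.
rewrite -[policy_dist2 q q'](subrK (policy_dist2 (s j) (s j'))) addrC lerD//.
by apply: le_trans dd; exact: ler_norm.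
Qed.

(* Only finitely many classes have to be inspected. *)
Lemma near_peak (U : (X -> bool) -> R) (M r : R) : 0 < r -> exists2 e0, 0 < e0 &
  forall q, C q -> M - e0 <= U q -> forall e, 0 < e ->
  exists q', [/\ C q', policy_dist2 q' q <= r & M - e <= U q'].
Proof.
move=> r0; have [T [cl clP]] := finite_partition r0.
(* Either the class of [c] contains near-maximizers of every precision, or some [e0] bars its
   members from being within [e0] of [M]. The minimum of these finitely many thresholds is the
   required one. *)
have good (c : T) : exists e0 : R, 0 < e0 /\
    ((exists2 q, C q & cl q = c /\ M - e0 <= U q) ->
     forall e, 0 < e -> exists q', [/\ C q', cl q' = c & M - e <= U q']).
  have [all_e|] := pselect (forall e, 0 < e -> exists q', [/\ C q', cl q' = c & M - e <= U q']).
    by exists 1; split.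
  move=> /existsNP[e0 /not_implyP[e00 no]]; exists e0; split=> // -[q Cq [qc Uq]].
  by case: no; exists q.
have [f fP] := choice good.
exists (\big[Num.min/1]_c f c).
  by apply: lt_bigmin => // c _; case: (fP c).
move=> q Cq Uq e e_gt0; have [_ /(_ _ e e_gt0)[]] := fP (cl q).
  exists q => //; split=> //; apply: le_trans Uq; rewrite lerD2l lerN2.
  by apply: bigmin_le_cond.
by move=> q' [Cq' cq' Uq']; exists q'; split=> //; exact: clP.
Qed.

End Countable.

Lemma value_le1 q : measurable_fun setT q -> value P m q <= 1.
Proof.
move=> mq; rewrite (value_mean hp hm hdelta hoverlap hY hconsistent mq).
apply: le_trans (ler_norm _) _; apply: norm_mean_le => [|v].
  rewrite (_ : (fun _ => _) = fun v : fulldata X R => mc m false v.1.1 +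
      (q v.1.1)%:R * (mc m true v.1.1 - mc m false v.1.1)); last first.
    by apply/funext => v; case: (q _); rewrite /= ?mul1r ?mul0r ?addr0// addrC subrK.
  have bm b : bmeas (fun v : fulldata X R => mc m b v.1.1) by exact: (bmeas_comp (bmeas_mc hm b)).
  apply: bmeasD => //; apply: bmeasM; last exact: bmeasB.
  by apply: bmeas_natr; exact: (measurableT_comp mq mxv).
by have /andP[h0 h1] := clamp01 (m (q v.1.1) v.1.1); rewrite ger0_norm.
Qed.

End DesignProcess.

(** * Passage from the increments of the process to the regret *)

Lemma cvge0P (R : realType) (u : nat -> \bar R) : (forall n, (0 <= u n)%E) ->
  u @ \oo --> 0%E <-> forall e : R, 0 < e -> \forall n \near \oo, (u n <= e%:E)%E.
Proof.
move=> u0; split=> [/fine_cvgP[ufin /cvgrPdist_le ucvg] e e0|small].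
  apply: filterS2 ufin (ucvg e e0) => n un; rewrite sub0r normrN => /(le_trans (ler_norm _)).
  by rewrite -lee_fin /= fineK.
have ufin : \forall n \near \oo, u n \is a fin_num.
  apply: filterS (small 1 ltr01) => n un1; rewrite ge0_fin_numE//.
  by apply: le_lt_trans un1 _; rewrite ltry.
apply/fine_cvgP; split=> //; apply/cvgrPdist_le => e e0.
apply: filterS2 ufin (small e e0) => n un une; rewrite sub0r normrN ger0_norm ?fine_ge0//.
by rewrite -lee_fin fineK.
Qed.

(** For {-1, 1}-valued functions, being within distance 1 of the limit is equality with it. *)
Lemma separable_enum (X : Type) (R : realType) (C : set (X -> bool)) : C !=set0 ->
  separable_class (pm_class C : set (X -> R)) ->
  exists s : nat -> X -> bool, (forall j, C (s j)) /\
    forall q, C q -> exists u : nat -> nat, forall x, \forall k \near \oo, s (u k) x = q x.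
Proof.
move=> [q0 Cq0] [F0 [F0C cF0 F0d]].
have [u0 F0u0 _] := F0d _ (ex_intro2 _ _ q0 Cq0 erefl).
move: cF0 => /pfcard_geP[F00|[e]].
  by have := F0u0 0; rewrite F00.
have lift j : exists q : X -> bool, C q /\ (fun x => trt (q x)) = e j.
  by have [q Cq qe] := F0C _ (funS (s := e) j Logic.I); exists q.
have [s sP] := choice lift.
exists s; split=> [j|q Cq]; first by case: (sP j).
have [v F0v vq] := F0d _ (ex_intro2 _ _ q Cq erefl).
have index k : exists j, e j = v k.
  by have [j _ <-] := surj (f := e) (F0v k); exists j.
have [u uP] := choice index.
exists u => x; have /cvgrPdist_lt /(_ 1 ltr01) := vq x; apply: filterS => k.
rewrite -(uP k) -(sP (u k)).2 /trt; case: (q x); case: (s (u k) x) => //.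
- by rewrite opprK => /(le_lt_trans (ler_norm _)); rewrite gtrDl ltNge ler01.
- by rewrite distrC opprK => /(le_lt_trans (ler_norm _)); rewrite gtrDl ltNge ler01.
Qed.

Theorem corollary14 (R : realType) (dX dO : measure_display)
  (X : measurableType dX) (Omega : measurableType dO)
  (* reference law *)
  (P : probability (obs X R) R) (p m : bool -> X -> R) (delta : R)
  (hp : is_propensity P p) (hm : is_regression P m)
  (hdelta : 0 < delta < 2^-1)
  (hoverlap : {ae P, forall o, delta <= p true o.1.1 <= 1 - delta})
  (hY : {ae P, forall o, 0 <= o.2 <= 1})
  (* full data *)
  (PP : probability (fulldata X R) R)
  (hZ : {ae PP, forall v, forall a, 0 <= potential v a <= 1})
  (hconsistent : forall C : set (obs X R), measurable C ->
     P C = sampling_law PP p [set ow | C ow.1])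
  (Pr : probability Omega R)
  (V : nat -> {RV Pr >-> fulldata X R}) (A : nat -> {RV Pr >-> bool})
  (hiid : iid_from PP V)
  (* design *)
  (t xi kappa : nat -> R) (G : nat -> R -> R) (htuning : tuning t xi kappa G)
  (I : Type) (Q : I -> bool -> X -> R) (B : nat -> set I)
  (hQ01 : forall n b, B n b -> forall a x, 0 <= Q b a x <= 1)
  (hQmeas : forall n b, B n b -> forall a, measurable_fun setT (Q b a))
  (n0 : nat) (hn0 : (1 <= n0)%N)
  (beta : forall n : nat, n.-tuple (obs X R) -> I)
  (hdesign : sequential_design V A p n0 G Q B beta)
  (* complexity of the policy class *)
  (hsep : separable_class (pm_class (policies Q B) : set (X -> R)))
  (hJ1 : forall eta : nat -> R, (forall n, 0 <= eta n) ->
     eta @ \oo --> (0 : R) ->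
     J1 (eta n) (pm_class (policies Q B)) @[n --> \oo] --> (0 : \bar R))
  (* estimator of the value and data-dependent policy *)
  (Vhat : forall n : nat, n.-tuple (obs X R) -> (X -> bool) -> R)
  (hVhat : oP Pr
     (fun n w => ereal_sup [set
        `|Num.sqrt n%:R * (Vhat n (data V A n w) pi - value P m pi)
          - Gtilde PP V A p n0 G Q beta n w
              (fun ow => f_pol P p m pi ow.1)|%:E | pi in policies Q B])
     (fun _ => 1))
  (pihat : forall n : nat, n.-tuple (obs X R) -> (X -> bool))
  (hpihat : forall n h, policies Q B (pihat n h))
  (rem : nat -> Omega -> \bar R)
  (hrem : oP Pr rem (fun n => (Num.sqrt n%:R)^-1))
  (hnearmax : forall n w,
     (ereal_sup [set (Vhat n (data V A n w) pi)%:E | pi in policies Q B]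
        - rem n w
      <= (Vhat n (data V A n w) (pihat n (data V A n w)))%:E)%E) :
  oP Pr (fun n w => regret P m (policies Q B) (pihat n (data V A n w)))
        (fun n => (Num.sqrt n%:R)^-1).
Proof.
pose C := policies Q B.
have C0 : C !=set0 by exists (pihat 0%N [tuple]); exact: hpihat.
have mC q : C q -> measurable_fun setT q.
  by move=> [b [n _ Bb] <-]; apply: measurable_fun_ler; exact: (hQmeas _ _ Bb).
have [a [W [a0 a_mono entC sumW Wcvg]]] := entropy_of_J1 C0 hJ1.
have [s [Cs dense]] := separable_enum C0 hsep.
have ms j : measurable_fun setT (s j) by exact: mC.
pose VV := value P m; pose Vs := sup [set VV q | q in C].
have VV_ub : has_ubound [set VV q | q in C].
  exists 1 => _ [q Cq <-].
  exact: (value_le1 hp hm hdelta hoverlap hY hconsistent (mC q Cq)).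
have VV_ne : [set VV q | q in C] !=set0 by case: C0 => q Cq; exists (VV q), q.
have VV_le q : C q -> VV q <= Vs by move=> Cq; apply: sup_upper_bound => //; exists q.
have regretE q : regret P m C q = (Vs - VV q)%:E.
  rewrite /regret (_ : [set _ | _ in C] = [set x%:E | x in [set VV q | q in C]]).
    by rewrite ereal_sup_EFin// EFinB.
  by rewrite image_comp.
have mu0 S : (0 <= mu_ext Pr S)%E by exact: mu_ext_ge0.
move=> e e0; apply/cvge0P => [n|eta4 eta4_gt0]; first exact: mu0.
(* Four exceptional events of outer probability at most [eta] each: the linear expansion, the
   remainder, and the two bounds on increments. The null set of unsound samples adds nothing. *)
pose eta := eta4 / 4; have eta0 : 0 < eta by rewrite divr_gt0.
(* Two errors of the linear expansion, one of near-maximization, one increment and the gap left by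
   the near-maximizer [q] add up to [5 c], below the [6 c = e] of a bad sample. *)
pose c := e / 6; have c0 : 0 < c by rewrite divr_gt0.
have [r [n1 [r0 small]]] := increment_small_class hp hm hdelta hoverlap hY hZ hconsistent hiid
  htuning hdesign a0 a_mono entC sumW Wcvg ms Cs mC dense c0 eta0.
(* The radius [r] of equicontinuity is fixed first. It determines the precision [e1] to which the
   value of the selected policy must approach the supremum, and the crude bound is then invoked at
   [e1 / 2]. *)
have [e1 e1_gt0 peak] := near_peak p delta hm A hiid a0 entC ms Cs mC dense VV Vs r0.
have e12 : 0 < e1 / 2 by rewrite divr_gt0.
have [n2 bounded] := increment_bounded_class hp hm hdelta hoverlap hY hZ hconsistent hiid
  htuning hdesign a0 a_mono entC sumW ms Cs mC dense e12 eta0.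
have close := (cvge0P (fun n => mu0 _)).1 (hVhat c c0) eta eta0.
have rem_small := (cvge0P (fun n => mu0 _)).1 (hrem c c0) eta eta0.
have [N [mN PN0 subN]] := ae_sound_sample hp hm hdelta hoverlap hY hZ hconsistent hiid.
pose n3 := (Num.truncn ((e1^-1 * (6 * c)) ^+ 2)).+1.
apply: filterS3 close rem_small (nbhs_infty_ge (maxn n3 (maxn n1 n2))) => n close_n rem_n.
rewrite !geq_max => /and3P[n3n n1n n2n].
have n_gt0 : (0 < n)%N by exact: leq_trans n3n.
pose L : R := Num.sqrt n%:R.
have L0 : 0 < L by rewrite sqrtr_gt0 ltr0n.
have LL : L * L = n%:R by rewrite -expr2 sqr_sqrtr.
(* For such [n] the [3 c] of [main] takes at most half of [e1 * L], leaving the other half to the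
   increment. *)
have L_large : 6 * c <= e1 * L.
  rewrite -ler_pdivrMl//; apply: le_trans (ler_norm _) _.
  rewrite -sqrtr_sqr ler_sqrt//; apply/ltW/(lt_le_trans (truncnS_gt _)).
  by rewrite ler_nat.
have [E4 [mE4 PE4 sm]] := small n n1n.
have [E5 [mE5 PE5 bnd]] := bounded n n2n.
set bad := [set w | _].
pose E1 := [set w | ((c * 1)%:E < `|ereal_sup [set
        `|L * (Vhat n (data V A n w) pi - value P m pi)
          - Gtilde PP V A p n0 G Q beta n w (fun ow => f_pol P p m pi ow.1)|%:E
        | pi in policies Q B]|)%E].
pose E2 := [set w | ((c * L^-1)%:E < `|rem n w|)%E].
have sub : bad `<=` E1 `|` (E2 `|` (N `|` (E4 `|` E5))).
  move=> w badw; apply: contrapT => /not_orP[nE1 /not_orP[nE2 /not_orP[nN /not_orP[nE4 nE5]]]].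
  pose h := data V A n w; pose pih := pihat n h; pose Vh := Vhat n h.
  pose Gt q := Gtilde PP V A p n0 G Q beta n w (fun ow => f_pol P p m q ow.1).
  have Cpih : C pih by exact: hpihat.
  have sw : forall i, sound p m delta (V i w) by apply: contrapT => /subN.
  have VhP q : C q -> `|L * (Vh q - VV q) - Gt q| <= c.
    move=> Cq; rewrite leNgt; apply/negP => lt_c; apply: nE1; rewrite /E1 /= mulr1.
    apply: lt_le_trans (lee_abs _); apply: lt_le_trans (ereal_sup_ubound _); last first.
      by exists q.
    by rewrite lte_fin.
  have remP : (`|rem n w| <= (c * L^-1)%:E)%E by rewrite leNgt; apply/negP.
  have rfin : rem n w \is a fin_num.
    by rewrite -abse_fin_num ge0_fin_numE// (le_lt_trans remP)// ltry.
  have maxP q : C q -> Vh q <= Vh pih + c * L^-1.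
    move=> Cq; have sup_ge : ((Vh q)%:E <= ereal_sup [set (Vh pi)%:E | pi in C])%E.
      by apply: ereal_sup_ubound; exists q.
    have := le_trans (leeB sup_ge (lexx (rem n w))) (hnearmax n w).
    rewrite -/h -/pih -/Vh -(fineK rfin) -EFinB lee_fin lerBlDr => /le_trans; apply.
    rewrite lerD2l; apply: le_trans (ler_norm _) _.
    by move: remP; rewrite -{1}(fineK rfin) abse_EFin lee_fin.
  have GtP q : C q -> Gt q - Gt pih = L^-1 * increment p m delta PP V A n w q pih.
    move=> Cq; exact: (Gtilde_diff hp hm hdelta hoverlap hY hZ hconsistent htuning hQmeas hdesign
      n (mC q Cq) (mC pih Cpih) sw).
  have main q : C q -> L * (VV q - VV pih) <=
      3 * c + L^-1 * `|increment p m delta PP V A n w q pih|.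
    move=> Cq; have := VhP q Cq; have := VhP pih Cpih.
    rewrite !ler_norml => /andP[_ h1] /andP[h2 _].
    have h3 : L * (Vh q - Vh pih) <= c.
      have := maxP q Cq; rewrite -lerBlDl -(ler_pM2l L0) mulrCA divff ?gt_eqF// mulr1.
      exact.
    have h4 : Gt pih - Gt q <= L^-1 * `|increment p m delta PP V A n w q pih|.
      rewrite -opprB GtP// -mulrN ler_wpM2l ?invr_ge0 ?(ltW L0)//.
      by rewrite -normrN; exact: ler_norm.
    move: h1 h2 h3 h4; rewrite !mulrBr; set x1 := L * _; set x2 := L * _; set x3 := L * _.
    set x4 := L * _; set x5 := L^-1 * _; lra.
  (* Consistency: comparison with an arbitrary policy, by the crude bound valid for all
     increments. *)
  have near_opt : Vs - e1 <= VV pih.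
    rewrite lerBlDr; apply: sup_le_ub => // _ [q Cq <-].
    have diff := main q Cq; have inc := bnd w nE5 q pih Cq Cpih.
    have {}inc : L^-1 * `|increment p m delta PP V A n w q pih| <= e1 / 2 * L.
      by rewrite ler_pdivrMl// mulrCA LL.
    rewrite -lerBlDl -(ler_pM2l L0); apply: le_trans diff _.
    by move: inc L_large; clear; rewrite [L * e1]mulrC [e1 / 2 * L]mulrAC; lra.
  have cL0 : 0 < c / L by rewrite divr_gt0.
  (* Second comparison, now with a near-maximizer within distance [r] of the selected policy, where
     the increment is at most [c] times [sqrt n]. *)
  have [q [Cq dq Vq]] := peak pih Cpih near_opt (c / L) cL0.
  have diff := main q Cq; have inc := sm w nE4 q pih Cq Cpih dq.
  have {}inc : L^-1 * `|increment p m delta PP V A n w q pih| <= c.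
    by rewrite ler_pdivrMl// mulrC.
  have badw' : e * L^-1 < Vs - VV pih.
    move: badw; rewrite /bad /= regretE lte_fin ger0_norm// subr_ge0.
    exact: VV_le.
  have {}badw' : 6 * c < L * (Vs - VV pih).
    have -> : 6 * c = e by rewrite /c; field.
    by rewrite -ltr_pdivrMl// mulrC.
  have {}Vq : L * Vs - c <= L * VV q.
    by move: Vq; rewrite -(ler_pM2l L0) mulrBr mulrCA divff ?gt_eqF// mulr1.
  move: badw' Vq diff inc; rewrite !mulrBr.
  move: (L * Vs) (L * VV pih) (L * VV q) (L^-1 * _) => x1 x2 x3 x4 h1 h2 h3 h4.
  by lra.
apply: (le_trans (le_mu_ext Pr sub)).
have U2 (S T : set Omega) (x y : R) : (mu_ext Pr S <= x%:E)%E -> (mu_ext Pr T <= y%:E)%E ->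
    (mu_ext Pr (S `|` T) <= (x + y)%:E)%E.
  by move=> Sx Ty; apply: le_trans (outer_measureU2 _ _ _) _; rewrite EFinD; exact: leeD.
rewrite (_ : eta4 = eta + (eta + (0 + (eta + eta)))); last by rewrite /eta; field.
apply: (U2 _ _ _ _); first exact: close_n.
apply: (U2 _ _ _ _); first exact: rem_n.
apply: (U2 _ _ _ _); first by rewrite measurable_mu_extE// le_eqVlt; apply/orP; left; apply/eqP; exact: PN0.
by apply: (U2 _ _ _ _); rewrite measurable_mu_extE.
Qed.
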